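(* Let $(\Omega,d,\mu)$ be a locally compact, non-complete metric measure space, with $\mu$ a doubling measure, such that $\Omega$ is a uniform domain in its completion $\overline\Omega$. Suppose also that $\partial\Omega:=\overline\Omega\setminus\Omega$ is bounded and is equipped with a Borel measure $\nu$ which is codimension $\theta$ Ahlfors regular with respect to $\mu$ for some $\theta>0$. Let $0<\alpha<1$, $1\le p<\infty$, and $1\le q\le\infty$ be such that $0<\alpha-\theta/p<1$. Then there exists a bounded linear trace operator $$T:B^\alpha_{p,q}(\Omega,\mu)\to B^{\alpha-\theta/p}_{p,q}(\partial\Omega,\nu)$$ such that for all $u\in B^\alpha_{p,q}(\Omega,\mu)$ we have $$\lim_{r\to 0^+}\frac{1}{\mu(B(z,r))}\int_{B(z,r)}|u-Tu(z)|^p\,d\mu=0\quad\text{for }\nu\text{-a.e. }z\in\partial\Omega,$$ $$\|Tu\|_{HB^{\alpha-\theta/p}_{p,q}(\partial\Omega,\nu)}\le C_1\|u\|_{HB^\alpha_{p,q}(\Omega,\mu)},$$ where $C_1\ge 1$ depends only on $\alpha,p,q,\theta$ and the doubling, codimensional Ahlfors regularity, and uniform domain constants, and $$\|Tu\|_{L^p(\partial\Omega,\nu)}\le C\left(\|u\|_{L^p(\Omega,\mu)}+\|u\|_{HB^\alpha_{p,q}(\Omega,\mu)}\right),$$ where the constant $C\ge 1$ depends only on $\alpha,p,q,\theta$, $\operatorname{diam}(\partial\Omega)$, as well as the doubling and codimensional Ahlfors regularity constants.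
   Context: Doubling: a Borel measure $\mu$ on a metric space is doubling if there is $C_\mu\ge 1$ (the doubling constant) with $0<\mu(B(x,2r))\le C_\mu\,\mu(B(x,r))<\infty$ for all points $x$ and all $r>0$. Boundary: $\overline\Omega$ is the metric completion of $\Omega$; since $\Omega$ is locally compact it is open in $\overline\Omega$. The measure $\mu$ is extended to $\overline\Omega$ by zero (i.e. $\mu(\partial\Omega)=0$). Balls $B(z,r)$ centered at $z\in\partial\Omega$ are balls of $\overline\Omega$. Codimension $\theta$ Ahlfors regularity: $\nu$ is codimension $\theta$ Ahlfors regular with respect to $\mu$ if there is $C_\theta\ge 1$ such that for all $z\in\partial\Omega$ and $0<r\le 2\operatorname{diam}(\partial\Omega)$, $$\frac{1}{C_\theta}\frac{\mu(B(z,r)\cap\Omega)}{r^\theta}\le\nu(B(z,r)\cap\partial\Omega)\le C_\theta\frac{\mu(B(z,r)\cap\Omega)}{r^\theta}.$$ Uniform domain: a curve is a continuous map $\gamma:[a,b]\to X$ (also identified with its image; it need not be rectifiable). A domain (connected open set) $\Omega\subset X$ is $A$-uniform, $A\ge1$, if for every $x,y\in\Omega$ there is a curve $\gamma$ in $\Omega$ joining $x$ to $y$ with (i) $\operatorname{diam}(\gamma)\le A\,d(x,y)$, and (ii) for each $z\in\gamma$, $\min\{\operatorname{diam}(\gamma_{x,z}),\operatorname{diam}(\gamma_{z,y})\}\le A\,\operatorname{dist}(z,X\setminus\Omega)$, where $\gamma_{x,z}$, $\gamma_{z,y}$ are the subcurves of $\gamma$ with the indicated endpoints. It is uniform if it is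 $A$-uniform for some $A\ge 1$; here $X=\overline\Omega$. Besov spaces: for a metric measure space $(X,d,\mu)$, $0<\alpha<1$, $1\le p<\infty$ and $f\in L^1_{\mathrm{loc}}(X,\mu)$, set $$\|f\|_{HB^\alpha_{p,q}(X,\mu)}:=\left(\int_0^\infty\left(\int_X\frac{1}{\mu(B(x,t))}\int_{B(x,t)}|f(y)-f(x)|^p\,d\mu(y)\,d\mu(x)\right)^{q/p}\frac{dt}{t^{\alpha q+1}}\right)^{1/q}$$ for $1\le q<\infty$, and $$\|f\|_{HB^\alpha_{p,\infty}(X,\mu)}:=\sup_{t>0}\frac{1}{t^{\alpha}}\left(\int_X\frac{1}{\mu(B(x,t))}\int_{B(x,t)}|f(y)-f(x)|^p\,d\mu(y)\,d\mu(x)\right)^{1/p}.$$ $HB^\alpha_{p,q}(X,\mu)$ is the class of $f\in L^1_{\mathrm{loc}}(X,\mu)$ for which this seminorm is finite. The inhomogeneous Besov space is $B^\alpha_{p,q}(X,\mu):=HB^\alpha_{p,q}(X,\mu)\cap L^p(X,\mu)$ with norm $\|f\|_{HB^\alpha_{p,q}(X,\mu)}+\|f\|_{L^p(X,\mu)}$.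
   Formalization: The formal theorem additionally assumes diam(∂Ω) > 0, i.e. the boundary has at least two points; for a one-point boundary the codimension θ condition is vacuous, ν is arbitrary and the claim fails (e.g. Ω = R²∖{0}, ν = δ₀, p = 2, α = θ = 1/2). *)

(* Defs.v *)
From HB Require Import structures.
From mathcomp Require Import all_boot all_order all_algebra.
From mathcomp Require Import all_classical all_reals all_analysis.

Set Implicit Arguments.
Unset Strict Implicit.
Unset Printing Implicit Defensive.

Import Order.TTheory GRing.Theory Num.Theory.
Import numFieldNormedType.Exports.

Local Open Scope classical_set_scope.
Local Open Scope ring_scope.

#[short(type="completeMetricType")]
HB.structure Definition CompleteMetric (R : numDomainType) :=
  { M of CompletePseudoMetric R M & PseudoMetric_isMetric R M }.

(* Convention: a metric measure space is a subset S of an ambient complete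
   metric space X, with the distance of X and a Borel measure of X that
   vanishes off S. For a Borel set S these measures are exactly the extensions
   by zero of the Borel measures of S. Functions on S are functions on X whose
   values outside S are never used, and the ball of S with centre x and radius
   r is [ball x r `&` S] (balls are open). The space Omega is a dense subset,
   so that X is its completion and [~` Omega] its boundary. *)

Definition borel (R : realType) (X : completeMetricType R) :=
  g_sigma_algebraType (@open X).

Section metric.
Context {R : realType} {X : completeMetricType R}.
Implicit Types (A Omega : set X) (x y : X).

(* the value is -oo for the empty set *)
Definition diam A : \bar R :=
  ereal_sup [set (mdist x y)%:E | x in A & y in A].

Definition complete_subset A :=
  forall F : set_system A, ProperFilter F -> cauchy F ->
    exists x : A, F --> x.

Definition uniform_curve Omega (A : R) x y (gam : R -> X) (a b : R) :=
  [/\ a <= b /\ {within `[a, b], continuous gam},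
      [set gam t | t in `[a, b]] `<=` Omega,
      gam a = x /\ gam b = y,
      (diam [set gam t | t in `[a, b]] <= (A * mdist x y)%:E)%E &
      forall t, a <= t <= b ->
        (mine (diam [set gam s | s in `[a, t]])
              (diam [set gam s | s in `[t, b]])
         <= A%:E * edist_inf (~` Omega) (gam t))%E].

Definition uniform_domain Omega (A : R) :=
  [/\ open Omega, connected Omega &
      forall x y, Omega x -> Omega y ->
        exists (gam : R -> X) (a b : R), uniform_curve Omega A x y gam a b].

End metric.

Section metric_measure.
Context {R : realType} {X : completeMetricType R}.
Local Open Scope ereal_scope.
Implicit Types (S Omega : set X) (mu nu : {measure set (borel X) -> \bar R}).
Implicit Types (f : borel X -> R) (p al : R) (q : \bar R).

Definition doubling S mu (C : R) :=
  forall x r, S x -> (0 < r)%R ->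
    [/\ 0 < mu (ball x (2 * r) `&` S),
        mu (ball x (2 * r) `&` S) <= C%:E * mu (ball x r `&` S) &
        C%:E * mu (ball x r `&` S) < +oo].

Definition codim_regular Omega mu nu (theta C : R) :=
  forall z r, (~` Omega) z -> (0 < r)%R -> r%:E <= 2%:E * diam (~` Omega) ->
    C^-1%:E * (mu (ball z r `&` Omega) / (r `^ theta)%:E)
      <= nu (ball z r `&` ~` Omega) /\
    nu (ball z r `&` ~` Omega)
      <= C%:E * (mu (ball z r `&` Omega) / (r `^ theta)%:E).

(* mean value of |f - c|^p over the ball of S with centre x and radius r;
   x need not belong to S *)
Definition ball_mean S mu p f (c : R) (x : X) (r : R) : \bar R :=
  (mu (ball x r `&` S))^-1 *
  \int[mu]_(y in ball x r `&` S) (`|f y - c| `^ p)%:E.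

Definition oscillation S mu p f (t : R) : \bar R :=
  \int[mu]_(x in S) ball_mean S mu p f (f x) x t.

(* the value at q = -oo is irrelevant: q is at least 1 *)
Definition besov_seminorm S mu al p q f : \bar R :=
  match q with
  | s%:E => (\int[lebesgue_measure]_(t in `]0%R, +oo[)
               (oscillation S mu p f t `^ (s / p)
                / (t `^ (al * s + 1))%:E)) `^ s^-1
  | _ => ereal_sup [set (t `^ al)^-1%:E * oscillation S mu p f t `^ p^-1
                   | t in [set t : R | (0 < t)%R]]
  end.

Definition L1loc S mu f :=
  measurable_fun (S : set (borel X)) f /\
  forall x, S x -> exists2 r : R, (0 < r)%R &
    mu.-integrable (ball x r `&` S) (EFin \o f).

(* [f \_ S] is zero outside S *)
Definition Lp_norm S mu p f : \bar R :=
  'N[mu]_(p%:E)[EFin \o (f \_ S)].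

Definition Lp S mu p f :=
  measurable_fun (S : set (borel X)) f /\ Lp_norm S mu p f < +oo.

Definition besov_norm S mu al p q f : \bar R :=
  besov_seminorm S mu al p q f + Lp_norm S mu p f.

Definition hom_besov S mu al p q f :=
  L1loc S mu f /\ besov_seminorm S mu al p q f < +oo.

Definition besov S mu al p q f :=
  hom_besov S mu al p q f /\ Lp S mu p f.

(* Elements of the Besov spaces are functions up to almost everywhere equality:
   T is an operator between them when it is compatible with that equality, and
   it is linear when it is so up to that equality. *)
Definition bounded_linear_besov (S1 : set X) mu1 (al1 : R) (S2 : set X) mu2
    (al2 : R) p q (T : (borel X -> R) -> (borel X -> R)) :=
  [/\ forall u, besov S1 mu1 al1 p q u -> besov S2 mu2 al2 p q (T u),
      forall u v, besov S1 mu1 al1 p q u -> besov S1 mu1 al1 p q v ->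
        {ae mu1, forall x, S1 x -> u x = v x} ->
        {ae mu2, forall z, S2 z -> T u z = T v z},
      forall (c : R) u v,
        besov S1 mu1 al1 p q u -> besov S1 mu1 al1 p q v ->
        {ae mu2, forall z, S2 z ->
          T (fun x => c * u x + v x)%R z = (c * T u z + T v z)%R} &
      exists2 K : R, (0 <= K)%R & forall u, besov S1 mu1 al1 p q u ->
        besov_norm S2 mu2 al2 p q (T u) <= K%:E * besov_norm S1 mu1 al1 p q u].

End metric_measure.

(* Main.v *)
Require Import Defs.
From HB Require Import structures.
From mathcomp Require Import all_boot all_order all_algebra.
From mathcomp Require Import all_classical all_reals all_analysis.
From mathcomp Require Import measurable_realfun finmap ring lra.

Set Implicit Arguments.
Unset Strict Implicit.
Unset Printing Implicit Defensive.

Import Order.TTheory GRing.Theory Num.Theory.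
Import numFieldNormedType.Exports.

Local Open Scope classical_set_scope.
Local Open Scope ring_scope.

(** Let D be the diameter of the boundary, r_k = 4 D / 2^k, and let osc(t)
    denote the integral over x in Omega of the mean of |u(y) - u(x)|^p over
    the ball B(x, t) of Omega. The trace T u of u, at a boundary point z,
    is the limit of the means m_k(z) of u over the balls B(z, r_k) of Omega.

    Two estimates carry the proof. Let W_k(z) be the mean, over x in B(z, r_k),
    of the mean of |u(y) - u(x)|^p over B(x, 2 r_k). Pointwise, W_k(z) bounds
    |m_(k+1)(w) - m_k(z)|^p for w close to z ([mean_step]), because the balls
    involved have comparable measures by the doubling property. In the mean,
    the integral of W_k over the boundary is at most a constant times
    r_k^(-theta) osc(2 r_k) ([integral_boundary_average]): after exchanging the
    integrals, the mean oscillation at x is multiplied by the ratio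
    nu(B(x, r_k)) / mu(B(x, r_k)), which codimension regularity controls. This
    is where the loss of theta / p in the smoothness comes from.

    Summing the differences of the means gives, for every lam > 1,
    |T u - m_n|^p <= C sum_j lam^j W_(n+j). The weights lam^j replace the
    inequalities of Minkowski and Hoelder ([poweR_nneseries_le],
    [lim_weighted_increments]). Integrated over the boundary, the right side
    becomes E_n = sum_j lam^j r_(n+j)^(-theta) osc(2 r_(n+j)). As T u(z) and
    T u(w) can be compared through the means around z and w, E_n also bounds
    the oscillation of T u at the scales between r_(n+2) and r_(n+1)
    ([boundary_oscillation_le]). Beyond D the oscillation of T u does not depend
    on the scale.

    The Besov seminorm of u dominates a sum over the dyadic scales
    ([dyadic_sum_le]), and that of T u is dominated by such a sum
    ([boundary_integral_le]). With lam = 2^((al p - theta) / 2), the sum over j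
    in E_n is a convolution with a geometric sequence, hence bounded on
    sequences; the hypothesis al - theta / p > 0 makes this choice of lam larger
    than 1. Keeping a single scale instead of the sum gives osc(t) <= C t^(al p)
    times the p-th power of the seminorm, for every q ([oscillation_weak]). This
    settles q = +oo, and it makes E_0 finite, so that the series of the
    lam^j W_j(z) converges for almost every z. At such a point z the means
    converge, which makes the trace linear in u, and the tails of the series
    bound the means of |u - T u(z)|^p over small balls around z
    ([trace_ball_mean_cvg]). The bound in L^p compares T u with m_0
    ([integral_trace_le]).

    Measurability rests on separability: disjoint balls inside a ball are
    countably many, as each has positive measure, so the space has a dense
    sequence and the set of the pairs at distance less than t is measurable in
    the product ([measurable_ball_rel]). The function osc of t enters only
    through comparisons with step functions ([le_lower_integral]). *)

(** * Lower integrals and the Borel sets of a metric space *)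

(** The integral of a nonnegative function is the supremum of the integrals of
    the simple functions below it, which makes it monotone without any
    measurability. *)
Lemma le_lower_integral d (T : measurableType d) (R : realType)
    (m : {measure set T -> \bar R}) (A B : set T) (f g : T -> \bar R) :
  A `<=` B -> (forall x, A x -> (0 <= f x)%E) ->
  (forall x, B x -> (0 <= g x)%E) ->
  (forall x, A x -> (f x <= g x)%E) ->
  (\int[m]_(x in A) f x <= \int[m]_(x in B) g x)%E.
Proof.
move=> AB f0 g0 fg; rewrite !ge0_integralE//.
apply: ereal_sup_le => _ [h hf <-] /=; exists h => //= x.
apply: (le_trans (hf x)); rewrite !patchE.
case: ifPn => xA; first by rewrite mem_set; [exact/fg/set_mem|exact/AB/set_mem].
by case: ifPn => // /set_mem /g0.
Qed.

Section metric_borel.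
Context {R : realType} {X : completeMetricType R}.
Implicit Types (x y : X) (A : set X).

Lemma open_ball_metric x (r : R) : open (ball x r).
Proof.
rewrite openE => y; rewrite ballEmdist /= => xy.
apply/nbhs_ballP; exists (r - mdist x y) => /=; first by rewrite subr_gt0.
move=> z; rewrite !ballEmdist /= => yz.
by rewrite (le_lt_trans (metric_triangle _ y _))// -ltrBrDl.
Qed.

Lemma measurable_open_borel A : open A -> measurable (A : set (borel X)).
Proof. by move=> oA; exact: (@sub_gen_smallest _ (sigma_algebra setT) (@open X)). Qed.

Lemma measurable_ball_borel x (r : R) : measurable (ball x r : set (borel X)).
Proof. by apply: measurable_open_borel; exact: open_ball_metric. Qed.

Definition dense_seq (a : nat -> X) :=
  forall x (e : R), 0 < e -> exists n, ball x e (a n).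

(** If d(x, y) < t, then some [a n] is so close to x that d(a n, y) plus this
    distance is still less than t: the set is a countable union of products of
    balls. *)
Lemma measurable_ball_rel (a : nat -> X) (t : R) : dense_seq a ->
  measurable ([set xy | ball xy.1 t xy.2] : set (borel X * borel X)).
Proof.
move=> da.
rewrite (_ : [set _ | _] = \bigcup_n \bigcup_k
   (ball (a n) k.+1%:R^-1 `*` ball (a n) (t - k.+1%:R^-1))); last first.
  apply/seteqP; split => [[x y] /=|[x y] [n _ [k _]] [] /=].
    rewrite ballEmdist /= -subr_gt0 => xyt.
    have t20 : 0 < (t - mdist x y) / 2 by rewrite divr_gt0.
    have [k _ /(_ k (leqnn k)) /= kt] := near_infty_natSinv_lt (PosNum t20).
    have [|n] := da x k.+1%:R^-1; first by rewrite invr_gt0.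
    move=> xan; exists n => //; exists k => //=; split.
      exact: ball_sym.
    have /ball_sym := xan; rewrite !ballEmdist /= => anx.
    rewrite (le_lt_trans (metric_triangle _ x _))//.
    move: anx kt => /=; set c := k.+1%:R^-1.
    by move: (mdist _ _) (mdist _ _) => e e' ? ?; lra.
  move=> /ball_sym xa ya; rewrite -(subrK k.+1%:R^-1 t) addrC.
  exact: ball_triangle xa ya.
do 2 (apply: bigcupT_measurable => ?).
by apply: measurableX; exact: measurable_ball_borel.
Qed.

End metric_borel.

(** * Separability *)

(** For each n, only finitely many disjoint subsets of [B] can have measure at
    least 1 / (n + 1). *)
Lemma countable_trivIset d (T : measurableType d) (R : realType)
    (m : {measure set T -> \bar R}) (I : choiceType) (E : set I)
    (F : I -> set T) (B : set T) :
  measurable B -> (m B < +oo)%E ->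
  (forall i, E i -> [/\ measurable (F i), F i `<=` B & (0 < m (F i))%E]) ->
  trivIset E F -> countable E.
Proof.
move=> mB Boo EF tE.
pose G n := [set i | E i /\ (n.+1%:R^-1%:E <= m (F i))%E].
have -> : E = \bigcup_n G n.
  apply/seteqP; split => [i Ei|i [n _ []]//].
  have [mFi FiB mFi0] := EF _ Ei.
  have [r mr] : exists r, m (F i) = r%:E.
    exists (fine (m (F i))); rewrite fineK// ge0_fin_numE//.
    by apply: (le_lt_trans _ Boo); apply: le_measure => //; exact: mem_set.
  move: mFi0; rewrite mr lte_fin => r0.
  have [n _ /(_ n (leqnn n)) /= nr] := near_infty_natSinv_lt (PosNum r0).
  by exists n => //; split=> //; rewrite mr lee_fin ltW.
apply: bigcup_countable => // n _.
apply: finite_set_countable; apply: contrapT => /infinite_set_fset infG.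
have Bfin : m B \is a fin_num by rewrite ge0_fin_numE.
(* N sets of measure at least 1 / (n + 1) have total measure more than m B *)
pose N := Num.Def.archi_bound (n.+1%:R * fine (m B)).
have [D DG ND] := infG N.
have DE : [set` D] `<=` E by move=> i /DG [].
have : (m (\big[setU/set0]_(i <- D) F i) <= m B)%E.
  apply: le_measure; [apply: mem_set|exact: mem_set|].
    by rewrite big_seq; apply: bigsetU_measurable => i /DE /EF[].
  by rewrite -bigcup_fset => x [i /DE /EF[_ + _]]; exact.
rewrite measure_fbigsetU; last 2 first.
- by move=> i /DE /EF [].
- exact: sub_trivIset tE.
have : (\sum_(i <- D) (n.+1%:R^-1%:E : \bar R) <= \sum_(i <- D) m (F i))%E.
  by rewrite !big_seq; apply: lee_sum => i /DG[].
move=> /le_trans/[apply].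
rewrite -[X in (_ <= X)%E](fineK Bfin) sumEFin lee_fin.
rewrite big_const_seq count_predT iter_addr addr0.
rewrite -[X in X <= _]mulr_natr ler_pdivrMl//; apply/negP; rewrite -ltNge.
apply: (lt_le_trans (archi_boundP _)); last by rewrite ler_nat.
by rewrite mulr_ge0// fine_ge0.
Qed.

Section separable.
Context {R : realType} {X : completeMetricType R}.
Variable m : {measure set (borel X) -> \bar R}.
Hypothesis mball : forall (x : X) (r : R), 0 < r ->
  (0 < m (ball x r) < +oo)%E.

(** A maximal family of disjoint balls of radius e is countable, since balls
    have positive and finite measures, and by maximality its centres come within
    2 e of every point. *)
Lemma ex_dense_seq (x0 : X) : exists a : nat -> X, dense_seq a.
Proof.
have cov (e : R) : 0 < e -> exists2 E : set X, countable E &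
    forall x, exists2 y, E y & ball x (2 * e) y.
  move=> e0.
  have [E [_ tE maxE]] :=
    @ex_maximal_disjoint_subcollection X X (fun x => ball x e) setT.
  exists E.
    pose E' (n : nat) := E `&` ball x0 n%:R.
    have -> : E = \bigcup_n E' n.
      apply/seteqP; split => [x Ex|x [n _ []]//].
      exists (Num.Def.archi_bound (mdist x0 x)) => //; split => //.
      by rewrite ballEmdist /=; apply: archi_boundP; exact: mdist_ge0.
    apply: bigcup_countable => // n _.
    apply: (@countable_trivIset _ _ _ m X (E' n) (fun x => ball x e)
      (ball x0 (n%:R + e))).
    - exact: measurable_ball_borel.
    - by have /andP[] := mball x0 (ltr_wpDl (ler0n R n) e0).
    - move=> x [Ex x0x]; split.
      + exact: measurable_ball_borel.
      + by move=> y; exact: ball_triangle x0x.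
      + by have /andP[] := mball x e0.
    - by apply: sub_trivIset tE => x [].
  move=> x; apply: contrapT => /forall2NP xE.
  have Ex : ~ E x.
    move=> Ex; case: (xE x) => //; apply.
    by apply: ballxx; rewrite mulr_gt0.
  apply: (maxE (E `|` [set x])) => //.
    by split; [move=> y; left|move=> /(_ x) xE'; apply/Ex/xE'; right].
  have dis y z : E y -> z = x -> ball y e `&` ball z e !=set0 -> y = z.
    move=> Ey -> [w [yw xw]]; exfalso; case: (xE y) => //; apply.
    by rewrite mulr_natl mulr2n; exact: ball_triangle xw (ball_sym yw).
  move=> y z [Ey|->] [Ez|->].
  - exact: tE.
  - exact: dis.
  - rewrite setIC => /dis; move=> /(_ Ez erefl) //.
  - by [].
have {}cov n : exists a : nat -> X, forall x, exists k,
    ball x (2 * n.+1%:R^-1) (a k).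
  have [|E cE Ex] := cov n.+1%:R^-1; first by rewrite invr_gt0.
  have [E0|/set0P [y0 Ey0]] := eqVneq E set0.
    by have [y] := Ex x0; rewrite E0.
  have [f finj] := countable_injP _ cE.
  exists (fun k => xget y0 [set y | E y /\ f y = k]) => x.
  have [y Ey xy] := Ex x; exists (f y).
  case: xgetP => [z _ [Ez fzy]|/(_ y)]; last by case.
  by rewrite (finj z y) //; exact: mem_set.
have [b bP] := choice cov.
exists (fun k => if (choice.unpickle k : option (nat * nat)) is Some ij
  then b ij.1 ij.2 else x0).
move=> x e e0.
have e20 : 0 < e / 2 by rewrite divr_gt0.
have [n _ /(_ n (leqnn n)) /= ne] := near_infty_natSinv_lt (PosNum e20).
have [k xk] := bP n x; exists (choice.pickle (n, k)); rewrite choice.pickleK.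
by apply: le_ball xk; rewrite mulrC -ler_pdivlMr// ltW.
Qed.

End separable.

(** * Tonelli's theorem for integrals over moving balls *)

Lemma measurable_restrictI d (T : measurableType d) (R : realType)
    (A S : set T) (f : T -> \bar R) :
  measurable A -> measurable S -> measurable_fun S f ->
  measurable_fun setT (f \_ (A `&` S)).
Proof.
move=> mA mS mf; apply/(measurable_restrictT _ (measurableI _ _ mA mS)).
by apply: (measurable_funS mS _ mf); exact: subIsetr.
Qed.

Section sigma_finite_copy.
Context d (T : measurableType d) (R : realType) (m : {measure set T -> \bar R}).

(** An alias that turns a hypothesis of sigma-finiteness into a canonical
    structure, the form in which Tonelli's theorem takes it. *)
Definition sigma_finite_copy (_ : sigma_finite setT m) : set T -> \bar R := m.

Variable sm : sigma_finite setT m.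

HB.instance Definition _ := Measure.copy (sigma_finite_copy sm) m.
HB.instance Definition _ :=
  Measure_isSigmaFinite.Build d T R (sigma_finite_copy sm) sm.

End sigma_finite_copy.
Arguments sigma_finite_copy {d T R m}.

Lemma patch_in (T : Type) (R : realType) (f : T -> \bar R) (D : set T) x :
  D x -> (f \_ D) x = f x.
Proof. by move=> Dx; rewrite patchE mem_set. Qed.

Lemma patch_out (T : Type) (R : realType) (f : T -> \bar R) (D : set T) x :
  ~ D x -> (f \_ D) x = 0%E.
Proof. by move=> Dx; rewrite patchE memNset. Qed.

Section fubini_ball.
Context {R : realType} {X : completeMetricType R}.
Local Open Scope ereal_scope.
Implicit Types (m : {measure set (borel X) -> \bar R}).

Lemma measurable_ball_integral (a : nat -> X) m (S : set (borel X)) (t : R)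
    (F : borel X * borel X -> \bar R) :
  dense_seq a -> sigma_finite setT m -> measurable S ->
  measurable_fun setT F -> (forall xy, 0 <= F xy) ->
  measurable_fun setT
    (fun x : borel X => \int[m]_(y in ball (x : X) t `&` S) F (x, y)).
Proof.
move=> da sm mS mF F0.
pose m' := sigma_finite_copy sm.
pose A := [set xy : borel X * borel X | ball (xy.1 : X) t (xy.2 : X)] `&`
  (snd @^-1` S).
have mA : measurable A.
  apply: measurableI; first exact: measurable_ball_rel da.
  by rewrite -[X in measurable X]setTI; apply: measurable_snd.
have mFA : measurable_fun setT (F \_ A).
  apply/(measurable_restrictT _ mA).
  exact: measurable_funS mF.
have FA0 xy : 0 <= (F \_ A) xy by rewrite patchE; case: ifPn.
have := @measurable_fun_fubini_tonelli_F _ _ _ _ _ m' _ mFA FA0.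
apply: eq_measurable_fun => x _.
rewrite /fubini_F [RHS]integral_mkcond.
apply: eq_integral => y _; rewrite !patchE.
congr (if _ then _ else _).
Qed.

(** By Tonelli's theorem and the symmetry of the distance, the left side is the
    integral over x of [F x] times the integral of [k] over the points of [S2]
    within t of x. With [k] the reciprocal of the measure of a ball, the left
    side is an integral of averages of [F]. *)
Lemma ball_integral_swap (a : nat -> X) m1 m2 (S1 S2 : set (borel X)) (t : R)
    (F k : borel X -> \bar R) (K : \bar R) :
  dense_seq a -> sigma_finite setT m1 -> sigma_finite setT m2 ->
  measurable S1 -> measurable S2 ->
  measurable_fun S1 F ->
  measurable_fun S2 k ->
  (forall x, S1 x -> 0 <= F x) -> (forall z, S2 z -> 0 <= k z) -> 0 <= K ->
  (forall x, S1 x -> \int[m2]_(z in ball (x : X) t `&` S2) k z <= K) ->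
  \int[m2]_(z in S2) (k z * \int[m1]_(x in ball (z : X) t `&` S1) F x) <=
    K * \int[m1]_(x in S1) F x.
Proof.
move=> da sm1 sm2 mS1 mS2 mF mk F0 k0 K0 kK.
pose m1' := sigma_finite_copy sm1.
pose m2' := sigma_finite_copy sm2.
pose A := [set xy : borel X * borel X | ball (xy.1 : X) t (xy.2 : X)].
have mA : measurable A by exact: measurable_ball_rel da.
pose G := (fun zx : borel X * borel X => (k \_ S2) zx.1 * (F \_ S1) zx.2) \_ A.
have mFS : measurable_fun setT (F \_ S1) by exact/(measurable_restrictT _ mS1).
have mkS : measurable_fun setT (k \_ S2) by exact/(measurable_restrictT _ mS2).
have FS0 x : 0 <= (F \_ S1) x by exact: erestrict_ge0.
have kS0 x : 0 <= (k \_ S2) x by exact: erestrict_ge0.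
have mG : measurable_fun setT G.
  apply/(measurable_restrictT _ mA); apply: (@measurable_funS _ _ _ _ setT) => //.
  apply: emeasurable_funM; first exact: (measurableT_comp mkS).
  exact: (measurableT_comp mFS).
have G0 zx : 0 <= G zx.
  by apply: erestrict_ge0 => -[z x] _ /=; exact: mule_ge0.
have mB x : measurable (ball x t : set (borel X)).
  exact: measurable_ball_borel.
rewrite integral_mkcond.
rewrite [leLHS](_ : _ = \int[m2]_z \int[m1]_x G (z, x)); last first.
  apply: eq_integral => z _; rewrite patchE.
  case: ifPn => zS; last first.
    rewrite integral0_eq// => x _; rewrite /G patchE; case: ifPn => //= _.
    by rewrite patchE (negbTE zS) mul0e.
  have kz0 : 0 <= k z by apply: k0; exact: set_mem.
  rewrite integral_mkcond -ge0_integralZl//; last 2 first.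
  - exact: measurable_restrictI (mB z) mS1 mF.
  - by move=> x _; apply: erestrict_ge0 => // y [_ /F0].
  apply: eq_integral => x _.
  have {}zS := set_mem zS.
  have [xz|xz] := pselect (ball (z : X) t x); last first.
    rewrite [RHS]patch_out// [X in k z * X]patch_out ?mule0//.
    by move=> [].
  rewrite [RHS]patch_in//= [in RHS]patch_in//; congr (_ * _).
  have [xS|xS] := pselect (S1 x); first by rewrite !patch_in.
  by rewrite !patch_out// => -[].
rewrite (@sfinite_Fubini _ _ _ _ _ m2' m1')//=.
rewrite [in leRHS]integral_mkcond -ge0_integralZl//.
apply: le_lower_integral => //.
- by move=> x _; exact: integral_ge0.
- by move=> x _; exact: mule_ge0.
move=> x _; rewrite [in leRHS]patchE; case: ifPn => xS; last first.
  rewrite mule0 integral0_eq// => z _; rewrite /G patchE; case: ifPn => //= _.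
  by rewrite [X in _ * X]patchE (negbTE xS) mule0.
have {}xS := set_mem xS.
apply: (@le_trans _ _ (F x * \int[m2]_(z in ball (x : X) t `&` S2) k z)); last first.
  by rewrite muleC lee_wpmul2r// ?F0// kK.
rewrite [X in F x * X]integral_mkcond -ge0_integralZl//; last 3 first.
- exact: measurable_restrictI (mB x) mS2 mk.
- by move=> z _; apply: erestrict_ge0 => // y [_ /k0].
- exact: F0.
rewrite le_eqVlt; apply/orP; left; apply/eqP.
apply: eq_integral => z _.
have [xz|xz] := pselect (ball (x : X) t z); last first.
  rewrite [LHS]patch_out; last by move=> /ball_sym.
  rewrite [X in F x * X]patch_out ?mule0//.
  by move=> [].
rewrite [LHS]patch_in/=; last exact: ball_sym.
rewrite [X in _ * X]patch_in// muleC; congr (_ * _).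
have [zS|zS] := pselect (S2 z); first by rewrite !patch_in.
by rewrite !patch_out// => -[].
Qed.

End fubini_ball.

(** * Geometric series and sums of powers *)

Section geometric_series.
Context {R : realType}.
Implicit Types (a : R^nat) (rho M : R).
Local Open Scope ereal_scope.

Lemma nneseries_geometric rho : (0 <= rho < 1)%R ->
  \sum_(0 <= j <oo) (rho ^+ j)%:E = ((1 - rho)^-1)%:E.
Proof.
move=> /andP[rho0 rho1]; apply/cvg_lim => //.
rewrite (_ : (fun _ => _) = EFin \o series (geometric 1%R rho)); last first.
  apply/funext => n /=; rewrite sumEFin /series /=; congr EFin.
  by apply: eq_bigr => i _; rewrite mul1r.
apply: cvg_EFin; first by near=> n.
have := @cvg_geometric_series R 1%R rho; rewrite div1r; apply.
by rewrite ger0_norm.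
Unshelve. all: by end_near. Qed.

Lemma cvg_geometric_increments a M rho : (0 <= rho < 1)%R ->
  (forall n, `|a n.+1 - a n| <= M * rho ^+ n)%R ->
  cvgn a /\ (`|limn a - a 0%N| <= M / (1 - rho))%R.
Proof.
move=> /andP[rho0 rho1] aM.
have cg : cvgn (series (geometric M rho)).
  by apply: is_cvg_geometric_series; rewrite ger0_norm.
have cn : cvgn [normed series (telescope a)].
  apply: (series_le_cvg _ _ _ cg) => n /=.
  - by [].
  - exact: le_trans (aM n).
  - exact: aM.
have ct : cvgn (series (telescope a)) by exact: normed_cvg.
have ea : a = (cst (a 0%N) + series (telescope a))%R.
  by apply/funext => n; rewrite [LHS]eq_sum_telescope.
have ca : cvgn a by rewrite ea; apply: is_cvgD => //; exact: is_cvg_cst.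
split => //.
have -> : (limn a - a 0%N)%R = limn (series (telescope a)).
  rewrite {1}ea limD//; last exact: is_cvg_cst.
  by rewrite lim_cst// addrC addKr.
apply: (le_trans (lim_series_norm cn)).
have <- : limn (series (geometric M rho)) = (M / (1 - rho))%R.
  by apply/cvg_lim => //; apply: cvg_geometric_series; rewrite ger0_norm.
apply: ler_lim => //; near=> n.
by apply: ler_sum => i _ /=; exact: aM.
Unshelve. all: by end_near. Qed.

End geometric_series.

Section power_sums.
Context {R : realType}.
Implicit Types (a : R^nat) (x w : (\bar R)^nat) (lam r : R).
Local Open Scope ereal_scope.

Lemma le_poweR (x y : \bar R) r : (0 <= r)%R -> 0 <= x -> x <= y ->
  x `^ r <= y `^ r.
Proof.
move=> r0 x0 xy; apply: (gt0_ler_poweR r0) => //; rewrite in_itv /= leey andbT //.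
exact: le_trans xy.
Qed.

Lemma nneseries_term w n : (forall j, 0 <= w j) -> w n <= \sum_(0 <= j <oo) w j.
Proof.
move=> w0; apply: le_trans (nneseries_lim_ge (P := xpredT) n.+1 _) => //.
by rewrite big_nat_recr//= leeDr// sume_ge0.
Qed.

Definition geometric_const r lam : R := ((1 - lam `^ (- r^-1))^-1 `^ r)%R.

Lemma geometric_ratio lam r : (0 < r)%R -> (1 < lam)%R ->
  (0 <= lam `^ (- r^-1) < 1)%R.
Proof.
move=> r0 lam1; have lam0 : (0 < lam)%R by apply: lt_trans lam1.
rewrite powR_ge0 /= powRN invf_lt1 ?powR_gt0//.
have : (1 `^ r^-1 < lam `^ r^-1)%R.
  by apply: gt0_ltr_powR; rewrite ?invr_gt0// ?nnegrE ?ler01// ltW.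
by rewrite powR1.
Qed.

Lemma geometric_const_gt0 r lam : (0 < r)%R -> (1 < lam)%R ->
  (0 < geometric_const r lam)%R.
Proof.
move=> r0 lam1; have /andP[_ q1] := geometric_ratio r0 lam1.
by apply: powR_gt0; rewrite invr_gt0 subr_gt0.
Qed.

Lemma weighted_term_le w lam r (s : R) j : (0 < r)%R -> (1 < lam)%R ->
  (forall j, 0 <= w j) -> \sum_(0 <= j <oo) (lam ^+ j)%:E * w j = s%:E ->
  w j `^ r^-1 <= (s `^ r^-1 * (lam `^ (- r^-1)) ^+ j)%:E.
Proof.
move=> r0 lam1 w0 ws; have lam0 : (0 < lam)%R by apply: lt_trans lam1.
have lw0 i : 0 <= (lam ^+ i)%:E * w i.
  by rewrite mule_ge0// lee_fin exprn_ge0// ltW.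
have := nneseries_term j lw0; rewrite ws => wjs.
have s0 : (0 <= s)%R by rewrite -lee_fin -ws; exact: nneseries_ge0.
have : w j <= (s / lam ^+ j)%:E.
  rewrite mulrC EFinM lee_pdivlMl//; exact: exprn_gt0.
move=> /(le_poweR _ (w0 j)) => /(_ r^-1%R); rewrite invr_ge0 ltW// => /(_ isT).
move=> /le_trans; apply; rewrite poweR_EFin lee_fin powRM// ?invr_ge0; last first.
  by rewrite exprn_ge0// ltW.
rewrite -powR_mulrn ?(ltW lam0)// -powRN -!powRrM -powR_mulrn ?powR_ge0//.
by rewrite -?powRrM !mulNr [X in (- X)%R]mulrC.
Qed.

(** This serves both exponents r >= 1 and r <= 1: if s is the sum on the right,
    each x_j is at most s^(1/r) lam^(-j/r), and these bounds are summed as a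
    geometric series. The weights are affordable, as lam may be taken close
    to 1. *)
Lemma poweR_nneseries_le x lam r : (0 < r)%R -> (1 < lam)%R ->
  (forall j, 0 <= x j) ->
  (\sum_(0 <= j <oo) x j) `^ r <=
  (geometric_const r lam)%:E * \sum_(0 <= j <oo) (lam ^+ j)%:E * x j `^ r.
Proof.
move=> r0 lam1 x0; have lam0 : (0 < lam)%R by apply: lt_trans lam1.
have gc0 := geometric_const_gt0 r0 lam1.
have lw0 i : 0 <= (lam ^+ i)%:E * x i `^ r.
  by rewrite mule_ge0 ?poweR_ge0// lee_fin exprn_ge0// ltW.
have : 0 <= \sum_(0 <= j <oo) (lam ^+ j)%:E * x j `^ r by exact: nneseries_ge0.
case ws : (\sum_(0 <= j <oo) (lam ^+ j)%:E * x j `^ r) => [s| |]//.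
  rewrite lee_fin => s0.
  have xs j : x j <= (s `^ r^-1 * (lam `^ (- r^-1)) ^+ j)%:E.
    have := weighted_term_le j r0 lam1 (fun j => poweR_ge0 (x j) r) ws.
    by rewrite -poweRrM mulfV ?gt_eqF// poweRe1.
  have /andP[q0 q1] := geometric_ratio r0 lam1.
  apply: (@le_trans _ _ ((s `^ r^-1 / (1 - lam `^ (- r^-1)))%:E `^ r)).
    apply: le_poweR; [exact: ltW|exact: nneseries_ge0|].
    rewrite EFinM -nneseries_geometric ?q0// -nneseriesZl; last first.
      by move=> j _; rewrite lee_fin exprn_ge0.
    by apply: lee_nneseries => // j _ ; rewrite -?EFinM.
  rewrite poweR_EFin lee_fin powRM ?powR_ge0 ?invr_ge0 ?subr_ge0 ?(ltW q1)//.
  by rewrite -powRrM mulVf ?gt_eqF// powRr1// mulrC.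
by move=> _; rewrite gt0_muley ?lte_fin// leey.
Qed.

(** A finite weighted sum bounds the increments by a geometric sequence, so
    that the sequence converges and its distance to the limit is a geometric
    sum. *)
Lemma lim_weighted_increments a w lam r : (0 < r)%R -> (1 < lam)%R ->
  (forall n, 0 <= w n) -> (forall n, (`|a n.+1 - a n| `^ r)%:E <= w n) ->
  \sum_(0 <= n <oo) (lam ^+ n)%:E * w n < +oo ->
  cvgn a /\ (`|limn a - a 0%N| `^ r)%:E <=
    (geometric_const r lam)%:E * \sum_(0 <= n <oo) (lam ^+ n)%:E * w n.
Proof.
move=> r0 lam1 w0 aw; have lam0 : (0 < lam)%R by apply: lt_trans lam1.
have lw0 i : 0 <= (lam ^+ i)%:E * w i.
  by rewrite mule_ge0// lee_fin exprn_ge0// ltW.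
have : 0 <= \sum_(0 <= j <oo) (lam ^+ j)%:E * w j by exact: nneseries_ge0.
case ws : (\sum_(0 <= j <oo) (lam ^+ j)%:E * w j) => [s| |]// + _.
rewrite lee_fin => s0.
have q01 := geometric_ratio r0 lam1.
have aws n : (`|a n.+1 - a n| <= s `^ r^-1 * (lam `^ (- r^-1)) ^+ n)%R.
  rewrite -lee_fin (le_trans _ (weighted_term_le n r0 lam1 w0 ws))//.
  apply: (@le_trans _ _ ((`|a n.+1 - a n| `^ r)%:E `^ r^-1)); last first.
    by apply: le_poweR; rewrite ?invr_ge0 ?(ltW r0)// lee_fin powR_ge0.
  by rewrite poweR_EFin -powRrM mulfV ?gt_eqF// powRr1.
have [ca la] := cvg_geometric_increments q01 aws.
split=> //; rewrite -EFinM lee_fin.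
have /andP[q0 q1] := q01.
apply: (@le_trans _ _ ((s `^ r^-1 / (1 - lam `^ (- r^-1))) `^ r)%R).
  by apply: ge0_ler_powR; rewrite ?nnegrE// ?(ltW r0)//; exact: le_trans la.
rewrite powRM ?powR_ge0 ?invr_ge0 ?subr_ge0 ?(ltW q1)//.
by rewrite -powRrM mulVf ?gt_eqF// powRr1// mulrC.
Qed.

(** The two sums can be exchanged, and each shifted sequence has a sum at most
    that of [w]. *)
Lemma nneseries_geometric_convolution w (rho : R) : (0 <= rho < 1)%R ->
  (forall n, 0 <= w n) ->
  \sum_(0 <= n <oo) \sum_(0 <= j <oo) (rho ^+ j)%:E * w (n + j)%N <=
  ((1 - rho)^-1)%:E * \sum_(0 <= n <oo) w n.
Proof.
move=> /[dup] rho01 /andP[rho0 rho1] w0.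
have rj0 j : 0 <= (rho ^+ j)%:E by rewrite lee_fin exprn_ge0.
rewrite nneseries_interchange; last by move=> i j; rewrite mule_ge0.
rewrite -nneseries_geometric// muleC.
have : 0 <= \sum_(0 <= n <oo) w n by exact: nneseries_ge0.
have wn j : \sum_(0 <= n <oo) w (n + j)%N <= \sum_(0 <= n <oo) w n.
  rewrite nneseries_addn// [leRHS](nneseries_split 0 j)// leeDr//.
  exact: sume_ge0.
case: (\sum_(0 <= n <oo) w n) wn => [s| |]// wn s0.
  rewrite -nneseriesZl; last by move=> j _; exact: rj0.
  apply: lee_nneseries => [j _ _|j _].
    by apply: nneseries_ge0 => n _ _; rewrite mule_ge0.
  rewrite nneseriesZl//.
  by rewrite muleC lee_wpmul2r.
rewrite nneseries_geometric// gt0_mulye ?leey// lte_fin invr_gt0 subr_gt0//.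
Qed.

End power_sums.

(** * Integrals compared with step functions *)

Section step_functions.
Context d (T : measurableType d) (R : realType) (m : {measure set T -> \bar R}).
Local Open Scope ereal_scope.
Implicit Types (I : (set T)^nat) (c : (\bar R)^nat) (D : set T).

Let step c I t := \sum_(0 <= n <oo) c n * (\1_(I n) t)%:E.

Let step_ge0 c I t : (forall n, 0 <= c n) -> 0 <= step c I t.
Proof. by move=> c0; apply: nneseries_ge0 => n _ _; rewrite mule_ge0. Qed.

Let measurable_step c I D : (forall n, 0 <= c n) ->
  (forall n, measurable (I n)) -> measurable_fun D (step c I).
Proof.
move=> c0 mI; apply: ge0_emeasurable_sum => [n t _ _|n _].
  by rewrite mule_ge0.
by apply: measurable_funeM; apply/measurable_EFinP; exact: measurable_indic.
Qed.

Let integral_step c I D : (forall n, 0 <= c n) ->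
  (forall n, measurable (I n)) -> measurable D ->
  \int[m]_(t in D) step c I t = \sum_(0 <= n <oo) c n * m (I n `&` D).
Proof.
move=> c0 mI mD; rewrite integral_nneseries//; last 2 first.
- by move=> n; apply: measurable_funeM; apply/measurable_EFinP; exact: measurable_indic.
- by move=> n t _; rewrite mule_ge0.
apply: eq_eseriesr => n _; rewrite ge0_integralZl//; last first.
  by apply/measurable_EFinP; exact: measurable_indic.
by rewrite integral_indic.
Qed.

(** Two families of sets, since small and large scales are enumerated in
    opposite directions. *)
Lemma integral_le_steps c1 I1 c2 I2 D (f : T -> \bar R) :
  measurable D -> (forall t, D t -> 0 <= f t) ->
  (forall n, 0 <= c1 n) -> (forall n, 0 <= c2 n) ->
  (forall n, measurable (I1 n)) -> (forall n, measurable (I2 n)) ->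
  (forall t, D t -> (exists n, I1 n t /\ f t <= c1 n) \/
                    (exists n, I2 n t /\ f t <= c2 n)) ->
  \int[m]_(t in D) f t <=
    \sum_(0 <= n <oo) c1 n * m (I1 n) + \sum_(0 <= n <oo) c2 n * m (I2 n).
Proof.
move=> mD f0 c10 c20 mI1 mI2 fc.
have stepI c I n t : (forall n, 0 <= c n) -> I n t -> c n <= step c I t.
  move=> c0 Int; have := @nneseries_term R (fun n => c n * (\1_(I n) t)%:E) n.
  rewrite indicE mem_set// mule1; apply.
  by move=> j; rewrite mule_ge0.
apply: (@le_trans _ _ (\int[m]_(t in D) (step c1 I1 t + step c2 I2 t))).
  apply: le_lower_integral => // t Dt; first by rewrite adde_ge0// step_ge0.
  case: (fc t Dt) => -[n [Int fn]]; apply: (le_trans fn).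
    by apply: (le_trans (stepI _ _ _ _ c10 Int)); rewrite leeDl// step_ge0.
  by apply: (le_trans (stepI _ _ _ _ c20 Int)); rewrite leeDr// step_ge0.
rewrite ge0_integralD//; try exact: measurable_step;
  try by move=> t _; exact: step_ge0.
have mle A : measurable A -> m (A `&` D) <= m A.
  move=> mA; apply: le_measure; last exact: subIsetl.
    by apply: mem_set; exact: measurableI.
  exact: mem_set.
rewrite !integral_step//; apply: leeD; apply: lee_nneseries => [n _ _|n _].
- by rewrite mule_ge0.
- by rewrite lee_wpmul2l// mle.
- by rewrite mule_ge0.
- by rewrite lee_wpmul2l// mle.
Qed.

(** As the sets are disjoint, the step function takes one of the values [c n]
    at each point, and lies below [f]. *)
Lemma integral_ge_steps c I D (f : T -> \bar R) :
  measurable D -> (forall t, D t -> 0 <= f t) -> (forall n, 0 <= c n) ->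
  (forall n, measurable (I n)) -> trivIset setT I ->
  (forall n t, I n t -> D t /\ c n <= f t) ->
  \sum_(0 <= n <oo) c n * m (I n) <= \int[m]_(t in D) f t.
Proof.
move=> mD f0 c0 mI tI cf.
apply: (@le_trans _ _ (\int[m]_(t in D) step c I t)).
  rewrite integral_step//; apply: lee_nneseries => [n _ _|n _].
    by rewrite mule_ge0.
  rewrite (_ : I n `&` D = I n)//; apply/setIidPl => t /cf[]//.
apply: le_lower_integral => // t Dt; first exact: step_ge0.
have [[n Int]|noI] := pselect (exists n, I n t); last first.
  rewrite /step eseries0 ?f0// => n _ _; rewrite indicE memNset ?mule0//.
  by move=> Int; apply: noI; exists n.
rewrite /step (@nneseriesD1 _ _ n) //; last by move=> k _; rewrite mule_ge0.
rewrite eseries0 ?adde0 => [|k _ /= kn].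
  by rewrite indicE mem_set// mule1; have [] := cf _ _ Int.
rewrite indicE memNset ?mule0// => Ikt; move/eqP: kn; apply.
by apply: (tI k n Logic.I Logic.I); exists t.
Qed.

End step_functions.

(** * Averages *)

Section averages.
Context d (T : measurableType d) (R : realType) (m : {measure set T -> \bar R}).
Local Open Scope ereal_scope.
Implicit Types (A B : set T) (F G : T -> \bar R) (u : T -> R) (p c K : R).

Definition average B F := (m B)^-1 * \int[m]_(y in B) F y.

Definition mean B u : R := ((fine (m B))^-1 * \int[m]_(y in B) u y)%R.

Lemma positive_measureE B : 0 < m B -> m B < +oo ->
  exists2 v : R, (0 < v)%R & m B = v%:E.
Proof.
move=> B0 Boo; have Bfin : m B \is a fin_num by rewrite ge0_fin_numE.
by exists (fine (m B)); [rewrite -lte_fin fineK|rewrite fineK].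
Qed.

Lemma average_ge0 B F : (forall y, B y -> 0 <= F y) -> 0 <= average B F.
Proof. by move=> F0; rewrite mule_ge0 ?inve_ge0// integral_ge0. Qed.

Lemma le_average B F G : (forall y, B y -> 0 <= F y) ->
  (forall y, B y -> F y <= G y) -> average B F <= average B G.
Proof.
move=> F0 FG; rewrite lee_wpmul2l ?inve_ge0// le_lower_integral// => y By.
exact: le_trans (F0 y By) (FG y By).
Qed.

Lemma average_enlarge A B F K : A `<=` B -> 0 < m A -> m B < +oo ->
  measurable A -> measurable B ->
  m B <= K%:E * m A -> (forall y, B y -> 0 <= F y) ->
  average A F <= K%:E * average B F.
Proof.
move=> AB A0 Boo mA mB BA F0.
have mAB : m A <= m B by apply: le_measure => //; exact: mem_set.
have [a a0 ma] := positive_measureE A0 (le_lt_trans mAB Boo).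
have [b b0 mb] := positive_measureE (lt_le_trans A0 mAB) Boo.
have int_ge0 : 0 <= \int[m]_(y in B) F y by exact: integral_ge0.
rewrite /average ma mb !inver !gt_eqF// muleA.
apply: (@le_trans _ _ ((a^-1)%:E * \int[m]_(y in B) F y)).
  by rewrite lee_wpmul2l ?lee_fin ?invr_ge0 ?(ltW a0)// le_lower_integral// => y /AB /F0.
rewrite lee_wpmul2r// -EFinM lee_fin.
move: BA; rewrite ma mb -EFinM lee_fin => bKa.
by rewrite ler_pdivlMr// ler_pdivrMl// mulrC.
Qed.

Lemma averageZl B F K : measurable B -> measurable_fun B F ->
  (forall y, B y -> 0 <= F y) -> (0 <= K)%R ->
  average B (fun y => K%:E * F y) = K%:E * average B F.
Proof.
by move=> mB mF F0 K0; rewrite /average ge0_integralZl// muleCA.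
Qed.

Lemma average_cst B (k : \bar R) : measurable B -> 0 < m B -> m B < +oo ->
  average B (cst k) = k.
Proof.
move=> mB B0 Boo; have [v v0 mv] := positive_measureE B0 Boo.
rewrite /average integral_cst// mv inver gt_eqF// muleC -muleA -EFinM.
by rewrite mulfV ?gt_eqF// mule1.
Qed.

Lemma averageD B F G : measurable B -> measurable_fun B F ->
  measurable_fun B G -> (forall y, B y -> 0 <= F y) ->
  (forall y, B y -> 0 <= G y) ->
  average B (fun y => F y + G y) = average B F + average B G.
Proof.
move=> mB mF mG F0 G0; rewrite /average ge0_integralD//.
by rewrite ge0_muleDr ?integral_ge0.
Qed.

Lemma integrable_cst_lty B c : measurable B -> m B < +oo ->
  m.-integrable B (EFin \o cst c).
Proof.
move=> mB Boo; apply/integrableP; split; first exact/measurable_EFinP.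
rewrite (_ : \int[m]_(y in B) _ = \int[m]_(y in B) (cst `|c%:E| y))//.
by rewrite integral_cst// lte_mul_pinfty.
Qed.

(** A form of Jensen's inequality, with a constant. Instead of convexity, the
    proof uses x <= l + l^(1-p) x^p for every l > 0, and takes for l the p-th
    root of the average on the right. *)
Lemma mean_dist B u c p : (1 <= p)%R -> measurable B -> 0 < m B ->
  m B < +oo -> m.-integrable B (EFin \o u) ->
  (`|mean B u - c| `^ p)%:E <=
    (2 `^ p)%:E * average B (fun y => (`|u y - c| `^ p)%:E).
Proof.
move=> p1 mB B0 Boo iu; have [v v0 mv] := positive_measureE B0 Boo.
have p0 : (0 < p)%R by exact: lt_le_trans p1.
have mu_ : measurable_fun B u by apply/measurable_EFinP; exact: measurable_int iu.
pose F y := (`|u y - c| `^ p)%:E.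
have F0 y : 0 <= F y by rewrite lee_fin powR_ge0.
have mN : measurable_fun B (fun y => `|u y - c|%R).
  apply: (measurableT_comp (@normr_measurable R setT)) => //.
  by apply: measurable_funB => //; exact: measurable_cst.
have mF : measurable_fun B F.
  apply/measurable_EFinP; apply: (measurableT_comp (measurable_powR p)) mN.
have : 0 <= \int[m]_(y in B) F y by exact: integral_ge0.
rewrite /average -/F mv inver gt_eqF//.
case iF : (\int[m]_(y in B) F y) => [i| |]//; last first.
  by move=> _; rewrite gt0_muley ?gt0_muley ?leey ?lte_fin ?invr_gt0// powR_gt0.
rewrite lee_fin => i0.
rewrite -EFinM lee_fin.
have icst : m.-integrable B (EFin \o cst c).
  exact: integrable_cst_lty.
have iuc : m.-integrable B (EFin \o (fun y => u y - c)%R).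
  by apply: (integrableB mB iu icst).
have mean_cE : (mean B u - c = v^-1 * \int[m]_(y in B) (u y - c))%R.
  rewrite /mean RintegralB// Rintegral_cst// mv /= mulrBr; congr (_ - _)%R.
  by rewrite mulrC mulfK// gt_eqF.
(* cut at height l: below l the integrand is at most l, above l it is at
   most l^(1-p) times its p-th power *)
have main l : (0 < l)%R -> (v^-1 * i <= l `^ p)%R ->
    (`|mean B u - c| <= 2 * l)%R.
  move=> l0 il.
  have cut x : (0 <= x)%R -> (x <= l + l `^ (1 - p) * x `^ p)%R.
    move=> x0; have [xl|lx] := leP x l.
      by rewrite (le_trans xl)// lerDl mulr_ge0 ?powR_ge0.
    rewrite -[leLHS]add0r lerD ?(ltW l0)//.
    have x0' : (0 < x)%R by exact: lt_trans lx.
    rewrite -{1}(powRr1 x0) -[X in (x `^ X)%R](subrK p 1%R) powRD; last first.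
      by rewrite (gt_eqF x0') implybT.
    rewrite ler_wpM2r ?powR_ge0// -opprB !powRN lef_pV2 ?posrE ?powR_gt0//.
    by apply: ge0_ler_powR; rewrite ?nnegrE ?subr_ge0 ?(ltW l0) ?(ltW lx).
  rewrite mean_cE normrM ger0_norm ?invr_ge0 ?(ltW v0)//.
  rewrite ler_pdivrMl// -lee_fin.
  apply: (@le_trans _ _ (\int[m]_(y in B) (`|u y - c|%:E))).
    rewrite EFin_normr_Rintegral//.
    apply: (le_trans (le_abse_integral _ mB _)).
      by apply: measurable_int iuc.
    by [].
  apply: (@le_trans _ _ (\int[m]_(y in B) (l%:E + (l `^ (1 - p))%:E * F y))).
    apply: le_lower_integral => // y _.
      apply: adde_ge0; first by rewrite lee_fin ltW.
      by rewrite -EFinM lee_fin mulr_ge0 ?powR_ge0.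
    by rewrite -EFinM -EFinD lee_fin cut.
  have Zi : \int[m]_(y in B) ((l `^ (1 - p))%:E * F y) = (l `^ (1 - p) * i)%:E.
    by rewrite ge0_integralZl ?lee_fin ?powR_ge0// iF.
  rewrite ge0_integralD//; last 3 first.
  - by move=> y _; rewrite lee_fin ltW.
  - by move=> y _; rewrite mule_ge0// lee_fin powR_ge0.
  - exact: measurable_funeM.
  rewrite Zi integral_cst// mv -EFinM -EFinD lee_fin.
  rewrite [leRHS]mulrC -mulrA mulrDl mul1r lerD//.
  have : (l `^ (1 - p) * (v^-1 * i) <= l)%R.
    apply: (@le_trans _ _ (l `^ (1 - p) * l `^ p)%R).
      by rewrite ler_wpM2l ?powR_ge0.
    rewrite -powRD; last by rewrite (gt_eqF l0) implybT.
    by rewrite subrK powRr1 ?(ltW l0).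
  by rewrite mulrCA ler_pdivrMl// [(v * l)%R]mulrC.
(* the average may vanish, while l has to be positive: hence the excess e *)
apply/ler_addgt0Pl => e e0.
have e2 : (0 < e / 2 `^ p)%R by rewrite divr_gt0// powR_gt0.
have vi : (0 < v^-1 * i + e / 2 `^ p)%R.
  by rewrite ltr_wpDl// mulr_ge0 ?invr_ge0 ?(ltW v0).
have := main ((v^-1 * i + e / 2 `^ p) `^ p^-1)%R.
rewrite powR_gt0// -powRrM mulVf ?gt_eqF// powRr1 ?(ltW vi)// lerDl (ltW e2).
move=> /(_ isT isT) le2.
apply: (@le_trans _ _ ((2 * (v^-1 * i + e / 2 `^ p) `^ p^-1) `^ p)%R).
  by apply: ge0_ler_powR => //; rewrite ?nnegrE ?(ltW p0)// mulr_ge0 ?powR_ge0.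
rewrite powRM ?powR_ge0// -powRrM mulVf ?gt_eqF// powRr1 ?(ltW vi)//.
by rewrite mulrDr addrC [(e / _)%R]mulrC mulrA mulfV ?mul1r// gt_eqF// powR_gt0.
Qed.

End averages.

(** * Measurability of ball averages *)

Lemma measurable_inve d (T : measurableType d) (R : realType) (D : set T)
    (f : T -> \bar R) :
  measurable D -> measurable_fun D f ->
  (forall x, D x -> 0 < f x < +oo)%E ->
  measurable_fun D (fun x => (f x)^-1)%E.
Proof.
move=> mD mf f0.
apply: (@eq_measurable_fun _ _ _ _ D (EFin \o ((@powR R)^~ (-1) \o (fine \o f)))).
  move=> x /set_mem Dx /=; have /andP[fx0 fxoo] := f0 x Dx.
  rewrite powR_inv1 ?fine_ge0 ?ltW//.
  have fx : f x \is a fin_num by rewrite ge0_fin_numE// ltW.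
  rewrite -[in RHS](fineK fx) inver gt_eqF// -lte_fin fineK//.
apply/measurable_EFinP; apply: (measurableT_comp (measurable_powR (-1))).
by apply: (measurableT_comp (fine_measurable _)).
Qed.

Section ball_averages.
Context {R : realType} {X : completeMetricType R}.
Local Open Scope ereal_scope.
Variables (a : nat -> X) (m : {measure set (borel X) -> \bar R}).
Variables (S : set (borel X)) (t : R).
Hypotheses (da : dense_seq a) (sm : sigma_finite setT m) (mS : measurable S).

Lemma measurable_ball_measure :
  measurable_fun setT (fun x : borel X => m (ball (x : X) t `&` S)).
Proof.
have := @measurable_ball_integral R X a m S t (cst 1) da sm mS
  (measurable_cst _) (fun=> lee01).
apply: eq_measurable_fun => x _ /=.
rewrite integral_cst ?mul1e//; apply: measurableI => //.
exact: measurable_ball_borel.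
Qed.

Lemma measurable_ball_average (F : borel X * borel X -> \bar R)
    (D : set (borel X)) :
  measurable D -> (forall x : X, D x -> 0 < m (ball x t `&` S) < +oo) ->
  measurable_fun setT F -> (forall xy, 0 <= F xy) ->
  measurable_fun D (fun x : borel X =>
    average m (ball (x : X) t `&` S) (fun y => F (x, y))).
Proof.
move=> mD D0 mF F0; apply: emeasurable_funM.
  apply: measurable_inve => //.
  apply: (@measurable_funS _ _ _ _ setT) => //.
  exact: measurable_ball_measure.
apply: (@measurable_funS _ _ _ _ setT) => //.
exact: measurable_ball_integral da sm mS mF F0.
Qed.

Lemma measurable_ball_average_fun (F : borel X -> \bar R) (D : set (borel X)) :
  measurable D -> (forall x : X, D x -> 0 < m (ball x t `&` S) < +oo) ->
  measurable_fun S F -> (forall y, S y -> 0 <= F y) ->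
  measurable_fun D (fun x : borel X => average m (ball (x : X) t `&` S) F).
Proof.
move=> mD D0 mF F0.
have := @measurable_ball_average (fun xy => (F \_ S) xy.2) D mD D0.
have mFS : measurable_fun setT (F \_ S) by exact/(measurable_restrictT _ mS).
have H1 := measurableT_comp mFS (@measurable_snd _ _ (borel X) (borel X)).
have FS0 x : 0 <= (F \_ S) x by exact: erestrict_ge0.
move=> /(_ H1 (fun xy => FS0 xy.2)); apply: eq_measurable_fun => x _.
rewrite /average; congr (_ * _); apply: eq_integral => y /set_mem[_ Sy].
by rewrite patch_in.
Qed.

Lemma measurable_ball_mean (u : borel X -> R) :
  (forall x : X, 0 < m (ball x t `&` S) < +oo) ->
  measurable_fun S u ->
  measurable_fun setT (fun x : borel X => mean m (ball (x : X) t `&` S) u).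
Proof.
move=> S0 mu.
have mur : measurable_fun S (EFin \o u) by exact/measurable_EFinP.
have musr : measurable_fun setT ((EFin \o u) \_ S) by exact/(measurable_restrictT _ mS).
have mint (F : borel X -> \bar R) : measurable_fun S F -> (forall y, S y -> 0 <= F y) ->
  measurable_fun setT (fun x : borel X => \int[m]_(y in ball (x : X) t `&` S) F y).
  move=> mF F0.
  have mFS : measurable_fun setT (F \_ S) by exact/(measurable_restrictT _ mS).
  have H1 := measurableT_comp mFS (@measurable_snd _ _ (borel X) (borel X)).
  have FS0 x : 0 <= (F \_ S) x by exact: erestrict_ge0.
  have := @measurable_ball_integral R X a m S t _ da sm mS H1 (fun xy => FS0 xy.2).
  apply: eq_measurable_fun => x _.
  by apply: eq_integral => y /set_mem[_ Sy]; rewrite /= patch_in.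
apply: measurable_funM.
  apply: (@eq_measurable_fun _ _ _ _ setT
      (fine \o (fun x : borel X => (m (ball (x : X) t `&` S))^-1))).
    move=> x _ /=; have /andP[x0 xoo] := S0 x.
    have [v v0 ->] := positive_measureE x0 xoo.
    by rewrite inver gt_eqF.
  apply: (measurableT_comp (fine_measurable _)) => //.
  apply: measurable_inve => //; first exact: measurable_ball_measure.
apply: (measurableT_comp (fine_measurable _)) => //.
apply: (@eq_measurable_fun _ _ _ _ setT (fun x : borel X =>
   \int[m]_(y in ball (x : X) t `&` S) (EFin \o u)^\+ y -
   \int[m]_(y in ball (x : X) t `&` S) (EFin \o u)^\- y)).
  by move=> x _; rewrite [RHS]integralE.
apply: emeasurable_funB; apply: mint.
- exact: measurable_funepos.
- by move=> y _; exact: funepos_ge0.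
- exact: measurable_funeneg.
- by move=> y _; exact: funeneg_ge0.
Qed.

End ball_averages.

(** * Doubling measures *)

Section doubling.
Context {R : realType} {X : completeMetricType R}.
Local Open Scope ereal_scope.
Variables (Omega : set X) (mu : {measure set (borel X) -> \bar R}).
Variables (Cmu p : R).
Hypotheses (oO : open Omega) (dO : dense Omega).
Hypotheses (mu0 : mu (~` Omega) = 0).
Hypotheses (Cmu1 : (1 <= Cmu)%R) (dbl : doubling Omega mu Cmu).
Hypothesis (p1 : (1 <= p)%R).

Local Notation Bo z r := (ball z r `&` Omega).

Let mO : measurable (Omega : set (borel X)).
Proof. exact: measurable_open_borel. Qed.

Let mB (z : X) r : measurable (Bo z r : set (borel X)).
Proof. by apply: measurableI => //; exact: measurable_ball_borel. Qed.

Let leB (A B : set X) : A `<=` B -> measurable (A : set (borel X)) ->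
  measurable (B : set (borel X)) -> mu A <= mu B.
Proof. by move=> AB mA mB'; apply: le_measure => //; exact: mem_set. Qed.

Let measurable_onB (F : borel X -> \bar R) (z : X) r :
  measurable_fun (Omega : set (borel X)) F ->
  measurable_fun (Bo z r : set (borel X)) F.
Proof. by move=> mF; apply: (measurable_funS mO _ mF); exact: subIsetr. Qed.

Let Cmu0 : (0 < Cmu)%R. Proof. exact: lt_le_trans Cmu1. Qed.

Let ex_point (z : X) (r : R) : (0 < r)%R -> exists2 x, Omega x & ball z r x.
Proof.
move=> r0; have [|x [zx Ox]] := dO _ (open_ball_metric z r).
  by exists z; exact: ballxx.
by exists x.
Qed.

Lemma subset_ball (z w : X) (r s : R) : ball w (s - r) z ->
  ball z r `<=` ball w s.
Proof. by move=> wz y zy; rewrite -(subrK r s); exact: ball_triangle zy. Qed.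

(** The doubling condition concerns centres in [Omega], while here the centre
    may lie on the boundary: by density a ball around a point of [Omega] is
    contained in the given one. *)
Lemma doubling_ball_gt0 (z : X) (r : R) : (0 < r)%R -> 0 < mu (Bo z r).
Proof.
move=> r0; have r20 : (0 < r / 2)%R by rewrite divr_gt0.
have [x Ox zx] := ex_point z r20.
have r40 : (0 < r / 4)%R by rewrite divr_gt0.
have [V0 _ _] := dbl Ox r40; apply: (lt_le_trans V0).
apply: leB => //; apply: setSI; apply: subset_ball.
by apply: le_ball zx; lra.
Qed.

Lemma doubling_ball_lty (z : X) (r : R) : (0 < r)%R -> mu (Bo z r) < +oo.
Proof.
move=> r0; have [x Ox zx] := ex_point z r0.
have [_ V1 V2] := dbl Ox r0; apply: le_lt_trans V2; apply: le_trans V1.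
apply: leB => //; apply: setSI; apply: subset_ball.
by apply: ball_sym; apply: le_ball zx; lra.
Qed.

(** Doubling is applied at a point x of [Omega] at distance less than r / 2 from
    z: then B(x, r / 2) is contained in B(z, r), and four doublings of its radius
    give a ball that contains B(w, 4 r). *)
Lemma doubling_shift (z w : X) (r : R) : (0 < r)%R -> ball z (2 * r) w ->
  mu (Bo w (4 * r)) <= (Cmu ^+ 4)%:E * mu (Bo z r).
Proof.
move=> r0 zw; have r20 : (0 < r / 2)%R by rewrite divr_gt0.
have [x Ox zx] := ex_point z r20.
have D s : (0 < s)%R -> mu (Bo x (2 * s)) <= Cmu%:E * mu (Bo x s).
  by move=> s0; have [] := dbl Ox s0.
apply: (@le_trans _ _ (mu (Bo x (2 * (2 * (2 * (2 * (r / 2)))))))).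
  apply: leB => //; apply: setSI; apply: subset_ball.
  by apply: (le_ball _ (ball_triangle (ball_sym zx) zw)); lra.
rewrite !exprS expr0 mulr1 !EFinM -!muleA.
have K0 : 0 <= Cmu%:E by rewrite lee_fin ltW.
do 3 (apply: (le_trans (D _ _)); [lra|rewrite lee_wpmul2l//]).
apply: (le_trans (D _ _)); [lra|rewrite lee_wpmul2l//].
apply: leB => //; apply: setSI; apply: subset_ball.
by apply: (le_ball _ zx); lra.
Qed.

Lemma doubling_dense_seq : exists a : nat -> X, dense_seq a.
Proof.
apply: (@ex_dense_seq _ _ mu _ point) => x r r0.
have -> : mu (ball x r) = mu (Bo x r).
  rewrite -[in LHS](setIT (ball x r)) -(setUv Omega) setIUr measureU//=.
  - rewrite [X in _ + X](_ : _ = 0) ?adde0//.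
    apply/eqP; rewrite eq_le measure_ge0 andbT -mu0.
    apply: leB; first exact: subIsetr.
    + apply: measurableI; first exact: measurable_ball_borel.
      exact: measurableC.
    + exact: measurableC.
  - apply: measurableI; first exact: measurable_ball_borel.
    exact: measurableC.
  - by rewrite setIACA setICr setI0.
by rewrite doubling_ball_gt0// doubling_ball_lty.
Qed.

Lemma doubling_sigma_finite : sigma_finite setT mu.
Proof.
exists (fun n => Bo (point : X) n.+1%:R `|` ~` Omega).
  apply/esym/seteqP; split=> // x _.
  have [Ox|nOx] := pselect (Omega x); last by exists 0%N => //; right.
  exists (Num.Def.archi_bound (mdist (point : X) x)) => //; left; split=> //.
  rewrite ballEmdist /=; apply: lt_le_trans (archi_boundP _) _.
    exact: mdist_ge0.
  by rewrite ler_nat.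
move=> n; split; first by apply: measurableU => //; exact: measurableC.
apply: (@le_lt_trans _ _ (mu (Bo (point : X) n.+1%:R) + mu (~` Omega))).
  by apply: measureU2 => //; exact: measurableC.
by rewrite mu0 adde0 doubling_ball_lty.
Qed.

Lemma measurable_ball_mean_self (u : borel X -> R) (s : R) : (0 < s)%R ->
  measurable_fun (Omega : set (borel X)) u ->
  measurable_fun (Omega : set (borel X))
    (fun x : borel X => ball_mean Omega mu p u (u x) x s).
Proof.
move=> s0 mu_; have [a da] := doubling_dense_seq.
pose u' := u \_ (Omega : set (borel X)).
have mu' : measurable_fun setT u' by exact/(measurable_restrictT _ mO).
have mF : measurable_fun setT
    (fun xy : borel X * borel X => (`|u' xy.2 - u' xy.1| `^ p)%:E).
  apply/measurable_EFinP; apply: (measurableT_comp (measurable_powR p)).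
  apply: (measurableT_comp (@normr_measurable R setT)) => //.
  apply: measurable_funB.
    exact: (measurableT_comp mu' measurable_snd).
  exact: (measurableT_comp mu' measurable_fst).
have V x (_ : Omega x) : 0 < mu (Bo x s) < +oo.
  by rewrite doubling_ball_gt0// doubling_ball_lty.
have := @measurable_ball_average R X a mu Omega s da doubling_sigma_finite mO
  _ Omega mO V mF.
have F0 (xy : borel X * borel X) : 0 <= (`|u' xy.2 - u' xy.1| `^ p)%:E.
  by rewrite lee_fin powR_ge0.
move=> /(_ F0); apply: eq_measurable_fun => x /set_mem Ox.
rewrite /average /ball_mean; congr (_ * _); apply: eq_integral => y /set_mem[_ Oy].
by rewrite /u' /= !patchE !mem_set.
Qed.

Section function.
Variable u : borel X -> R.
Hypothesis mu_ : measurable_fun (Omega : set (borel X)) u.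
Hypothesis iu : forall (z : X) (r : R), (0 < r)%R ->
  mu.-integrable (Bo z r) (EFin \o u).

(** The inner radius is twice the outer one, so that the inner balls contain
    B(z, s). *)
Definition mean_oscillation (s : R) (z : X) : \bar R :=
  average mu (Bo z s) (fun x => ball_mean Omega mu p u (u x) x (2 * s)).

Let bm_ge0 (f : borel X -> R) c (x : X) r : 0 <= ball_mean Omega mu p f c x r.
Proof.
by rewrite mule_ge0 ?inve_ge0 ?integral_ge0// => y _; rewrite lee_fin powR_ge0.
Qed.

Lemma mean_oscillation_ge0 s z : 0 <= mean_oscillation s z.
Proof. by apply: average_ge0 => x _; exact: bm_ge0. Qed.

Lemma measurable_mean_oscillation s : (0 < s)%R ->
  measurable_fun setT (mean_oscillation s : borel X -> \bar R).
Proof.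
move=> s0; have [a da] := doubling_dense_seq.
apply: (@measurable_ball_average_fun R X a mu Omega s da doubling_sigma_finite mO
  _ setT) => //.
- by move=> x _; rewrite doubling_ball_gt0// doubling_ball_lty.
- by apply: measurable_ball_mean_self => //; rewrite mulr_gt0.
Qed.

Let K : R := (2 `^ p * Cmu ^+ 4)%R.

Let K0 : (0 <= K)%R.
Proof. by rewrite mulr_ge0 ?powR_ge0// exprn_ge0// ltW. Qed.

(** For x in B(z, s), the ball B(x, 2 s) contains B(z, s) and has comparable
    measure, so that the local oscillation of u at x bounds the distance from
    u x to the mean over B(z, s). *)
Lemma ball_mean_mean_le (z : X) s : (0 < s)%R ->
  ball_mean Omega mu p u (mean mu (Bo z s) u) z s <=
    K%:E * mean_oscillation s z.
Proof.
move=> s0; rewrite -averageZl//; last first.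
  by apply: measurable_onB; apply: measurable_ball_mean_self => //; rewrite mulr_gt0.
apply: le_average => // x [zx Ox].
rewrite distrC.
apply: (le_trans (mean_dist (u x) p1 (mB z s) (doubling_ball_gt0 z s0)
  (doubling_ball_lty z s0) (iu z s0))).
rewrite EFinM -muleA lee_wpmul2l ?lee_fin ?powR_ge0//.
have s20 : (0 < 2 * s)%R by rewrite mulr_gt0.
apply: average_enlarge => //.
- apply: setSI; apply: subset_ball; apply: ball_sym.
  by apply: le_ball zx; lra.
- exact: doubling_ball_gt0.
- exact: doubling_ball_lty.
apply: (@le_trans _ _ (mu (Bo x (4 * s)))).
  by apply: leB => //; apply: setSI; apply: le_ball; lra.
by apply: doubling_shift => //; apply: le_ball zx; lra.
Qed.

(** B(w, r) is contained in B(z, 2 r) with comparable measure, hence its mean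
    is as close to the mean over B(z, 2 r) as u is, on average, in the larger
    ball. *)
Lemma mean_step (z w : X) r : (0 < r)%R -> ball z r w ->
  (`|mean mu (Bo w r) u - mean mu (Bo z (2 * r)) u| `^ p)%:E <=
    (K ^+ 2)%:E * mean_oscillation (2 * r) z.
Proof.
move=> r0 zw; have r20 : (0 < 2 * r)%R by rewrite mulr_gt0.
apply: (le_trans (mean_dist _ p1 (mB w r) (doubling_ball_gt0 w r0)
  (doubling_ball_lty w r0) (iu w r0))).
rewrite exprS expr1 EFinM -muleA.
apply: (@le_trans _ _ (K%:E * ball_mean Omega mu p u (mean mu (Bo z (2 * r)) u) z (2 * r))).
  rewrite EFinM -muleA lee_wpmul2l ?lee_fin ?powR_ge0//.
  apply: average_enlarge => //.
  - apply: setSI; apply: subset_ball.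
    by apply: le_ball zw; lra.
  - exact: doubling_ball_gt0.
  - exact: doubling_ball_lty.
  apply: (@le_trans _ _ (mu (Bo z (4 * r)))).
    by apply: leB => //; apply: setSI; apply: le_ball; lra.
  by apply: doubling_shift => //; apply: ball_sym; apply: le_ball zw; lra.
by rewrite lee_wpmul2l ?lee_fin// ball_mean_mean_le.
Qed.

End function.
End doubling.

(** * Codimension regular measures on the boundary *)

Section boundary.
Context {R : realType} {X : completeMetricType R}.
Local Open Scope ereal_scope.
Variables (Omega : set X) (mu nu : {measure set (borel X) -> \bar R}).
Variables (Cmu Cth theta D : R).
Hypotheses (oO : open Omega) (dO : dense Omega).
Hypotheses (mu0 : mu (~` Omega) = 0) (nu0 : nu Omega = 0).
Hypotheses (Cmu1 : (1 <= Cmu)%R) (dbl : doubling Omega mu Cmu).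
Hypotheses (Cth1 : (1 <= Cth)%R) (theta0 : (0 < theta)%R).
Hypothesis (cod : codim_regular Omega mu nu theta Cth).
Hypotheses (D0 : (0 < D)%R) (diamD : diam (~` Omega) = D%:E).

Local Notation Bo z r := (ball z r `&` Omega).
Local Notation Bd z r := (ball z r `&` ~` Omega).

Let mO : measurable (Omega : set (borel X)).
Proof. exact: measurable_open_borel. Qed.

Let mOc : measurable (~` Omega : set (borel X)).
Proof. exact: measurableC. Qed.

Let mBo (z : X) (r : R) : measurable (Bo z r : set (borel X)).
Proof. by apply: measurableI => //; exact: measurable_ball_borel. Qed.

Let mBd (z : X) (r : R) : measurable (Bd z r : set (borel X)).
Proof. by apply: measurableI => //; exact: measurable_ball_borel. Qed.

Let leB (m : {measure set (borel X) -> \bar R}) (A B : set X) : A `<=` B ->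
  measurable (A : set (borel X)) ->
  measurable (B : set (borel X)) -> m A <= m B.
Proof. by move=> AB mA mB'; apply: le_measure => //; exact: mem_set. Qed.

Let Cth0 : (0 < Cth)%R. Proof. exact: lt_le_trans Cth1. Qed.
Let Cmu0 : (0 < Cmu)%R. Proof. exact: lt_le_trans Cmu1. Qed.

Let V_gt0 (z : X) (r : R) : (0 < r)%R -> 0 < mu (Bo z r).
Proof. exact: doubling_ball_gt0 oO dO dbl z r. Qed.

Let V_lty (z : X) (r : R) : (0 < r)%R -> mu (Bo z r) < +oo.
Proof. exact: doubling_ball_lty oO dO dbl z r. Qed.

Lemma boundary_ball_full (z : X) (t : R) : (~` Omega) z -> (D < t)%R ->
  Bd z t = ~` Omega.
Proof.
move=> Oz Dt; apply/setIidr => w Ow; rewrite ballEmdist /=.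
apply: le_lt_trans Dt; rewrite -lee_fin -diamD.
by apply: ereal_sup_ubound; exists z => //; exists w.
Qed.

Definition codim_const : R := (Cth * 4 `^ theta)%R.

Let codim_const0 : (0 <= codim_const)%R.
Proof. by rewrite mulr_ge0 ?powR_ge0// ltW. Qed.

Let le2D (r : R) : (r <= 2 * D)%R -> r%:E <= 2%:E * diam (~` Omega).
Proof. by rewrite diamD -EFinM lee_fin. Qed.

Let codim_upper (z : X) (r : R) : (~` Omega) z -> (0 < r)%R -> (r <= 2 * D)%R ->
  nu (Bd z r) <= (Cth / r `^ theta)%:E * mu (Bo z r).
Proof.
move=> Oz r0 /le2D rD; have [_] := cod Oz r0 rD; rewrite inver gt_eqF ?powR_gt0//.
by move/le_trans; apply; rewrite EFinM -muleA [X in _ * X]muleC.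
Qed.

(** Regularity is assumed for radii up to 2 D. A ball of radius more than D
    contains the whole boundary, so that between 2 D and 8 D only r^theta changes,
    by a factor of at most 4^theta. *)
Lemma boundary_measure_le (z : X) (r : R) : (~` Omega) z -> (0 < r)%R ->
  (r <= 8 * D)%R -> nu (Bd z r) <= (codim_const / r `^ theta)%:E * mu (Bo z r).
Proof.
move=> Oz r0 r8.
have four : (1 <= 4 `^ theta :> R)%R.
  apply: (@le_trans _ _ (1 `^ theta)%R); first by rewrite powR1.
  by apply: ge0_ler_powR; rewrite ?nnegrE ?(ltW theta0)//; lra.
have [rD|Dr] := leP r (2 * D)%R.
  apply: (le_trans (codim_upper Oz r0 rD)); rewrite lee_wpmul2r// lee_fin.
  by rewrite ler_wpM2r ?invr_ge0 ?powR_ge0// /codim_const ler_peMr// ltW.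
have D20 : (0 < 2 * D)%R by rewrite mulr_gt0.
apply: (@le_trans _ _ (nu (Bd z (2 * D)))).
  by apply: leB => //; rewrite [X in _ `<=` X]boundary_ball_full//; lra.
apply: (le_trans (codim_upper Oz D20 (lexx _))).
apply: lee_pmul => //.
- by rewrite lee_fin divr_ge0 ?powR_ge0// ltW.
- rewrite lee_fin /codim_const -mulrA ler_pM2l// ler_pdivlMr ?powR_gt0//.
  rewrite mulrC ler_pdivrMr ?powR_gt0// -powRM ?(ltW D20)//.
  by apply: ge0_ler_powR; rewrite ?nnegrE ?(ltW theta0)// ?mulr_ge0 ?(ltW r0)//; lra.
- by apply: leB => //; apply: setSI; apply: le_ball; exact: ltW.
Qed.

Lemma interior_measure_le (z : X) (r : R) : (~` Omega) z -> (0 < r)%R ->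
  (r <= 2 * D)%R -> mu (Bo z r) <= (Cth * r `^ theta)%:E * nu (Bd z r).
Proof.
move=> Oz r0 /le2D rD; have [+ _] := cod Oz r0 rD.
rewrite inver gt_eqF ?powR_gt0//.
rewrite lee_pdivrMl// muleC lee_pdivrMl ?powR_gt0// => /le_trans; apply.
by rewrite muleA -EFinM mulrC.
Qed.

Lemma boundary_ball_gt0 (z : X) (r : R) : (~` Omega) z -> (0 < r)%R ->
  0 < nu (Bd z r).
Proof.
move=> Oz r0; pose s := Num.min r (2 * D)%R.
have s0 : (0 < s)%R by rewrite lt_min r0 mulr_gt0.
apply: (@lt_le_trans _ _ (nu (Bd z s))); last first.
  by apply: leB => //; apply: setSI; apply: le_ball; rewrite ge_min lexx.
have sD : (s <= 2 * D)%R by rewrite ge_min lexx orbT.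
have := interior_measure_le Oz s0 sD.
have V0 := doubling_ball_gt0 oO dO dbl z s0.
rewrite lt_neqAle measure_ge0 andbT => VN; apply/eqP => N0.
by move: VN; rewrite -N0 mule0 leNgt V0.
Qed.

Lemma boundary_lty : nu (~` Omega) < +oo.
Proof.
have [[z Oz]|noz] := pselect (exists z, (~` Omega) z); last first.
  rewrite (_ : ~` Omega = set0) ?measure0//.
  by apply/seteqP; split => // z Oz; apply: noz; exists z.
have D20 : (0 < 2 * D)%R by rewrite mulr_gt0.
rewrite -(@boundary_ball_full z (2 * D)) //; last lra.
apply: (le_lt_trans (codim_upper Oz D20 (lexx _))).
rewrite lte_mul_pinfty ?lee_fin ?divr_ge0 ?powR_ge0 ?(ltW Cth0)//.
exact: V_lty.
Qed.

Lemma boundary_ball_lty (z : X) (r : R) : nu (Bd z r) < +oo.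
Proof. by apply: le_lt_trans boundary_lty; apply: leB. Qed.

Lemma boundary_sigma_finite : sigma_finite setT nu.
Proof.
exists (fun=> setT); first by apply/esym/seteqP; split => // x _; exists 0%N.
move=> _; split=> //; rewrite -(setUv Omega).
apply: (@le_lt_trans _ _ (nu Omega + nu (~` Omega))); first exact: measureU2.
by rewrite nu0 add0e boundary_lty.
Qed.

Definition boundary_const : R := (codim_const * Cth * Cmu ^+ 4)%R.

Lemma boundary_const_ge0 : (0 <= boundary_const)%R.
Proof. by rewrite !mulr_ge0 ?exprn_ge0// ltW. Qed.

(** [nu] inherits doubling from [mu]: at each scale the codimension condition
    compares the two measures. *)
Lemma boundary_shift (z w : X) (t : R) : (~` Omega) z -> (~` Omega) w ->
  (0 < t)%R -> (t <= 2 * D)%R -> ball z (2 * t) w ->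
  nu (Bd w (4 * t)) <= boundary_const%:E * nu (Bd z t).
Proof.
move=> Oz Ow t0 tD zw; have t40 : (0 < 4 * t)%R by rewrite mulr_gt0.
have t8 : (4 * t <= 8 * D)%R by lra.
apply: (le_trans (boundary_measure_le Ow t40 t8)).
apply: (@le_trans _ _ ((codim_const / t `^ theta)%:E *
   ((Cmu ^+ 4)%:E * ((Cth * t `^ theta)%:E * nu (Bd z t))))).
  apply: lee_pmul => //.
  - by rewrite lee_fin divr_ge0 ?powR_ge0.
  - rewrite lee_fin ler_wpM2l// lef_pV2 ?posrE ?powR_gt0//.
    by apply: ge0_ler_powR; rewrite ?nnegrE ?(ltW theta0) ?(ltW t0) ?(ltW t40)//; lra.
  apply: (le_trans (doubling_shift oO dO Cmu1 dbl t0 zw)).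
  by rewrite lee_wpmul2l ?lee_fin ?exprn_ge0 ?(ltW Cmu0)// interior_measure_le.
rewrite !muleA -!EFinM lee_wpmul2r// lee_fin le_eqVlt; apply/orP; left; apply/eqP.
by rewrite /boundary_const; field; rewrite gt_eqF ?powR_gt0.
Qed.

Definition trace_const : R := (codim_const * Cmu ^+ 4)%R.

Lemma trace_const_ge0 : (0 <= trace_const)%R.
Proof. by rewrite !mulr_ge0 ?exprn_ge0// ltW. Qed.

Let inve_le (x y k : \bar R) (c : R) : 0 < x -> x < +oo -> 0 < y -> y < +oo ->
  (0 <= c)%R -> x <= c%:E * y -> y^-1 <= c%:E * x^-1.
Proof.
case: x => [x| |]//; case: y => [y| |]//; rewrite !lte_fin => x0 _ y0 _ c0.
rewrite !inver !gt_eqF// -!EFinM !lee_fin => xy.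
by rewrite ler_pdivlMr// ler_pdivrMl// mulrC.
Qed.

(** The smoothness theta / p is lost here. After the exchange of the integrals,
    [F x] is multiplied by the integral of 1 / mu(B(z, s)) over the boundary
    points z within s of x. If z0 is one of them, then mu(B(z, s)) is comparable
    to mu(B(z0, 4 s)) for all of them, and by regularity the measure of the set
    of these points is at most a constant times s^(-theta) mu(B(z0, 4 s)). *)
Lemma integral_boundary_average (F : borel X -> \bar R) (s : R) :
  (0 < s)%R -> (s <= 4 * D)%R ->
  measurable_fun (Omega : set (borel X)) F -> (forall x, Omega x -> 0 <= F x) ->
  \int[nu]_(z in ~` Omega) average mu (Bo z s) F <=
    (trace_const / s `^ theta)%:E * \int[mu]_(x in Omega) F x.
Proof.
move=> s0 s4 mF F0.
have [a da] := doubling_dense_seq oO dO mu0 dbl.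
have V0 z := doubling_ball_gt0 oO dO dbl z s0.
have Voo z := doubling_ball_lty oO dO dbl z s0.
have smu := doubling_sigma_finite oO dO mu0 dbl.
have c0 : 0 <= (trace_const / s `^ theta)%:E.
  by rewrite lee_fin divr_ge0 ?powR_ge0// trace_const_ge0.
have s20 : (0 < 2 * s)%R by rewrite mulr_gt0.
have s40 : (0 < 4 * s)%R by rewrite mulr_gt0.
have s8 : (2 * s <= 8 * D)%R by lra.
apply: (@ball_integral_swap R X a mu nu (Omega : set (borel X))
  (~` Omega : set (borel X)) s F (fun z => (mu (Bo z s))^-1)) => //.
- exact: boundary_sigma_finite.
- apply: measurable_inve => //.
    apply: (measurable_funS measurableT) => //.
    exact: measurable_ball_measure da smu mO.
  by move=> z _; rewrite V0 Voo.
- by move=> z _; rewrite inve_ge0.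
move=> x Ox.
have [[z0 [xz0 Oz0]]|noz] := pselect (exists z, Bd x s z); last first.
  rewrite (_ : Bd x s = set0) ?integral_set0//.
  by apply/seteqP; split => // z Bz; apply: noz; exists z.
pose k := ((Cmu ^+ 4)%:E * (mu (Bo z0 (4 * s)))^-1).
apply: (@le_trans _ _ (\int[nu]_(z in Bd x s) (cst k z))).
  apply: le_lower_integral => // z [xz Oz] //=.
  - by rewrite inve_ge0.
  - by rewrite mule_ge0 ?inve_ge0// lee_fin exprn_ge0// ltW.
  apply: inve_le => //.
  - exact: V_gt0.
  - exact: V_lty.
  - by rewrite exprn_ge0// ltW.
  apply: (doubling_shift oO dO Cmu1 dbl) => //.
  by apply: (le_ball _ (ball_triangle (ball_sym xz) xz0)); lra.
rewrite integral_cst//.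
have V4 := doubling_ball_gt0 oO dO dbl z0 s40.
have V4oo := doubling_ball_lty oO dO dbl z0 s40.
apply: (@le_trans _ _ (k * ((codim_const / s `^ theta)%:E * mu (Bo z0 (4 * s))))).
  rewrite lee_wpmul2l//.
    by rewrite mule_ge0 ?inve_ge0// lee_fin exprn_ge0// ltW.
  apply: (@le_trans _ _ (nu (Bd z0 (2 * s)))).
    apply: leB => //; apply: setSI; apply: subset_ball.
    by apply: (le_ball _ (ball_sym xz0)); lra.
  apply: (le_trans (boundary_measure_le Oz0 s20 s8)).
  apply: lee_pmul => //.
  - by rewrite lee_fin divr_ge0 ?powR_ge0.
  - rewrite lee_fin ler_wpM2l// lef_pV2 ?posrE ?powR_gt0//.
    by apply: ge0_ler_powR; rewrite ?nnegrE ?(ltW theta0) ?(ltW s0) ?(ltW s20)//; lra.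
  by apply: leB => //; apply: setSI; apply: le_ball; lra.
have [v v0 vE] := positive_measureE V4 V4oo.
rewrite /k vE inver gt_eqF// -!EFinM lee_fin le_eqVlt; apply/orP; left; apply/eqP.
by rewrite /trace_const; field; rewrite !gt_eqF ?powR_gt0.
Qed.

(** The same exchange with [nu] in both places: as [nu] is doubling, averaging
    over balls is bounded on integrable functions. *)
Lemma integral_boundary_self_average (G : borel X -> \bar R) (t : R) :
  (0 < t)%R -> (t <= 2 * D)%R ->
  measurable_fun (~` Omega : set (borel X)) G ->
  (forall x, (~` Omega) x -> 0 <= G x) ->
  \int[nu]_(z in ~` Omega) average nu (Bd z t) G <=
    boundary_const%:E * \int[nu]_(x in ~` Omega) G x.
Proof.
move=> t0 tD mG G0.
have [a da] := doubling_dense_seq oO dO mu0 dbl.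
have snu := boundary_sigma_finite.
have N0 z : (~` Omega) z -> 0 < nu (Bd z t) by move=> Oz; exact: boundary_ball_gt0.
have Noo z := boundary_ball_lty z t.
have t40 : (0 < 4 * t)%R by rewrite mulr_gt0.
apply: (@ball_integral_swap R X a nu nu (~` Omega : set (borel X))
  (~` Omega : set (borel X)) t G (fun z => (nu (Bd z t))^-1)) => //.
- apply: measurable_inve => //.
    apply: (measurable_funS measurableT) => //.
    exact: measurable_ball_measure da snu mOc.
  by move=> z Oz; rewrite N0//=.
- by move=> z _; rewrite inve_ge0.
- by rewrite lee_fin boundary_const_ge0.
move=> x Ox.
have N4 := boundary_ball_gt0 Ox t40.
pose k := (boundary_const%:E * (nu (Bd x (4 * t)))^-1).
have k0 : 0 <= k by rewrite mule_ge0 ?inve_ge0// lee_fin boundary_const_ge0.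
apply: (@le_trans _ _ (\int[nu]_(z in Bd x t) (cst k z))).
  apply: le_lower_integral => // z [xz Oz] //=; first by rewrite inve_ge0.
  apply: inve_le => //.
  - exact: boundary_ball_lty.
  - exact: N0.
  - exact: boundary_const_ge0.
  apply: boundary_shift => //.
  by apply: (le_ball _ (ball_sym xz)); lra.
rewrite integral_cst//.
apply: (@le_trans _ _ (k * nu (Bd x (4 * t)))).
  rewrite lee_wpmul2l//; apply: leB => //; apply: setSI; apply: le_ball; lra.
have [v v0 vE] := positive_measureE N4 (boundary_ball_lty x _).
by rewrite /k vE inver gt_eqF// -!EFinM lee_fin mulfVK// gt_eqF.
Qed.

End boundary.

(** * The trace and its oscillation *)

Section trace_definition.
Context {R : realType} {X : completeMetricType R}.

(** The radii of index at least 1 are those, up to 2 D, for which the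
    codimension condition is assumed. *)
Definition scale (D : R) (k : nat) : R := 4 * D / 2 ^+ k.

(** An upper limit is measurable in z, and equals the limit of the means
    wherever they converge. *)
Definition trace (Omega : set X) (mu : {measure set (borel X) -> \bar R})
    (D : R) (u : borel X -> R) (z : borel X) : R :=
  fine (limn_esup
    (fun k => (mean mu (ball (z : X) (scale D k) `&` Omega) u)%:E)).

Lemma scale_gt0 D k : 0 < D -> 0 < scale D k.
Proof. by move=> D0; rewrite divr_gt0 ?mulr_gt0 ?exprn_gt0. Qed.

Lemma scaleS D k : 2 * scale D k.+1 = scale D k.
Proof. by rewrite /scale exprS; field; rewrite expf_neq0. Qed.

Lemma scale_le D k : 0 < D -> scale D k <= 4 * D.
Proof.
move=> D0; rewrite ler_pdivrMr ?exprn_gt0// ler_peMr ?mulr_ge0 ?(ltW D0)//.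
by rewrite exprn_ege1// ler1n.
Qed.

Lemma scaleS_le D k : 0 < D -> scale D k.+1 <= 2 * D.
Proof.
by move=> D0; have := scale_le k D0; rewrite -scaleS; lra.
Qed.

End trace_definition.

Lemma powRD_le2 (R : realType) (p x y : R) : 0 < p -> 0 <= x -> 0 <= y ->
  (x + y) `^ p <= 2 `^ p * (x `^ p + y `^ p).
Proof.
move=> p0 x0 y0.
have [xy|yx] := leP x y.
  apply: (@le_trans _ _ ((2 * y) `^ p)).
    by apply: ge0_ler_powR; rewrite ?nnegrE ?(ltW p0) ?addr_ge0 ?mulr_ge0//; lra.
  by rewrite powRM// ler_wpM2l ?powR_ge0// lerDr powR_ge0.
apply: (@le_trans _ _ ((2 * x) `^ p)).
  by apply: ge0_ler_powR; rewrite ?nnegrE ?(ltW p0) ?addr_ge0 ?mulr_ge0//; lra.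
by rewrite powRM// ler_wpM2l ?powR_ge0// lerDl powR_ge0.
Qed.

Section trace.
Context {R : realType} {X : completeMetricType R}.
Local Open Scope ereal_scope.
Variables (Omega : set X) (mu nu : {measure set (borel X) -> \bar R}).
Variables (Cmu Cth theta D p lam : R).
Hypotheses (oO : open Omega) (dO : dense Omega).
Hypotheses (mu0 : mu (~` Omega) = 0) (nu0 : nu Omega = 0).
Hypotheses (Cmu1 : (1 <= Cmu)%R) (dbl : doubling Omega mu Cmu).
Hypotheses (Cth1 : (1 <= Cth)%R) (theta0 : (0 < theta)%R).
Hypothesis (cod : codim_regular Omega mu nu theta Cth).
Hypotheses (D0 : (0 < D)%R) (diamD : diam (~` Omega) = D%:E).
Hypotheses (p1 : (1 <= p)%R) (lam1 : (1 < lam)%R).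

Local Notation Bo z r := (ball z r `&` Omega).
Local Notation Bd z r := (ball z r `&` ~` Omega).
Local Notation sc := (scale D).
Local Notation trace := (trace Omega mu D).

Let mO : measurable (Omega : set (borel X)).
Proof. exact: measurable_open_borel. Qed.

Let mOc : measurable (~` Omega : set (borel X)).
Proof. exact: measurableC. Qed.

Let mBd (z : X) r : measurable (Bd z r : set (borel X)).
Proof. by apply: measurableI => //; exact: measurable_ball_borel. Qed.

Let Cmu_ge0 : (0 <= Cmu)%R. Proof. exact: le_trans Cmu1. Qed.
Let Cth_ge0 : (0 <= Cth)%R. Proof. exact: le_trans Cth1. Qed.
Let p0 : (0 < p)%R. Proof. exact: lt_le_trans p1. Qed.
Let lam0 : (0 < lam)%R. Proof. exact: lt_trans lam1. Qed.
Let sc0 k : (0 < sc k)%R. Proof. exact: scale_gt0. Qed.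
Let lamE n : 0 <= (lam ^+ n)%:E.
Proof. by rewrite lee_fin exprn_ge0// ltW. Qed.

Definition step_const : R := ((2 `^ p * Cmu ^+ 4) ^+ 2)%R.
Definition dist_const : R := (geometric_const p lam * step_const)%R.

Let step_const0 : (0 <= step_const)%R. Proof. exact: sqr_ge0. Qed.
Let dist_const0 : (0 <= dist_const)%R.
Proof. by rewrite mulr_ge0// ltW// geometric_const_gt0. Qed.
Let trc0 : (0 <= trace_const Cmu Cth theta)%R. Proof. exact: trace_const_ge0. Qed.
Let bdc0 : (0 <= boundary_const Cmu Cth theta)%R. Proof. exact: boundary_const_ge0. Qed.

Section function.
Variable u : borel X -> R.
Hypothesis mu_ : measurable_fun (Omega : set (borel X)) u.
Hypothesis iu : forall (z : X) (r : R), (0 < r)%R ->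
  mu.-integrable (Bo z r) (EFin \o u).

Local Notation W k z := (mean_oscillation Omega mu p u (sc k) z).
Local Notation av k z := (mean mu (Bo z (sc k)) u).

Let W0 k z : 0 <= W k z. Proof. exact: mean_oscillation_ge0. Qed.
Let mW k : measurable_fun setT (mean_oscillation Omega mu p u (sc k) : borel X -> \bar R).
Proof. exact: (measurable_mean_oscillation p oO dO mu0 dbl mu_ (sc0 k)). Qed.

Lemma trace_approximation (z : X) n :
  \sum_(0 <= j <oo) (lam ^+ j)%:E * W (n + j)%N z < +oo ->
  (fun k => av k z) @ \oo --> trace u z /\
  (`|trace u z - av n z| `^ p)%:E <=
    dist_const%:E * \sum_(0 <= j <oo) (lam ^+ j)%:E * W (n + j)%N z.
Proof.
move=> Woo.
pose b j := av (n + j)%N z.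
have sumE : \sum_(0 <= j <oo) (lam ^+ j)%:E * (step_const%:E * W (n + j)%N z) =
    step_const%:E * \sum_(0 <= j <oo) (lam ^+ j)%:E * W (n + j)%N z.
  rewrite -nneseriesZl; last by move=> j _; rewrite mule_ge0.
  by apply: eq_eseriesr => j _; rewrite muleCA.
have [|||cb bl] :=
  @lim_weighted_increments R b (fun j => step_const%:E * W (n + j)%N z) lam p p0 lam1.
- by move=> j; rewrite mule_ge0.
- move=> j; rewrite /b addnS -(scaleS D (n + j)).
  apply: (mean_step oO dO mu0 Cmu1 dbl p1 mu_ iu) => //.
  exact: ballxx.
- by rewrite sumE lte_mul_pinfty// lee_fin.
have ca : (fun k => av k z) @ \oo --> limn b.
  rewrite -(cvg_shiftn n) (_ : [sequence _]_k = b)//.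
  by apply/funext => k /=; rewrite /b addnC.
have te : trace u z = limn b.
  rewrite /trace (_ : limn_esup _ = (limn b)%:E)//.
  have cE : (fun k => (av k z)%:E) @ \oo --> (limn b)%:E.
    by apply: cvg_EFin ca; near=> k.
  by rewrite is_cvg_limn_esupE; [exact/cvg_lim|apply/cvg_ex; exists (limn b)%:E].
rewrite te; split; first exact: ca.
by move: bl; rewrite sumE muleA -EFinM /b addn0.
Unshelve. all: by end_near. Qed.

(** Where the sum is infinite the bound is trivial, so that no exceptional set
    appears. *)
Lemma trace_dist (z : X) n :
  (`|trace u z - av n z| `^ p)%:E <=
    dist_const%:E * \sum_(0 <= j <oo) (lam ^+ j)%:E * W (n + j)%N z.
Proof.
have := ltey (\sum_(0 <= j <oo) (lam ^+ j)%:E * W (n + j)%N z).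
case: eqVneq => [->|_ /trace_approximation[]//] _.
rewrite gt0_muley ?leey// lte_fin mulr_gt0 ?geometric_const_gt0//.
by rewrite exprn_gt0// mulr_gt0 ?powR_gt0// exprn_gt0// (lt_le_trans _ Cmu1).
Qed.

Lemma measurable_mean_scale k :
  measurable_fun setT (fun z : borel X => av k (z : X)).
Proof.
have [a da] := doubling_dense_seq oO dO mu0 dbl.
apply: (@measurable_ball_mean R X a mu (Omega : set (borel X))) => //.
  exact: doubling_sigma_finite oO dO mu0 dbl.
move=> x; rewrite (doubling_ball_gt0 oO dO dbl)//=.
exact: (doubling_ball_lty oO dO dbl).
Qed.

Lemma measurable_trace : measurable_fun setT (trace u).
Proof.
change (measurable_fun setT (fine \o (fun z : borel X =>
  limn_esup (fun k => (av k (z : X))%:E)))).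
apply: measurableT_comp; first exact: fine_measurable.
apply: (@measurable_fun_limn_esup _ _ _ setT
  (fun k (z : borel X) => (av k (z : X))%:E)) => k.
by apply/measurable_EFinP; exact: measurable_mean_scale.
Qed.

Let G n (z : borel X) := (`|trace u z - av n (z : X)| `^ p)%:E.

Let mG n : measurable_fun setT (G n).
Proof.
apply/measurable_EFinP; apply: (measurableT_comp (measurable_powR p)).
apply: (measurableT_comp (@normr_measurable R setT)) => //.
by apply: measurable_funB; [exact: measurable_trace|exact: measurable_mean_scale].
Qed.

Let G0 n z : 0 <= G n z. Proof. by rewrite lee_fin powR_ge0. Qed.

Let restr (F : borel X -> \bar R) (A : set (borel X)) :
  measurable_fun setT F -> measurable_fun A F.
Proof. by move=> mF; apply: (measurable_funS measurableT _ mF). Qed.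

(** The bound that [integral_boundary_average] gives, up to a constant, for the
    integral over the boundary of the mean oscillation at scale k. *)
Definition scaled_oscillation k : \bar R :=
  ((sc k `^ theta)^-1)%:E * oscillation Omega mu p u (2 * sc k).

Definition multiscale_oscillation n : \bar R :=
  \sum_(0 <= j <oo) (lam ^+ j)%:E * scaled_oscillation (n + j)%N.

Lemma oscillation_ge0 (S : set X) (m : {measure set (borel X) -> \bar R}) f t :
  0 <= oscillation S m p f t.
Proof.
apply: integral_ge0 => x _; apply: average_ge0 => y _.
by rewrite lee_fin powR_ge0.
Qed.

Lemma scaled_oscillation_ge0 k : 0 <= scaled_oscillation k.
Proof. by rewrite mule_ge0 ?oscillation_ge0// lee_fin invr_ge0 powR_ge0. Qed.

Let lso_ge0 j k : 0 <= (lam ^+ j)%:E * scaled_oscillation k.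
Proof. by rewrite mule_ge0// scaled_oscillation_ge0. Qed.

Lemma integral_mean_oscillation k :
  \int[nu]_(z in ~` Omega) W k z <=
    (trace_const Cmu Cth theta)%:E * scaled_oscillation k.
Proof.
rewrite muleA -EFinM.
apply: (@integral_boundary_average R X Omega mu nu Cmu Cth theta D) => //.
- exact: scale_le.
- by apply: (measurable_ball_mean_self p oO dO mu0 dbl) => //; rewrite mulr_gt0.
- move=> x _; apply: average_ge0 => y _; by rewrite lee_fin powR_ge0.
Qed.

Lemma integral_mean_oscillation_sum n :
  \int[nu]_(z in ~` Omega) (\sum_(0 <= j <oo) (lam ^+ j)%:E * W (n + j)%N z) <=
    (trace_const Cmu Cth theta)%:E * multiscale_oscillation n.
Proof.
rewrite integral_nneseries//; last 2 first.
- by move=> j; apply: measurable_funeM; exact: restr.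
- by move=> j z _; rewrite mule_ge0.
rewrite -nneseriesZl; last by [].
apply: lee_nneseries => [j _ _|j _].
  by apply: integral_ge0 => z _; rewrite mule_ge0.
rewrite ge0_integralZl//; last exact: restr.
by rewrite muleCA lee_wpmul2l// integral_mean_oscillation.
Qed.

Lemma integral_trace_dist n :
  \int[nu]_(z in ~` Omega) (`|trace u z - av n (z : X)| `^ p)%:E <=
    (dist_const * trace_const Cmu Cth theta)%:E * multiscale_oscillation n.
Proof.
rewrite EFinM -muleA.
apply: (@le_trans _ _ (\int[nu]_(z in ~` Omega) (dist_const%:E *
    \sum_(0 <= j <oo) (lam ^+ j)%:E * W (n + j)%N z))).
  apply: le_lower_integral => // z _; last exact: trace_dist.
  by rewrite mule_ge0// nneseries_ge0// => j _ _; rewrite mule_ge0.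
rewrite ge0_integralZl//; last 2 first.
- apply: ge0_emeasurable_sum => [j z _ _|j _]; first by rewrite mule_ge0.
  by apply: measurable_funeM; exact: restr.
- by move=> z _; apply: nneseries_ge0 => j _ _; rewrite mule_ge0.
by rewrite lee_wpmul2l ?integral_mean_oscillation_sum.
Qed.

Lemma multiscale_oscillationS n :
  multiscale_oscillation n.+1 <= multiscale_oscillation n.
Proof.
rewrite [leRHS]/multiscale_oscillation nneseries_recl//.
rewrite -(@nneseries_addn _ (fun j => (lam ^+ j)%:E * scaled_oscillation (n + j)%N) 1%N)//.
apply: (@le_trans _ _ (\sum_(0 <= j <oo)
    (lam ^+ (j + 1))%:E * scaled_oscillation (n + (j + 1))%N)); last first.
  by rewrite leeDr.
apply: lee_nneseries => [//|j _].
rewrite addn1 addnS addSn lee_wpmul2r ?scaled_oscillation_ge0// lee_fin.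
by rewrite exprS ler_peMl ?exprn_ge0 ?(ltW lam0)// ltW.
Qed.

Lemma scaled_oscillation_le n : scaled_oscillation n <= multiscale_oscillation n.
Proof.
have := @nneseries_term R (fun j => (lam ^+ j)%:E * scaled_oscillation (n + j)%N) 0%N.
by rewrite /= expr0 mul1e addn0; apply.
Qed.

Let cst4 : R := ((2 `^ p) ^+ 2)%R.
Let cst4_ge0 : (0 <= cst4)%R. Proof. exact: sqr_ge0. Qed.

Let pow_quad (x y a b c : R) :
  (`|x - y| `^ p <= cst4 * (`|x - a| `^ p +
     (`|y - c| `^ p + (`|a - b| `^ p + `|c - b| `^ p))))%R.
Proof.
apply: (@le_trans _ _ (((`|x - a| + `|a - b|) + (`|y - c| + `|c - b|)) `^ p)%R).
  apply: ge0_ler_powR; rewrite ?nnegrE ?(ltW p0)// ?addr_ge0//.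
  have -> : (x - y = ((x - a) + (a - b)) - ((y - c) + (c - b)))%R by ring.
  apply: (le_trans (ler_normB _ _)).
  by apply: lerD; exact: ler_normD.
apply: (le_trans (powRD_le2 p0 _ _)); rewrite ?addr_ge0//.
rewrite /cst4 expr2 -mulrA ler_wpM2l ?powR_ge0//.
have H1 := powRD_le2 p0 (normr_ge0 (x - a)%R) (normr_ge0 (a - b)%R).
have H2 := powRD_le2 p0 (normr_ge0 (y - c)%R) (normr_ge0 (c - b)%R).
apply: (le_trans (lerD H1 H2)); rewrite -mulrDr ler_wpM2l ?powR_ge0//.
lra.
Qed.

Definition trace_osc_const : R :=
  (boundary_const Cmu Cth theta * (2 `^ p) ^+ 2 *
   ((boundary_const Cmu Cth theta + 1) *
      (dist_const * trace_const Cmu Cth theta) +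
    2 * (step_const * trace_const Cmu Cth theta)))%R.

Let Bd_gt0 (z : X) (t : R) : (~` Omega) z -> (0 < t)%R -> 0 < nu (Bd z t).
Proof.
by move=> Oz t0; exact: (boundary_ball_gt0 oO dO dbl Cth1 cod D0 diamD Oz t0).
Qed.

Let Bd_lty (z : X) (t : R) : nu (Bd z t) < +oo.
Proof. exact: (boundary_ball_lty oO dO dbl Cth1 cod D0 diamD). Qed.

(** [T u w] and [T u z] are compared through the means over the balls around w
    and z at scale n + 1, which are both close to the mean around z at
    scale n. *)
Let ball_mean_trace_le n t (z : X) : (~` Omega) z ->
  (sc n.+2 < t <= sc n.+1)%R ->
  ball_mean (~` Omega) nu p (trace u) (trace u z) z t <=
  (boundary_const Cmu Cth theta * cst4)%:E *
  (average nu (Bd z (sc n.+1)) (G n.+1) +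
   (G n.+1 z + (step_const%:E * W n z + step_const%:E * W n z))).
Proof.
move=> Oz /andP[t1 t2].
have t0 : (0 < t)%R by exact: lt_trans t1.
have r2D : (sc n.+1 <= 2 * D)%R by exact: scaleS_le.
have t2D : (t <= 2 * D)%R by exact: le_trans r2D.
pose k := G n.+1 z + (step_const%:E * W n z + step_const%:E * W n z).
have k0 : 0 <= k by rewrite !adde_ge0// mule_ge0.
have mG' : measurable_fun (Bd z (sc n.+1) : set (borel X)) (G n.+1).
  exact: (@restr (G n.+1) (Bd z (sc n.+1) : set (borel X))).
apply: (@le_trans _ _ ((boundary_const Cmu Cth theta)%:E *
  average nu (Bd z (sc n.+1)) (fun w => (`|trace u w - trace u z| `^ p)%:E))).
  apply: average_enlarge => //.
  - by apply: setSI; exact: le_ball.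
  - exact: Bd_gt0.
  - apply: (@le_trans _ _ (nu (Bd z (4 * t)))).
      apply: le_measure; [exact: mem_set|exact: mem_set|].
      apply: setSI; apply: le_ball.
      by move: t1; have := scaleS D n.+1; lra.
    apply: (boundary_shift oO dO Cmu1 dbl Cth1 theta0 cod D0 diamD) => //.
    by apply: ballxx; rewrite mulr_gt0.
rewrite (EFinM _ cst4) -[leRHS]muleA lee_wpmul2l ?lee_fin//.
rewrite -/k -(average_cst k (mBd z (sc n.+1)) (Bd_gt0 Oz (sc0 _)) (Bd_lty z _)).
rewrite -averageD//.
rewrite -averageZl//; last 2 first.
- by apply: emeasurable_funD.
- by move=> w _; rewrite adde_ge0.
apply: le_average => [w _|w [zw Ow]]; first by rewrite lee_fin powR_ge0.
have step1 : (`|av n.+1 w - av n z| `^ p)%:E <= step_const%:E * W n z.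
  rewrite -(scaleS D n).
  exact: (mean_step oO dO mu0 Cmu1 dbl p1 mu_ iu (sc0 _) zw).
have step2 : (`|av n.+1 z - av n z| `^ p)%:E <= step_const%:E * W n z.
  rewrite -(scaleS D n).
  apply: (mean_step oO dO mu0 Cmu1 dbl p1 mu_ iu (sc0 _)).
  exact: ballxx.
apply: (@le_trans _ _ (cst4%:E * (G n.+1 w + (G n.+1 z +
   ((`|av n.+1 w - av n z| `^ p)%:E + (`|av n.+1 z - av n z| `^ p)%:E))))).
  by rewrite /G -!EFinD -EFinM lee_fin; exact: pow_quad.
rewrite lee_wpmul2l ?lee_fin// leeD2l// leeD2l//.
exact: (leeD step1 step2).
Qed.

Lemma boundary_oscillation_le n t : (sc n.+2 < t <= sc n.+1)%R ->
  oscillation (~` Omega) nu p (trace u) t <=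
    trace_osc_const%:E * multiscale_oscillation n.
Proof.
move=> tn.
have cW z : 0 <= step_const%:E * W n z by rewrite mule_ge0.
have aG z : 0 <= average nu (Bd z (sc n.+1)) (G n.+1) by exact: average_ge0.
have mcW : measurable_fun (~` Omega : set (borel X))
    (fun z : borel X => step_const%:E * W n (z : X)).
  by apply: measurable_funeM; exact: restr.
have maG : measurable_fun (~` Omega : set (borel X))
    (fun z : borel X => average nu (Bd (z : X) (sc n.+1)) (G n.+1)).
  have [a da] := doubling_dense_seq oO dO mu0 dbl.
  apply: (@measurable_ball_average_fun R X a nu (~` Omega : set (borel X))) => //.
  - exact: (boundary_sigma_finite oO dO nu0 dbl Cth1 cod D0 diamD).
  - by move=> x Ox; rewrite Bd_gt0// Bd_lty.
  - exact: restr.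
have mGc : measurable_fun (~` Omega : set (borel X)) (G n.+1) by exact: restr.
apply: (@le_trans _ _ (\int[nu]_(z in ~` Omega)
  ((boundary_const Cmu Cth theta * cst4)%:E *
  (average nu (Bd z (sc n.+1)) (G n.+1) +
   (G n.+1 z + (step_const%:E * W n z + step_const%:E * W n z)))))).
  apply: le_lower_integral => // z Oz.
  - by apply: average_ge0 => w _; rewrite lee_fin powR_ge0.
  - by apply: mule_ge0; [rewrite lee_fin mulr_ge0|rewrite !adde_ge0].
  - exact: ball_mean_trace_le.
have mk1 : measurable_fun (~` Omega : set (borel X))
    (fun z : borel X => step_const%:E * W n (z : X) + step_const%:E * W n (z : X)).
  exact: emeasurable_funD.
have mk2 : measurable_fun (~` Omega : set (borel X))
    (fun z : borel X => G n.+1 z +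
       (step_const%:E * W n (z : X) + step_const%:E * W n (z : X))).
  exact: emeasurable_funD.
have c0 : (0 <= boundary_const Cmu Cth theta * cst4)%R by rewrite mulr_ge0.
rewrite ge0_integralZl//; last 2 first.
- exact: emeasurable_funD.
- by move=> z _; rewrite !adde_ge0.
rewrite /trace_osc_const [in leRHS]EFinM -[leRHS]muleA lee_wpmul2l ?lee_fin//.
rewrite ge0_integralD//; last by move=> z _; rewrite !adde_ge0.
rewrite ge0_integralD//; last by move=> z _; rewrite !adde_ge0.
rewrite ge0_integralD// ge0_integralZl//; last exact: restr.
have IW : step_const%:E * \int[nu]_(z in ~` Omega) W n z <=
    (step_const * trace_const Cmu Cth theta)%:E * multiscale_oscillation n.
  rewrite [in leRHS]EFinM -muleA lee_wpmul2l ?lee_fin//.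
  apply: (le_trans (integral_mean_oscillation n)).
  by rewrite lee_wpmul2l ?lee_fin// scaled_oscillation_le.
have IG : \int[nu]_(z in ~` Omega) G n.+1 z <=
    (dist_const * trace_const Cmu Cth theta)%:E * multiscale_oscillation n.
  apply: (le_trans (integral_trace_dist n.+1)).
  apply: lee_wpmul2l; [by rewrite lee_fin mulr_ge0|exact: multiscale_oscillationS].
have IG0 : 0 <= \int[nu]_(z in ~` Omega) G n.+1 z by exact: integral_ge0.
have IA : \int[nu]_(z in ~` Omega) average nu (Bd z (sc n.+1)) (G n.+1) <=
    (boundary_const Cmu Cth theta)%:E * \int[nu]_(z in ~` Omega) G n.+1 z.
  apply: (integral_boundary_self_average oO dO mu0 nu0 Cmu1 dbl Cth1 theta0 cod
    D0 diamD) => //.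
  exact: scaleS_le.
have E0 : 0 <= multiscale_oscillation n by exact: nneseries_ge0.
apply: (@le_trans _ _ ((boundary_const Cmu Cth theta)%:E *
  ((dist_const * trace_const Cmu Cth theta)%:E * multiscale_oscillation n) +
  ((dist_const * trace_const Cmu Cth theta)%:E * multiscale_oscillation n +
   ((step_const * trace_const Cmu Cth theta)%:E * multiscale_oscillation n +
   (step_const * trace_const Cmu Cth theta)%:E * multiscale_oscillation n)))).
  apply: leeD; last by apply: leeD => //; exact: leeD.
  by apply: (le_trans IA); rewrite lee_wpmul2l ?lee_fin.
rewrite muleA -EFinM -!ge0_muleDl ?lee_fin ?addr_ge0 ?mulr_ge0// -?EFinD.
rewrite lee_wpmul2r// lee_fin; first lra.
all: first [exact: Cmu_ge0|exact: Cth_ge0|exact: ltW (geometric_const_gt0 p0 lam1)].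
Qed.

(** Balls of radius 2 D or more contain the whole boundary. *)
Lemma boundary_oscillation_far t : (2 * D < t)%R ->
  oscillation (~` Omega) nu p (trace u) t =
  oscillation (~` Omega) nu p (trace u) (sc 1).
Proof.
move=> Dt; apply: eq_integral => z /set_mem Oz.
have s1 : (sc 1 = 2 * D)%R by rewrite /scale expr1; field.
rewrite /ball_mean (boundary_ball_full diamD Oz) ?(boundary_ball_full diamD Oz)//.
- by rewrite s1 ltr_pMl// ltr1n.
- by apply: lt_trans Dt; rewrite ltr_pMl// ltr1n.
Qed.

End function.
End trace.

(** * Dyadic form of the Besov seminorm *)

Lemma lebesgue_measure_oc (R : realType) (a b : R) : a <= b ->
  lebesgue_measure (`]a, b]%classic : set R) = (b - a)%:E.
Proof.
rewrite lebesgue_measure_itv /= lte_fin le_eqVlt => /predU1P[->|->].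
  by rewrite ltxx subrr.
by rewrite EFinB.
Qed.

Lemma scaleD (R : realType) (D : R) n j :
  scale D (n + j) = scale D n / 2 ^+ j.
Proof. by rewrite /scale exprD invfM mulrA. Qed.

Lemma scale_anti (R : realType) (D : R) m n : 0 < D -> (m <= n)%N ->
  scale D n <= scale D m.
Proof.
move=> D0 mn; rewrite -(subnKC mn) scaleD ler_pdivrMr ?exprn_gt0//.
by rewrite ler_peMr ?(ltW (scale_gt0 _ D0))// exprn_ege1// ler1n.
Qed.

Section interior_besov.
Context {R : realType} {X : completeMetricType R}.
Local Open Scope ereal_scope.
Variables (Omega : set X) (mu : {measure set (borel X) -> \bar R}).
Variables (Cmu p al D : R).
Hypotheses (oO : open Omega) (dO : dense Omega).
Hypotheses (mu0 : mu (~` Omega) = 0).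
Hypotheses (Cmu1 : (1 <= Cmu)%R) (dbl : doubling Omega mu Cmu).
Hypotheses (p1 : (1 <= p)%R) (D0 : (0 < D)%R) (al0 : (0 < al)%R).
Variable u : borel X -> R.
Hypothesis mu_ : measurable_fun (Omega : set (borel X)) u.

Local Notation Bo z r := (ball z r `&` Omega).
Local Notation osc := (oscillation Omega mu p u).
Local Notation tau k := (2 * scale D k)%R.

Let p0 : (0 < p)%R. Proof. exact: lt_le_trans p1. Qed.
Let Cmu0 : (0 < Cmu)%R. Proof. exact: lt_le_trans Cmu1. Qed.
Let tau0 k : (0 < tau k)%R. Proof. by rewrite mulr_gt0// scale_gt0. Qed.

Let mO : measurable (Omega : set (borel X)).
Proof. exact: measurable_open_borel. Qed.

Let mB (z : X) r : measurable (Bo z r : set (borel X)).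
Proof. by apply: measurableI => //; exact: measurable_ball_borel. Qed.

(** The oscillation is defined by means and need not increase with the radius,
    but doubling makes it almost increasing between s and 2 s. *)
Lemma oscillation_doubling (s t : R) : (0 < s)%R -> (s <= t <= 2 * s)%R ->
  osc s <= (Cmu ^+ 4)%:E * osc t.
Proof.
move=> s0 /andP[st ts]; have t0 : (0 < t)%R by exact: lt_le_trans st.
have C0 : (0 <= Cmu ^+ 4)%R by rewrite exprn_ge0// ltW.
have bm0 x r : 0 <= ball_mean Omega mu p u (u x) x r.
  by apply: average_ge0 => y _; rewrite lee_fin powR_ge0.
rewrite -ge0_integralZl//; last exact: (measurable_ball_mean_self p oO dO mu0 dbl).
apply: le_lower_integral => // x Ox; first by rewrite mule_ge0.
apply: average_enlarge => //.
- by apply: setSI; exact: le_ball.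
- exact: (doubling_ball_gt0 oO dO dbl).
- exact: (doubling_ball_lty oO dO dbl).
apply: (@le_trans _ _ (mu (Bo x (4 * s)))).
  apply: le_measure; [exact: mem_set|exact: mem_set|].
  by apply: setSI; apply: le_ball; lra.
by apply: (doubling_shift oO dO Cmu1 dbl) => //; apply: ballxx; rewrite mulr_gt0.
Qed.

Section finite_exponent.
Variable s : R.
Hypothesis s1 : (1 <= s)%R.

Let s0 : (0 < s)%R. Proof. exact: lt_le_trans s1. Qed.

(** The exponent is that of t^(- al s - 1), raised by one for the length of a
    dyadic interval. *)
Definition dyadic_term k : \bar R :=
  (tau k `^ (- (al * s)))%:E * osc (tau k) `^ (s / p).

Definition dyadic_const : R :=
  ((Cmu ^+ 4) `^ (s / p) * 2 `^ (al * s + 1))%R.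

Lemma dyadic_const_gt0 : (0 < dyadic_const)%R.
Proof. by rewrite mulr_gt0 ?powR_gt0// exprn_gt0. Qed.

Lemma dyadic_term_ge0 k : 0 <= dyadic_term k.
Proof. by rewrite mule_ge0 ?poweR_ge0// lee_fin powR_ge0. Qed.

(** Between tau and 2 tau the integrand is at least its value at tau, up to a
    constant, and the intervals for different scales are disjoint. *)
Lemma dyadic_sum_le :
  \sum_(0 <= k <oo) dyadic_term k <= dyadic_const%:E *
   \int[lebesgue_measure]_(t in `]0%R, +oo[)
       (osc t `^ (s / p) / (t `^ (al * s + 1))%:E).
Proof.
pose C4 := ((Cmu ^+ 4) `^ (s / p))%R.
have C40 : (0 < C4)%R by rewrite powR_gt0// exprn_gt0.
pose c k := ((C4 * (2 * tau k) `^ (al * s + 1))^-1)%:E * osc (tau k) `^ (s / p).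
have c0 k : 0 <= c k.
  by rewrite mule_ge0 ?poweR_ge0// lee_fin invr_ge0 mulr_ge0 ?powR_ge0// ltW.
have t20 k : (0 < 2 * tau k)%R by rewrite mulr_gt0.
have cE k : dyadic_term k = dyadic_const%:E * (c k * (tau k)%:E).
  rewrite /c muleAC -EFinM muleA -EFinM; congr (_%:E * _).
  move: (tau k) (tau0 k) => T T0.
  rewrite powRM ?(ltW T0)// powRN /dyadic_const -/C4.
  rewrite [X in (2 `^ _ * X)%R]powRD ?(gt_eqF T0) ?implybT//.
  rewrite powRr1 ?(ltW T0)//; field.
  by rewrite (gt_eqF T0) (gt_eqF C40) !gt_eqF ?powR_gt0.
under eq_eseriesr do rewrite cE.
rewrite nneseriesZl; last by move=> k _; rewrite mule_ge0// lee_fin ltW.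
rewrite lee_wpmul2l ?lee_fin ?(ltW dyadic_const_gt0)//.
pose I k : set R := `](tau k)%R, (2 * tau k)%R]%classic.
have IE k : lebesgue_measure (I k) = (tau k)%:E.
  rewrite lebesgue_measure_oc; first by congr (_%:E); ring.
  by rewrite ler_peMl ?(ltW (tau0 k))// ler1n.
under eq_eseriesr do rewrite -IE.
apply: integral_ge_steps => //.
- move=> t; rewrite /= in_itv/= andbT => t0.
  by rewrite mule_ge0 ?poweR_ge0 ?inve_ge0// lee_fin powR_ge0.
- by move=> n; exact: measurable_itv.
- apply: ltn_trivIset => n m mn.
  apply/seteqP; split => // t []; rewrite /I /= !in_itv/= => /andP[mt _] /andP[_ tn].
  have := lt_le_trans mt tn; rewrite ltNge => /negP; apply.
  rewrite ler_pM2l//; case: n mn {tn} => // n mn; rewrite scaleS.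
  exact: scale_anti.
- move=> k t; rewrite /I /= in_itv/= => /andP[tk kt].
  have t0 : (0 < t)%R by exact: lt_trans tk.
  split; first by rewrite in_itv /= t0.
  rewrite inver gt_eqF ?powR_gt0// muleC.
  rewrite /c invfM EFinM muleAC [leLHS]muleC.
  apply: lee_pmul; rewrite ?mule_ge0 ?poweR_ge0 ?lee_fin ?invr_ge0 ?powR_ge0 ?(ltW C40)//.
    rewrite lef_pV2 ?posrE ?powR_gt0//.
    apply: ge0_ler_powR; rewrite ?nnegrE ?(ltW t0) ?(ltW (t20 k))//.
    by rewrite addr_ge0// mulr_ge0// ltW.
  rewrite lee_pdivrMl//.
  have sp0 : (0 <= s / p)%R by rewrite divr_ge0// ltW.
  rewrite /C4 -poweR_EFin -poweRM ?oscillation_ge0//; last first.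
    by rewrite lee_fin exprn_ge0// ltW.
  apply: le_poweR => //; first exact: oscillation_ge0.
  by apply: oscillation_doubling => //; rewrite (ltW tk).
Qed.

End finite_exponent.
End interior_besov.

Section dyadic_index.
Context {R : realType}.
Variable D : R.
Hypothesis D0 : 0 < D.

Lemma ex_pow2_gt (x : R) : exists n, x < 2 ^+ n.
Proof.
exists (Num.Def.archi_bound `|x|); apply: (le_lt_trans (ler_norm x)).
apply: (lt_trans (archi_boundP (normr_ge0 x))).
by rewrite -natrX ltr_nat ltn_expl.
Qed.

Lemma scale1 : scale D 1 = 2 * D.
Proof. by rewrite /scale expr1; field. Qed.

Lemma ex_scale_small (t : R) : 0 < t -> t <= 2 * D ->
  exists n, scale D n.+2 < t <= scale D n.+1.
Proof.
move=> t0 tD.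
have exn : exists n, scale D n.+2 < t.
  have [n xn] := ex_pow2_gt (D / t); exists n.
  rewrite ltr_pdivrMr ?exprn_gt0//.
  by move: xn; rewrite ltr_pdivrMr// !exprS; lra.
have [n nt nmin] := ex_minnP exn; exists n; rewrite nt /=.
case: n nt nmin => [_ _|n _ nmin]; first by rewrite scale1.
by rewrite leNgt; apply/negP => /nmin; rewrite ltnn.
Qed.

Lemma ex_scale_large (t : R) : 2 * D < t ->
  exists k, 2 * D * 2 ^+ k < t <= 2 * D * 2 ^+ k.+1.
Proof.
move=> tD.
have exn : exists n, t <= 2 * D * 2 ^+ n.+1.
  have [n xn] := ex_pow2_gt (t / D); exists n.
  move: xn; rewrite ltr_pdivrMr// => xn.
  have : 0 < 2 ^+ n * D by rewrite mulr_gt0 ?exprn_gt0.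
  rewrite exprS; lra.
have [n nt nmin] := ex_minnP exn; exists n; rewrite nt andbT.
case: n nt nmin => [_ _|n _ nmin]; first by rewrite expr0 mulr1.
by rewrite ltNge; apply/negP => /nmin; rewrite ltnn.
Qed.

End dyadic_index.

Section weak_estimates.
Context {R : realType} {X : completeMetricType R}.
Local Open Scope ereal_scope.
Variables (Omega : set X) (mu : {measure set (borel X) -> \bar R}).
Variables (Cmu p al theta D : R) (q : \bar R).
Hypotheses (oO : open Omega) (dO : dense Omega).
Hypotheses (mu0 : mu (~` Omega) = 0).
Hypotheses (Cmu1 : (1 <= Cmu)%R) (dbl : doubling Omega mu Cmu).
Hypotheses (p1 : (1 <= p)%R) (D0 : (0 < D)%R) (al0 : (0 < al)%R).
Hypothesis (q1 : 1 <= q).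
Hypothesis (beta0 : (0 < al * p - theta)%R).
Variable u : borel X -> R.
Hypothesis mu_ : measurable_fun (Omega : set (borel X)) u.

Local Notation osc := (oscillation Omega mu p u).
Local Notation tau k := (2 * scale D k)%R.
Local Notation N := (besov_seminorm Omega mu al p q u).
Local Notation beta := (al * p - theta)%R.

Let p0 : (0 < p)%R. Proof. exact: lt_le_trans p1. Qed.
Let sc0 k : (0 < scale D k)%R. Proof. exact: scale_gt0. Qed.
Let tau0 k : (0 < tau k)%R. Proof. by rewrite mulr_gt0. Qed.

Definition weak_const : R :=
  if q is s%:E then (dyadic_const Cmu p al s `^ s^-1)%R else 1%R.

Lemma weak_const_ge0 : (0 <= weak_const)%R.
Proof. by rewrite /weak_const; case: q => // s; exact: powR_ge0. Qed.

Lemma besov_seminorm_ge0 (S : set X) (m : {measure set (borel X) -> \bar R}) a f :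
  0 <= besov_seminorm S m a p q f.
Proof.
have sup0 : 0 <= ereal_sup [set (t `^ a)^-1%:E * oscillation S m p f t `^ p^-1
                   | t in [set t : R | (0 < t)%R]].
  apply: (@le_trans _ _ ((1 `^ a)^-1%:E * oscillation S m p f 1 `^ p^-1)).
    by rewrite mule_ge0 ?poweR_ge0// lee_fin invr_ge0 powR_ge0.
  by apply: ereal_sup_ubound; exists 1%R => //=.
by rewrite /besov_seminorm; case: q => // s; exact: poweR_ge0.
Qed.

(** One term of the dyadic sum, or one radius in the supremum, is at most the
    whole. Thus all q share the bound of q = +oo at dyadic scales. *)
Lemma oscillation_weak k :
  osc (tau k) <= (weak_const `^ p * tau k `^ (al * p))%:E * N `^ p.
Proof.
have o0 : 0 <= osc (tau k) by exact: oscillation_ge0.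
have T0 := tau0 k; set T := tau k in o0 T0 *.
rewrite /weak_const /besov_seminorm.
case: q q1 => [s| |]//; last first.
  move=> _; set sup := ereal_sup _.
  rewrite powR1 mul1r.
  have : (T `^ al)^-1%:E * osc T `^ p^-1 <= sup.
    by apply: ereal_sup_ubound; exists T.
  rewrite lee_pdivrMl ?powR_gt0// => H.
  have sup0 : 0 <= sup.
    apply: (le_trans _ (ereal_sup_ubound _)); last by exists T.
    by rewrite mule_ge0 ?poweR_ge0// lee_fin invr_ge0 powR_ge0.
  have := le_poweR (ltW p0) (poweR_ge0 _ _) H.
  rewrite -poweRrM mulVf ?gt_eqF// poweRe1// poweRM ?lee_fin ?powR_ge0//.
  by rewrite poweR_EFin -powRrM.
rewrite lee_fin => s1; have s0 : (0 < s)%R by exact: lt_le_trans s1.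
set I := \int[_]_(t in _) _.
have I0 : 0 <= I.
  apply: integral_ge0 => t; rewrite /= in_itv/= andbT => t0.
  by rewrite mule_ge0 ?poweR_ge0 ?inve_ge0// lee_fin powR_ge0.
have := dyadic_sum_le oO dO mu0 Cmu1 dbl p1 D0 al0 mu_ s1.
move=> /(le_trans (nneseries_term k (dyadic_term_ge0 _ _ _ _ _ _ _))).
rewrite -/I /dyadic_term -/T powRN lee_pdivrMl ?powR_gt0// muleA -EFinM.
have sp0 : (0 < s / p)%R by rewrite divr_gt0.
have sV : ((s / p)^-1 = s^-1 * p)%R by rewrite invf_div mulrC.
have dc := ltW (dyadic_const_gt0 p al Cmu1 s).
move=> /(le_poweR (ltW (_ : 0 < (s / p)^-1)%R)).
rewrite invr_gt0 => /(_ sp0 (poweR_ge0 _ _)).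
rewrite -poweRrM mulfV ?gt_eqF// poweRe1// => /le_trans; apply.
rewrite poweRM ?lee_fin ?mulr_ge0 ?powR_ge0// poweR_EFin powRM ?powR_ge0//.
rewrite sV [I `^ _]poweRrM -!powRrM mulrC.
rewrite (_ : al * s * (s^-1 * p) = al * p)%R//; field.
by rewrite gt_eqF.
Qed.

Local Notation lam := (2 `^ (beta / 2))%R.

Definition multiscale_const : R :=
  (weak_const `^ p * 2 `^ (al * p) / (1 - 2 `^ (- (beta / 2))))%R.

Lemma pow2_ratio (b : R) : (0 < b)%R -> (0 <= 2 `^ (- b) < 1)%R.
Proof.
move=> b0; rewrite powR_ge0 powRN invf_lt1 ?powR_gt0//.
have : (1 `^ b < 2 `^ b)%R.
  by apply: gt0_ltr_powR; rewrite ?nnegrE// ltr1n.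
by rewrite powR1.
Qed.

Lemma pow2_gt1 (b : R) : (0 < b)%R -> (1 < 2 `^ b)%R.
Proof.
move=> b0; have /andP[_] := pow2_ratio b0.
by rewrite powRN invf_lt1 ?powR_gt0.
Qed.

Lemma multiscale_const_ge0 : (0 <= multiscale_const)%R.
Proof.
rewrite divr_ge0 ?mulr_ge0 ?powR_ge0// subr_ge0.
have /andP[_ /ltW] := pow2_ratio (divr_gt0 beta0 (ltr0n R 2)); exact.
Qed.

Lemma scaleD_powR n j (b : R) :
  (scale D (n + j) `^ b = scale D n `^ b * (2 `^ (- b)) ^+ j)%R.
Proof.
rewrite scaleD powRM ?invr_ge0 ?exprn_ge0 ?(ltW (sc0 n))//; congr (_ * _)%R.
rewrite -[in RHS]powR_mulrn ?powR_ge0// -powRrM -[X in (X^-1 `^ _)%R]powR_mulrn//.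
by rewrite -powRN -powRrM !mulNr mulrC.
Qed.

(** The weak bound makes the term of index j at most a constant times
    lam^j 2^(- beta j). For lam = 2^(beta/2) this is a geometric sequence of ratio
    2^(- beta/2). *)
Lemma multiscale_weak n :
  multiscale_oscillation Omega mu theta D p lam u n <=
    (multiscale_const * scale D n `^ beta)%:E * N `^ p.
Proof.
have w0 := weak_const_ge0.
have rho01 := pow2_ratio (divr_gt0 beta0 (ltr0n R 2)).
have Np0 : 0 <= N `^ p by exact: poweR_ge0.
pose M := (weak_const `^ p * 2 `^ (al * p) * scale D n `^ beta)%:E * N `^ p.
have M0 : 0 <= M by rewrite mule_ge0// lee_fin !mulr_ge0 ?powR_ge0.
apply: (@le_trans _ _ (\sum_(0 <= j <oo) ((2 `^ (- (beta / 2))) ^+ j)%:E * M)).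
  apply: lee_nneseries => [j _ _|j _].
    by rewrite mule_ge0 ?scaled_oscillation_ge0// lee_fin exprn_ge0// powR_ge0.
  apply: (@le_trans _ _ ((lam ^+ j)%:E * (((scale D (n + j) `^ theta)^-1)%:E *
     ((weak_const `^ p * tau (n + j) `^ (al * p))%:E * N `^ p)))).
    rewrite lee_wpmul2l ?lee_fin ?exprn_ge0 ?powR_ge0//.
    by rewrite lee_wpmul2l ?lee_fin ?invr_ge0 ?powR_ge0// oscillation_weak.
  rewrite /M !muleA -!EFinM lee_wpmul2r// lee_fin le_eqVlt; apply/orP; left.
  apply/eqP.
  have e1 : (tau (n + j) `^ (al * p) = 2 `^ (al * p) *
     (scale D (n + j) `^ theta * scale D (n + j) `^ beta))%R.
    rewrite powRM ?(ltW (sc0 _))// -powRD; last by rewrite (gt_eqF (sc0 _)) implybT.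
    by rewrite addrC subrK.
  have e2 : (scale D (n + j) `^ beta = scale D n `^ beta *
      (2 `^ (- (beta / 2)) ^+ j * 2 `^ (- (beta / 2)) ^+ j))%R.
    rewrite scaleD_powR -exprMn -powRD; last by rewrite pnatr_eq0 implybT.
    by congr (_ * _ `^ _ ^+ _)%R; field.
  have e3 : (lam ^+ j * (2 `^ (- (beta / 2)) ^+ j) = 1)%R.
    rewrite -exprMn powRN mulfV ?expr1n// gt_eqF// powR_gt0//.
  rewrite e1 e2; set a := (lam ^+ j)%R in e3 *; set b := (_ ^+ j)%R in e3 *.
  have sn : (scale D (n + j) `^ theta != 0)%R by rewrite gt_eqF// powR_gt0.
  transitivity ((a * b) * (b * (weak_const `^ p * 2 `^ (al * p) *
    scale D n `^ beta)))%R; last by rewrite e3 mul1r.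
  by field.
apply: (@le_trans _ _ (M * \sum_(0 <= j <oo) ((2 `^ (- (beta / 2))) ^+ j)%:E)).
  have rj0 j : 0 <= ((2 `^ (- (beta / 2))) ^+ j)%:E :> \bar R.
    by rewrite lee_fin exprn_ge0// powR_ge0.
  move: M0; case: M => [r| |]// M0.
    rewrite -nneseriesZl; last by [].
    apply: lee_nneseries => [j _ _|j _]; first by rewrite mule_ge0.
    by rewrite muleC.
  rewrite nneseries_geometric// gt0_mulye ?leey// lte_fin invr_gt0 subr_gt0.
  by case/andP: rho01.
rewrite nneseries_geometric// /M muleAC -EFinM lee_wpmul2r// lee_fin.
rewrite /multiscale_const le_eqVlt; apply/orP; left; apply/eqP; field.
by rewrite subr_eq0 eq_sym lt_eqF//; case/andP: rho01.
Qed.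

End weak_estimates.

(** * Besov seminorm of the trace *)

Section boundary_besov.
Context {R : realType} {X : completeMetricType R}.
Local Open Scope ereal_scope.
Variables (Omega : set X) (mu nu : {measure set (borel X) -> \bar R}).
Variables (Cmu Cth p al theta D : R) (q : \bar R).
Hypotheses (oO : open Omega) (dO : dense Omega).
Hypotheses (mu0 : mu (~` Omega) = 0) (nu0 : nu Omega = 0).
Hypotheses (Cmu1 : (1 <= Cmu)%R) (dbl : doubling Omega mu Cmu).
Hypotheses (Cth1 : (1 <= Cth)%R) (theta0 : (0 < theta)%R).
Hypothesis (cod : codim_regular Omega mu nu theta Cth).
Hypotheses (D0 : (0 < D)%R) (diamD : diam (~` Omega) = D%:E).
Hypotheses (p1 : (1 <= p)%R) (al0 : (0 < al)%R) (q1 : 1 <= q).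
Hypothesis (al'0 : (0 < al - theta / p)%R).
Variable u : borel X -> R.
Hypothesis mu_ : measurable_fun (Omega : set (borel X)) u.
Hypothesis iu : forall (z : X) (r : R), (0 < r)%R ->
  mu.-integrable (ball z r `&` Omega) (EFin \o u).

Local Notation al' := (al - theta / p)%R.
Local Notation beta := (al * p - theta)%R.
Local Notation lam := (2 `^ (beta / 2))%R.
Local Notation T := (trace Omega mu D u).
Local Notation E := (multiscale_oscillation Omega mu theta D p lam u).
Local Notation oscb := (oscillation (~` Omega) nu p T).
Local Notation N := (besov_seminorm Omega mu al p q u).
Local Notation Kosc := (trace_osc_const Cmu Cth theta p lam).

Let p0 : (0 < p)%R. Proof. exact: lt_le_trans p1. Qed.
Let sc0 k : (0 < scale D k)%R. Proof. exact: scale_gt0. Qed.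

Let betaE : beta = (al' * p)%R.
Proof. by rewrite mulrBl divfK// gt_eqF. Qed.

Let beta0 : (0 < beta)%R. Proof. by rewrite betaE mulr_gt0. Qed.
Let lam1 : (1 < lam)%R.
Proof. by apply: pow2_gt1; rewrite divr_gt0. Qed.

Lemma trace_osc_const_ge0 : (0 <= Kosc)%R.
Proof.
have b0 := boundary_const_ge0 theta Cmu1 Cth1.
have t0 := trace_const_ge0 theta Cmu1 Cth1.
have s0 : (0 <= step_const Cmu p)%R by exact: sqr_ge0.
have d0 : (0 <= dist_const Cmu p lam)%R.
  by rewrite mulr_ge0// ltW// geometric_const_gt0.
apply: mulr_ge0; first by apply: mulr_ge0 => //; exact: sqr_ge0.
apply: addr_ge0; apply: mulr_ge0 => //; try exact: mulr_ge0.
exact: addr_ge0.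
Qed.

Let E0 n : 0 <= E n.
Proof.
by apply: nneseries_ge0 => j _ _; rewrite mule_ge0 ?scaled_oscillation_ge0.
Qed.

Let osc_le n t : (scale D n.+2 < t <= scale D n.+1)%R -> oscb t <= Kosc%:E * E n.
Proof.
exact: (boundary_oscillation_le oO dO mu0 nu0 Cmu1 dbl Cth1 theta0 cod D0 diamD
  p1 lam1 mu_ iu).
Qed.

Let osc_far t : (2 * D < t)%R -> oscb t <= Kosc%:E * E 0%N.
Proof.
move=> tD; rewrite (boundary_oscillation_far mu nu p D0 diamD u tD).
by apply: osc_le; rewrite lexx andbT -(scaleS D 1) ltr_pMl// ltr1n.
Qed.

Let oscb0 t : 0 <= oscb t. Proof. exact: oscillation_ge0. Qed.

Definition boundary_weak_const : R :=
  (Kosc * multiscale_const Cmu p al theta q * 4 `^ beta)%R.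

Lemma boundary_weak_const_ge0 : (0 <= boundary_weak_const)%R.
Proof.
apply: mulr_ge0; last exact: powR_ge0.
apply: mulr_ge0; first exact: trace_osc_const_ge0.
exact: multiscale_const_ge0.
Qed.

Lemma boundary_oscillation_weak t : (0 < t)%R ->
  oscb t <= (boundary_weak_const * t `^ beta)%:E * N `^ p.
Proof.
move=> t0.
have main n : (scale D n <= 4 * t)%R -> oscb t <= Kosc%:E * E n ->
    oscb t <= (boundary_weak_const * t `^ beta)%:E * N `^ p.
  move=> nt /le_trans; apply.
  have Ew := multiscale_weak oO dO mu0 Cmu1 dbl p1 D0 al0 q1 beta0 mu_ n.
  apply: (@le_trans _ _ (Kosc%:E * ((multiscale_const Cmu p al theta q *
      scale D n `^ beta)%:E * N `^ p))).
    by rewrite lee_wpmul2l// lee_fin trace_osc_const_ge0.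
  rewrite muleA -EFinM lee_wpmul2r ?poweR_ge0// lee_fin.
  rewrite /boundary_weak_const.
  move: (Kosc) (multiscale_const Cmu p al theta q) trace_osc_const_ge0
    (multiscale_const_ge0 Cmu q beta0) => a m a0 m0.
  rewrite -!mulrA ler_wpM2l// ler_wpM2l// -powRM// ?(ltW t0)//.
  apply: ge0_ler_powR => //; rewrite ?nnegrE ?(ltW beta0) ?(ltW (sc0 n))//.
  by rewrite mulr_ge0// ltW.
have [tD|Dt] := leP t (2 * D)%R.
  have [n nt] := ex_scale_small t0 tD.
  apply: (main n); last exact: osc_le.
  by case/andP: nt => nt _; rewrite -(scaleS D n) -(scaleS D n.+1); lra.
apply: (main 0%N); last exact: osc_far.
by have := scale_le 0 D0; move: Dt; lra.
Qed.

Lemma boundary_besov_infty :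
  besov_seminorm (~` Omega) nu al' p +oo T <=
    (boundary_weak_const `^ p^-1)%:E * N.
Proof.
have N0 : 0 <= N by exact: besov_seminorm_ge0.
apply: ge_ereal_sup => _ [t /= t0 <-].
rewrite lee_pdivrMl ?powR_gt0//.
have := le_poweR (_ : 0 <= p^-1)%R (oscb0 t) (boundary_oscillation_weak t0).
rewrite invr_ge0 (ltW p0) => /(_ isT) /le_trans; apply.
rewrite poweRM ?poweR_ge0//; last first.
  by rewrite lee_fin mulr_ge0 ?powR_ge0 ?boundary_weak_const_ge0.
rewrite -poweRrM mulfV ?gt_eqF// poweRe1// poweR_EFin muleA -EFinM.
rewrite lee_wpmul2r// lee_fin powRM ?powR_ge0 ?boundary_weak_const_ge0//.
by rewrite -powRrM betaE mulfK ?gt_eqF// mulrC.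
Qed.

Section finite_exponent.
Variable s : R.
Hypothesis s1 : (1 <= s)%R.

Let s0 : (0 < s)%R. Proof. exact: lt_le_trans s1. Qed.
Local Notation gam := (al' * s)%R.
Local Notation lam' := (2 `^ (gam / 4))%R.
Local Notation rho := (2 `^ (- (gam / 4)))%R.
Local Notation b := (dyadic_term Omega mu p al D u s).

Let gam0 : (0 < gam)%R. Proof. exact: mulr_gt0. Qed.
Let sp0 : (0 < s / p)%R. Proof. exact: divr_gt0. Qed.
Let b0 k : 0 <= b k. Proof. exact: dyadic_term_ge0. Qed.

Let e n := (scale D n `^ (- gam))%:E * E n `^ (s / p).
Let e0 n : 0 <= e n.
Proof. by rewrite mule_ge0 ?poweR_ge0// lee_fin powR_ge0. Qed.

Let Kg : R := (geometric_const (s / p) lam' * 2 `^ (al * s))%R.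
Let Kg0 : (0 <= Kg)%R.
Proof.
rewrite mulr_ge0 ?powR_ge0// ltW// geometric_const_gt0//.
Qed.

Let rho01 : (0 <= rho < 1)%R.
Proof. by apply: pow2_ratio; rewrite divr_gt0. Qed.

(** The powers of 2 gained and lost over j scales. Raised to the power s / p,
    the weight lam^j of E_n grows like 2^(gam j / 2), since beta s / p = gam; the
    weight lam'^j of the power sum grows like 2^(gam j / 4); and the passage from
    scale n + j to scale n costs 2^(- gam j). Thus 2^(- gam j / 4) remains. *)
Let coefficient n j : (scale D n `^ (- gam) * (lam' ^+ j *
   (((lam ^+ j) * (scale D (n + j) `^ theta)^-1) `^ (s / p) *
   (2 * scale D (n + j)) `^ (al * s))) = 2 `^ (al * s) * rho ^+ j)%R.
Proof.
have y0 := sc0 (n + j); have x0 := sc0 n.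
rewrite powRM ?invr_ge0 ?exprn_ge0 ?powR_ge0//.
rewrite [((2 * _) `^ _)%R]powRM ?(ltW y0)//.
rewrite -[((scale D (n + j) `^ theta)^-1)%R]powRN -powRrM.
rewrite -[(lam ^+ j)%R]powR_mulrn ?powR_ge0// -2!powRrM.
rewrite -[(lam' ^+ j)%R]powR_mulrn ?powR_ge0// -powRrM.
rewrite -[(rho ^+ j)%R]powR_mulrn ?powR_ge0// -powRrM.
set Y := scale D (n + j).
have eY : (Y `^ (- theta * (s / p)) * Y `^ (al * s) = Y `^ gam)%R.
  rewrite -powRD; last by rewrite (gt_eqF y0) implybT.
  by congr (_ `^ _)%R; field; rewrite gt_eqF.
have -> : (scale D n `^ (- gam) * (2 `^ (gam / 4 * j%:R) *
   (2 `^ (beta / 2 * (j%:R * (s / p))) * Y `^ (- theta * (s / p)) *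
     (2 `^ (al * s) * Y `^ (al * s)))) =
   2 `^ (al * s) * ((2 `^ (gam / 4 * j%:R) * 2 `^ (beta / 2 * (j%:R * (s / p)))) *
    (scale D n `^ (- gam) * (Y `^ (- theta * (s / p)) * Y `^ (al * s)))))%R by ring.
have en : (scale D n `^ (- gam) * scale D n `^ gam = 1)%R.
  rewrite -powRD; last by rewrite (gt_eqF x0) implybT.
  by rewrite addNr powRr0.
rewrite eY /Y scaleD_powR// [(scale D n `^ _ * (_ * _))%R]mulrA en mul1r.
rewrite -[(_ ^+ j)%R]powR_mulrn ?powR_ge0// -powRrM.
rewrite -!powRD; try by rewrite pnatr_eq0 implybT.
congr (_ `^ _)%R; field; rewrite gt_eqF//.
Qed.

(** Up to a constant, [e n] bounds the part at scale n of the boundary seminorm.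
    It is at most a convolution of the dyadic terms of [u] with a geometric
    sequence. *)
Let e_le n : e n <= Kg%:E * \sum_(0 <= j <oo) (rho ^+ j)%:E * b (n + j)%N.
Proof.
have gl : (1 < lam')%R by apply: pow2_gt1; rewrite divr_gt0.
have lso0 j : 0 <= (lam ^+ j)%:E * scaled_oscillation Omega mu theta D p u (n + j).
  by rewrite mule_ge0 ?scaled_oscillation_ge0// lee_fin exprn_ge0// powR_ge0.
have ps := poweR_nneseries_le sp0 gl lso0.
apply: (@le_trans _ _ ((scale D n `^ (- gam))%:E * ((geometric_const (s / p) lam')%:E *
  \sum_(0 <= j <oo) (lam' ^+ j)%:E * ((lam ^+ j)%:E *
     scaled_oscillation Omega mu theta D p u (n + j)) `^ (s / p)))).
  by rewrite lee_wpmul2l// lee_fin powR_ge0.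
have gc0 : (0 <= geometric_const (s / p) lam')%R by rewrite ltW// geometric_const_gt0.
rewrite muleCA /Kg EFinM -[leRHS]muleA lee_wpmul2l ?lee_fin//.
have lp0 j : 0 <= (lam' ^+ j)%:E :> \bar R by rewrite lee_fin exprn_ge0// powR_ge0.
rewrite -nneseriesZl; last by move=> j _; rewrite mule_ge0 ?poweR_ge0.
rewrite -nneseriesZl; last first.
  by move=> j _; rewrite mule_ge0// lee_fin exprn_ge0// powR_ge0.
apply: lee_nneseries => [j _ _|j _].
  by rewrite mule_ge0 ?lee_fin ?powR_ge0// mule_ge0 ?poweR_ge0.
rewrite [leRHS]muleA -EFinM -(coefficient n) /dyadic_term /scaled_oscillation.
rewrite [(lam ^+ j)%:E * (_ * _)]muleA -EFinM.
have o0 : 0 <= oscillation Omega mu p u (2 * scale D (n + j)) by exact: oscillation_ge0.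
rewrite poweRM//; last by rewrite lee_fin mulr_ge0 ?invr_ge0 ?exprn_ge0 ?powR_ge0.
rewrite poweR_EFin !muleA -!EFinM lee_wpmul2r ?poweR_ge0// lee_fin.
have y0 : (0 < 2 * scale D (n + j))%R by rewrite mulr_gt0.
rewrite -!mulrA -powRD; last by rewrite (gt_eqF y0) implybT.
by rewrite subrr powRr0 mulr1.
Qed.

Let I := \int[lebesgue_measure]_(t in `]0%R, +oo[)
  (oscillation Omega mu p u t `^ (s / p) / (t `^ (al * s + 1))%:E).

Let I0 : 0 <= I.
Proof.
apply: integral_ge0 => t; rewrite /= in_itv/= andbT => t0.
by rewrite mule_ge0 ?poweR_ge0 ?inve_ge0// lee_fin powR_ge0.
Qed.

Definition trace_sum_const : R :=
  (geometric_const (s / p) lam' * 2 `^ (al * s) / (1 - rho) *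
   dyadic_const Cmu p al s)%R.

Let c1_ge0 : (0 <= trace_sum_const)%R.
Proof.
apply: mulr_ge0; last exact/ltW/dyadic_const_gt0.
apply: mulr_ge0; first exact: Kg0.
by rewrite invr_ge0 subr_ge0; case/andP: rho01 => _ /ltW.
Qed.

Let e_sum : \sum_(0 <= n <oo) e n <= trace_sum_const%:E * I.
Proof.
have rj0 j : 0 <= (rho ^+ j)%:E :> \bar R by rewrite lee_fin exprn_ge0// powR_ge0.
have ss0 n : 0 <= \sum_(0 <= j <oo) (rho ^+ j)%:E * b (n + j)%N.
  by apply: nneseries_ge0 => j _ _; rewrite mule_ge0.
apply: (@le_trans _ _ (\sum_(0 <= n <oo)
   Kg%:E * \sum_(0 <= j <oo) (rho ^+ j)%:E * b (n + j)%N)).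
  by apply: lee_nneseries => [n _ _|n _]; [exact: e0|exact: e_le].
rewrite nneseriesZl//.
apply: (@le_trans _ _ (Kg%:E * (((1 - rho)^-1)%:E * \sum_(0 <= n <oo) b n))).
  by rewrite lee_wpmul2l ?lee_fin// nneseries_geometric_convolution.
rewrite muleA -EFinM /trace_sum_const [in leRHS]EFinM -[leRHS]muleA.
rewrite lee_wpmul2l//.
  rewrite lee_fin mulr_ge0// invr_ge0 subr_ge0.
  by case/andP: rho01 => _ /ltW.
exact: (dyadic_sum_le oO dO mu0 Cmu1 dbl p1 D0 al0 mu_ s1).
Qed.

Definition trace_integral_const : R :=
  (Kosc `^ (s / p) * (4 `^ gam + 2 `^ gam / (1 - 2 `^ (- gam))))%R.

Let c2_ge0 : (0 <= trace_integral_const)%R.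
Proof.
rewrite mulr_ge0 ?powR_ge0// addr_ge0 ?powR_ge0// divr_ge0 ?powR_ge0//.
by rewrite subr_ge0 ltW//; case/andP: (pow2_ratio gam0).
Qed.

Let f t := oscb t `^ (s / p) / (t `^ (gam + 1))%:E.

Let g n (x : R) : \bar R := ((x `^ (gam + 1))^-1)%:E * ((Kosc `^ (s / p))%:E * E n `^ (s / p)).

Let g0 n x : 0 <= g n x.
Proof.
apply: mule_ge0; first by rewrite lee_fin invr_ge0 powR_ge0.
by rewrite mule_ge0 ?poweR_ge0// lee_fin powR_ge0.
Qed.

Let f_le n (x t : R) : (0 < x)%R -> (x < t)%R -> oscb t <= Kosc%:E * E n -> f t <= g n x.
Proof.
move=> x0 xt ot; have t0 : (0 < t)%R by exact: lt_trans xt.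
rewrite /f inver gt_eqF ?powR_gt0// muleC.
have h : oscb t `^ (s / p) <= (Kosc `^ (s / p))%:E * E n `^ (s / p).
  rewrite -poweR_EFin -poweRM//; last by rewrite lee_fin trace_osc_const_ge0.
  by apply: le_poweR => //; exact: ltW.
apply: lee_pmul => //; rewrite ?poweR_ge0// ?lee_fin ?invr_ge0 ?powR_ge0//.
rewrite lef_pV2 ?posrE ?powR_gt0//; apply: ge0_ler_powR => //.
- by rewrite addr_ge0// ltW.
- by rewrite nnegrE ltW.
- by rewrite nnegrE ltW.
- exact: ltW.
Qed.

Let gE n x : (0 < x)%R ->
  g n x * x%:E = (Kosc `^ (s / p))%:E * ((x `^ (- gam))%:E * E n `^ (s / p)).
Proof.
move=> x0; rewrite /g muleAC muleCA -EFinM; congr (_ * (_%:E * _)).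
rewrite powRD; last by rewrite (gt_eqF x0) implybT.
by rewrite powRN powRr1 ?(ltW x0)//; field; rewrite !gt_eqF ?powR_gt0.
Qed.

(** Radii up to 2 D are covered by dyadic intervals where E_n bounds the
    oscillation of the trace. Beyond 2 D the bound E_0 remains valid, and
    t^(- gam - 1) is integrable at infinity, since gam > 0. *)
Lemma boundary_integral_le :
  \int[lebesgue_measure]_(t in `]0%R, +oo[) f t <=
  (trace_integral_const * trace_sum_const)%:E * I.
Proof.
pose I1 n : set R := `](scale D n.+2)%R, (scale D n.+1)%R]%classic.
pose big k : R := (2 * D * 2 ^+ k)%R.
have big0 k : (0 < big k)%R by rewrite !mulr_gt0 ?exprn_gt0.
pose I2 k : set R := `](big k)%R, (big k.+1)%R]%classic.
have I1E n : lebesgue_measure (I1 n) = (scale D n.+2)%:E.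
  have := scaleS D n.+1; have := sc0 n.+2 => h1 h2.
  by rewrite lebesgue_measure_oc; [congr (_%:E); lra|lra].
have bigS k : (big k.+1 = 2 * big k)%R by rewrite /big exprS; ring.
have I2E k : lebesgue_measure (I2 k) = (big k)%:E.
  rewrite lebesgue_measure_oc bigS; first by congr (_%:E); ring.
  by rewrite ler_peMl ?(ltW (big0 k))// ler1n.
rewrite EFinM -muleA.
apply: (@le_trans _ _ (trace_integral_const%:E * \sum_(0 <= n <oo) e n)); last first.
  by rewrite lee_wpmul2l ?lee_fin.
apply: (@le_trans _ _ (\sum_(0 <= n <oo) g n (scale D n.+2) * lebesgue_measure (I1 n) +
   \sum_(0 <= k <oo) g 0%N (big k) * lebesgue_measure (I2 k))).
  apply: integral_le_steps => //.
  - move=> t; rewrite /= in_itv/= andbT => t0.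
    by rewrite mule_ge0 ?poweR_ge0 ?inve_ge0// lee_fin powR_ge0.
  - by move=> n; exact: measurable_itv.
  - by move=> n; exact: measurable_itv.
  move=> t; rewrite /= in_itv/= andbT => t0.
  have [tD|Dt] := leP t (2 * D)%R.
    have [n nt] := ex_scale_small t0 tD; left; exists n; split.
      by rewrite /I1 /= in_itv.
    by apply: f_le => //; [case/andP: nt|exact: osc_le].
  have [k kt] := ex_scale_large D0 Dt; right; exists k; split.
    by rewrite /I2 /= in_itv.
  by apply: f_le => //; [case/andP: kt|exact: osc_far].
rewrite /trace_integral_const mulrDr EFinD ge0_muleDl; last 2 first.
- by rewrite lee_fin mulr_ge0 ?powR_ge0.
- rewrite lee_fin mulr_ge0 ?powR_ge0// divr_ge0 ?powR_ge0//.
  by rewrite subr_ge0 ltW//; case/andP: (pow2_ratio gam0).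
apply: leeD.
  rewrite -nneseriesZl; last by move=> n _; exact: e0.
  apply: lee_nneseries => [n _ _|n _]; first by rewrite mule_ge0.
  rewrite I1E gE// EFinM -muleA lee_wpmul2l ?lee_fin ?powR_ge0//.
  rewrite /e muleA -EFinM lee_wpmul2r ?poweR_ge0// lee_fin.
  rewrite le_eqVlt; apply/orP; left; apply/eqP.
  rewrite -(scaleS D n) -(scaleS D n.+1) mulrA powRM ?(ltW (sc0 _))//.
  rewrite mulrA [(2 * 2)%R](_ : _ = 4)%R; last by ring.
  rewrite [(4 `^ (- _))%R]powRN.
  by rewrite mulfV ?mul1r// gt_eqF ?powR_gt0.
apply: (@le_trans _ _ (((Kosc `^ (s / p)) * (2 `^ gam / (1 - 2 `^ (- gam))))%:E * e 0%N)); last first.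
  rewrite lee_wpmul2l//; last exact: nneseries_term.
  rewrite lee_fin mulr_ge0 ?powR_ge0// divr_ge0 ?powR_ge0//.
  by rewrite subr_ge0 ltW//; case/andP: (pow2_ratio gam0).
have bigE k : (big k `^ (- gam) =
    2 `^ gam * scale D 0 `^ (- gam) * (2 `^ (- gam)) ^+ k)%R.
  rewrite [big k](_ : _ = 2^-1 * scale D 0 * 2 ^+ k)%R; last first.
    by rewrite /big /scale expr0; field.
  have h : (0 <= 2^-1 * scale D 0)%R by apply: mulr_ge0 => //; exact: ltW.
  rewrite powRM ?exprn_ge0//.
  rewrite powRM ?(ltW (sc0 _))//; congr (_ * _ * _)%R.
    rewrite -[(2^-1)%R]powR_inv1// -powRrM.
    by congr (_ `^ _)%R; ring.
  rewrite -(powR_mulrn _ (ler0n R 2)) -(powR_mulrn _ (powR_ge0 2 _)).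
  by rewrite -!powRrM mulrC.
have gam01 := pow2_ratio gam0.
have rj0 j : 0 <= ((2 `^ (- gam)) ^+ j)%:E :> \bar R.
  by rewrite lee_fin exprn_ge0// powR_ge0.
apply: (@le_trans _ _ (\sum_(0 <= k <oo) ((2 `^ (- gam)) ^+ k)%:E *
    ((Kosc `^ (s / p) * 2 `^ gam)%:E * e 0%N))).
  apply: lee_nneseries => [k _ _|k _]; first by rewrite mule_ge0.
  rewrite I2E gE// bigE /e !muleA -!EFinM lee_wpmul2r ?poweR_ge0// lee_fin.
  by rewrite le_eqVlt; apply/orP; left; apply/eqP; ring.
(* if [e 0] is infinite, so is the right side, unless its constant vanishes *)
have := e0 0%N; case: (e 0%N) => [r| |]// r0.
  have m0 : 0 <= (Kosc `^ (s / p) * 2 `^ gam)%:E * r%:E.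
    by rewrite mule_ge0// lee_fin mulr_ge0 ?powR_ge0.
  under eq_eseriesr do rewrite muleC.
  rewrite -EFinM nneseriesZl//.
  rewrite nneseries_geometric// -!EFinM lee_fin.
  by rewrite le_eqVlt; apply/orP; left; apply/eqP; ring.
have [K60|K6n] := eqVneq (Kosc `^ (s / p))%R 0%R.
  rewrite K60 !mul0r mul0e eseries0// => k _ _.
  by rewrite mule0.
have c0 : 0 < (Kosc `^ (s / p) * (2 `^ gam / (1 - 2 `^ (- gam))))%:E.
  rewrite lte_fin mulr_gt0//; first by rewrite lt_neqAle powR_ge0 eq_sym K6n.
  by rewrite divr_gt0 ?powR_gt0// subr_gt0; case/andP: gam01.
by rewrite [leRHS]gt0_muley// leey.
Qed.

Lemma boundary_besov_finite :
  (\int[lebesgue_measure]_(t in `]0%R, +oo[)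
     (oscb t `^ (s / p) / (t `^ (al' * s + 1))%:E)) `^ s^-1 <=
  ((trace_integral_const * trace_sum_const) `^ s^-1)%:E * I `^ s^-1.
Proof.
have c0 : (0 <= trace_integral_const * trace_sum_const)%R by exact: mulr_ge0.
rewrite -poweR_EFin -poweRM ?lee_fin//; apply: le_poweR.
- by rewrite invr_ge0 ltW.
- apply: integral_ge0 => t; rewrite /= in_itv/= andbT => t0.
  by rewrite mule_ge0 ?poweR_ge0 ?inve_ge0// lee_fin powR_ge0.
- exact: boundary_integral_le.
Qed.

End finite_exponent.
End boundary_besov.

(** * Integrability of the trace *)

Section Lp.
Context {R : realType} {X : completeMetricType R}.
Local Open Scope ereal_scope.
Variables (S : set X) (m : {measure set (borel X) -> \bar R}) (p : R).
Hypotheses (mS : measurable (S : set (borel X))) (p1 : (1 <= p)%R).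
Variable f : borel X -> R.

Let p0 : (0 < p)%R. Proof. exact: lt_le_trans p1. Qed.

Lemma Lp_normE :
  Lp_norm S m p f = (\int[m]_(x in S) (`|f x| `^ p)%:E) `^ p^-1.
Proof.
rewrite /Lp_norm unlock; congr (_ `^ _).
rewrite [RHS]integral_mkcond; apply: eq_integral => x _.
have [xS|xS] := pselect ((S : set (borel X)) x).
  by rewrite [RHS]patch_in//= patchE mem_set//.
rewrite [RHS]patch_out//= patchE memNset//=.
by rewrite normr0 powR0// gt_eqF.
Qed.

Lemma poweR_Lp_norm :
  Lp_norm S m p f `^ p = \int[m]_(x in S) (`|f x| `^ p)%:E.
Proof.
rewrite Lp_normE -poweRrM mulVf ?gt_eqF// poweRe1//.
by apply: integral_ge0 => x _; rewrite lee_fin powR_ge0.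
Qed.

Lemma Lp_norm_ge0 : 0 <= Lp_norm S m p f.
Proof. by rewrite Lp_normE poweR_ge0. Qed.

(** On a set of finite measure, |f| <= 1 + |f|^p suffices. *)
Lemma Lp_integrable (B : set (borel X)) : measurable B -> B `<=` S ->
  m B < +oo -> Lp S m p f -> m.-integrable B (EFin \o f).
Proof.
move=> mB BS Boo [mf fp].
have mfB : measurable_fun B f by exact: (measurable_funS mS BS mf).
apply/integrableP; split; first exact/measurable_EFinP.
apply: (@le_lt_trans _ _ (\int[m]_(x in B) (1 + (`|f x| `^ p)%:E))).
  apply: le_lower_integral => // x _; first by rewrite adde_ge0// lee_fin powR_ge0.
  rewrite /= -EFinD lee_fin; have [f1|f1] := leP `|f x|%R 1%R.
    by rewrite (le_trans f1)// lerDl powR_ge0.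
  rewrite -[leLHS]powRr1//.
  apply: (@le_trans _ _ (`|f x| `^ p)%R); last by rewrite lerDr.
  by apply: ler_powR => //; exact: ltW.
have mfp : measurable_fun B (fun x => (`|f x| `^ p)%:E).
  apply/measurable_EFinP; apply: (measurableT_comp (measurable_powR p)).
  exact: (measurableT_comp (@normr_measurable R setT)).
rewrite ge0_integralD//.
rewrite [X in X + _](_ : _ = m B); last by rewrite -[RHS]mul1e -integral_cst.
apply: lte_add_pinfty => //.
apply: (@le_lt_trans _ _ (\int[m]_(x in S) (`|f x| `^ p)%:E)).
  by apply: le_lower_integral => // x _; rewrite lee_fin powR_ge0.
by rewrite -poweR_Lp_norm; exact: poweR_lty.
Qed.

End Lp.

Section trace_Lp.
Context {R : realType} {X : completeMetricType R}.
Local Open Scope ereal_scope.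
Variables (Omega : set X) (mu nu : {measure set (borel X) -> \bar R}).
Variables (Cmu Cth p al theta D : R) (q : \bar R).
Hypotheses (oO : open Omega) (dO : dense Omega).
Hypotheses (mu0 : mu (~` Omega) = 0) (nu0 : nu Omega = 0).
Hypotheses (Cmu1 : (1 <= Cmu)%R) (dbl : doubling Omega mu Cmu).
Hypotheses (Cth1 : (1 <= Cth)%R) (theta0 : (0 < theta)%R).
Hypothesis (cod : codim_regular Omega mu nu theta Cth).
Hypotheses (D0 : (0 < D)%R) (diamD : diam (~` Omega) = D%:E).
Hypotheses (p1 : (1 <= p)%R) (al0 : (0 < al)%R) (q1 : 1 <= q).
Hypothesis (beta0 : (0 < al * p - theta)%R).

Local Notation beta := (al * p - theta)%R.
Local Notation lam := (2 `^ (beta / 2))%R.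
Local Notation T := (trace Omega mu D).
Local Notation N u := (besov_seminorm Omega mu al p q u).
Local Notation Bo z r := (ball z r `&` Omega).
Local Notation sc := (scale D).
Local Notation av k u z := (mean mu (Bo z (sc k)) u).
Local Notation W k u z := (mean_oscillation Omega mu p u (sc k) z).

Let p0 : (0 < p)%R. Proof. exact: lt_le_trans p1. Qed.
Let sc0 k : (0 < sc k)%R. Proof. exact: scale_gt0. Qed.
Let lam1 : (1 < lam)%R. Proof. by apply: pow2_gt1; rewrite divr_gt0. Qed.

Let mO : measurable (Omega : set (borel X)).
Proof. exact: measurable_open_borel. Qed.

Let mOc : measurable (~` Omega : set (borel X)).
Proof. exact: measurableC. Qed.

Let mBo (z : X) (r : R) : measurable (Bo z r : set (borel X)).
Proof. by apply: measurableI => //; exact: measurable_ball_borel. Qed.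

Let V_gt0 (z : X) (r : R) : (0 < r)%R -> 0 < mu (Bo z r).
Proof. exact: doubling_ball_gt0 oO dO dbl z r. Qed.

Let V_lty (z : X) (r : R) : (0 < r)%R -> mu (Bo z r) < +oo.
Proof. exact: doubling_ball_lty oO dO dbl z r. Qed.

Lemma Lp_ball_integrable (u : borel X -> R) : Lp Omega mu p u ->
  forall (z : X) (r : R), (0 < r)%R -> mu.-integrable (Bo z r) (EFin \o u).
Proof.
move=> Lu z r r0; apply: (Lp_integrable mO p1 (mBo z r)) => //.
exact: V_lty.
Qed.

Definition trace_Lp_const1 : R :=
  (2 `^ p * (dist_const Cmu p lam * trace_const Cmu Cth theta) *
   (multiscale_const Cmu p al theta q * scale D 0 `^ beta))%R.

Definition trace_Lp_const2 : R :=
  (2 `^ p * (2 `^ p * (trace_const Cmu Cth theta / scale D 0 `^ theta)))%R.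

Let dt0 : (0 <= dist_const Cmu p lam * trace_const Cmu Cth theta)%R.
Proof.
apply: mulr_ge0; last exact: trace_const_ge0.
apply: mulr_ge0; last exact: sqr_ge0.
exact/ltW/geometric_const_gt0.
Qed.

Let tt0 : (0 <= trace_const Cmu Cth theta / scale D 0 `^ theta)%R.
Proof. by apply: divr_ge0; [exact: trace_const_ge0|exact: powR_ge0]. Qed.

Lemma trace_Lp_const1_ge0 : (0 <= trace_Lp_const1)%R.
Proof.
apply: mulr_ge0; first by apply: mulr_ge0 => //; exact: powR_ge0.
by apply: mulr_ge0; [exact: multiscale_const_ge0|exact: powR_ge0].
Qed.

Lemma trace_Lp_const2_ge0 : (0 <= trace_Lp_const2)%R.
Proof. by apply: mulr_ge0; [exact: powR_ge0|apply: mulr_ge0; [exact: powR_ge0|]]. Qed.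

Definition trace_Lp_const : R :=
  ((trace_Lp_const1 + trace_Lp_const2) `^ p^-1)%R.

Section function.
Variable u : borel X -> R.
Hypothesis Lu : Lp Omega mu p u.

Let mu_ : measurable_fun (Omega : set (borel X)) u. Proof. by case: Lu. Qed.
Let iu := Lp_ball_integrable Lu.

Let mT : measurable_fun setT (T u).
Proof. exact: (measurable_trace oO dO mu0 dbl D0 mu_). Qed.

Let mav k : measurable_fun setT (fun z : borel X => av k u (z : X)).
Proof. exact: (measurable_mean_scale oO dO mu0 dbl D0 mu_). Qed.

Let mpow (A : set (borel X)) (g : borel X -> R) : measurable_fun setT g ->
  measurable_fun A (fun z => (`|g z| `^ p)%:E).
Proof.
move=> mg; apply: (measurable_funS measurableT) => //.
apply/measurable_EFinP; apply: (measurableT_comp (measurable_powR p)).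
exact: (measurableT_comp (@normr_measurable R setT)).
Qed.

Lemma multiscale_lty : N u < +oo ->
  multiscale_oscillation Omega mu theta D p lam u 0%N < +oo.
Proof.
move=> Noo.
apply: (le_lt_trans (multiscale_weak oO dO mu0 Cmu1 dbl p1 D0 al0 q1 beta0 mu_ 0)).
apply: lte_mul_pinfty => //; last exact: poweR_lty.
by rewrite lee_fin; apply: mulr_ge0; [exact: multiscale_const_ge0|exact: powR_ge0].
Qed.

(** The mean at the largest scale r_0 = 4 D is close to the trace by
    [integral_trace_dist], and [integral_boundary_average] bounds its own p-th
    power in terms of that of [u]. *)
Lemma integral_trace_le :
  \int[nu]_(z in ~` Omega) (`|T u z| `^ p)%:E <=
  trace_Lp_const1%:E * N u `^ p +
  trace_Lp_const2%:E * Lp_norm Omega mu p u `^ p.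
Proof.
have p2 : (0 <= 2 `^ p :> R)%R by exact: powR_ge0.
have ge0p (x : R) : 0 <= (`|x| `^ p)%:E by rewrite lee_fin powR_ge0.
apply: (@le_trans _ _ (\int[nu]_(z in ~` Omega) ((2 `^ p)%:E *
    ((`|T u z - av 0%N u (z : X)| `^ p)%:E + (`|av 0%N u (z : X)| `^ p)%:E)))).
  apply: le_lower_integral => // z Oz; first by rewrite mule_ge0// adde_ge0.
  rewrite -EFinD -EFinM lee_fin.
  apply: le_trans (powRD_le2 p0 _ _) => //.
  apply: ge0_ler_powR; rewrite ?nnegrE ?(ltW p0)//.
  by rewrite -{1}(subrK (av 0%N u z) (T u z)) ler_normD.
have m1 : measurable_fun (~` Omega : set (borel X))
    (fun z : borel X => (`|T u z - av 0%N u (z : X)| `^ p)%:E).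
  by apply: mpow; exact: measurable_funB.
have m2 : measurable_fun (~` Omega : set (borel X))
    (fun z : borel X => (`|av 0%N u (z : X)| `^ p)%:E) by exact: mpow.
rewrite ge0_integralZl//; last 2 first.
- exact: emeasurable_funD.
- by move=> z _; rewrite adde_ge0.
rewrite ge0_integralD// ge0_muleDr; last 2 first.
- exact: integral_ge0.
- exact: integral_ge0.
apply: leeD.
  rewrite /trace_Lp_const1 -mulrA EFinM -muleA lee_wpmul2l//.
  apply: (le_trans (integral_trace_dist oO dO mu0 nu0 Cmu1 dbl Cth1 theta0 cod
    D0 diamD p1 lam1 mu_ iu 0%N)).
  rewrite [X in _ <= X * _](EFinM (dist_const Cmu p lam * trace_const Cmu Cth theta)%R).
  rewrite -[leRHS]muleA lee_wpmul2l//.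
  exact: (multiscale_weak oO dO mu0 Cmu1 dbl p1 D0 al0 q1 beta0 mu_ 0).
rewrite /trace_Lp_const2 [X in _ <= X * _]EFinM -[leRHS]muleA lee_wpmul2l//.
apply: (@le_trans _ _ (\int[nu]_(z in ~` Omega) ((2 `^ p)%:E *
    average mu (Bo z (sc 0)) (fun y => (`|u y| `^ p)%:E)))).
  apply: le_lower_integral => // z Oz.
    by rewrite mule_ge0// average_ge0.
  have := mean_dist 0%R p1 (mBo z (sc 0)) (V_gt0 z (sc0 0)) (V_lty z (sc0 0))
    (iu z (sc0 0)).
  rewrite subr0; move/le_trans; apply; apply: lee_wpmul2l.
    by rewrite lee_fin powR_ge0.
  by apply: le_average => y _ //; rewrite subr0.
have mup : measurable_fun (Omega : set (borel X)) (fun y => (`|u y| `^ p)%:E).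
  apply/measurable_EFinP; apply: (measurableT_comp (measurable_powR p)).
  exact: (measurableT_comp (@normr_measurable R setT)).
rewrite ge0_integralZl//; last 2 first.
- have [a da] := doubling_dense_seq oO dO mu0 dbl.
  apply: (@measurable_ball_average_fun R X a mu (Omega : set (borel X))) => //.
    exact: doubling_sigma_finite oO dO mu0 dbl.
  by move=> x _; rewrite V_gt0// V_lty.
- by move=> z _; exact: average_ge0.
rewrite [X in _ <= X * _]EFinM -[leRHS]muleA lee_wpmul2l// poweR_Lp_norm//.
apply: (integral_boundary_average oO dO mu0 nu0 Cmu1 dbl Cth1 theta0 cod
  D0 diamD) => //.
exact: scale_le.
Qed.

Lemma trace_Lp_norm_le :
  Lp_norm (~` Omega) nu p (T u) <=
    trace_Lp_const%:E * (Lp_norm Omega mu p u + N u).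
Proof.
have L0 : 0 <= Lp_norm Omega mu p u by exact: Lp_norm_ge0.
have N0 : 0 <= N u by exact: besov_seminorm_ge0.
have LN0 : 0 <= Lp_norm Omega mu p u + N u by exact: adde_ge0.
have c1 := trace_Lp_const1_ge0; have c2 := trace_Lp_const2_ge0.
rewrite Lp_normE//.
apply: (@le_trans _ _ (((trace_Lp_const1 + trace_Lp_const2)%:E *
    (Lp_norm Omega mu p u + N u) `^ p) `^ p^-1)).
  apply: le_poweR.
  - by rewrite invr_ge0 ltW.
  - by apply: integral_ge0 => z _; rewrite lee_fin powR_ge0.
  apply: (le_trans integral_trace_le).
  rewrite EFinD ge0_muleDl ?lee_fin//; apply: leeD; rewrite lee_wpmul2l ?lee_fin//;
    apply: le_poweR; rewrite ?(ltW p0)//.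
    by rewrite leeDr.
  by rewrite leeDl.
rewrite poweRM ?poweR_ge0 ?lee_fin ?addr_ge0// poweR_EFin -poweRrM.
by rewrite mulfV ?gt_eqF// poweRe1.
Qed.

(** The sum has a finite integral over the boundary. *)
Lemma trace_ae_summable : N u < +oo ->
  {ae nu, forall z : borel X, (~` Omega) z ->
    \sum_(0 <= j <oo) (lam ^+ j)%:E * W j u z < +oo}.
Proof.
move=> Noo.
have mW j : measurable_fun setT (mean_oscillation Omega mu p u (sc j) : borel X -> \bar R).
  exact: (measurable_mean_oscillation p oO dO mu0 dbl mu_ (sc0 j)).
have lW0 j z : 0 <= (lam ^+ j)%:E * W j u z by rewrite mule_ge0// mean_oscillation_ge0.
have mS : measurable_fun (~` Omega : set (borel X)) (fun z : borel X =>
    \sum_(0 <= j <oo) (lam ^+ j)%:E * W j u (z : X)).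
  apply: ge0_emeasurable_sum => [j z _ _|j _]; first exact: lW0.
  by apply: measurable_funeM; exact: (measurable_funS measurableT _ (mW j)).
have iS : nu.-integrable (~` Omega : set (borel X)) (fun z : borel X =>
    \sum_(0 <= j <oo) (lam ^+ j)%:E * W j u (z : X)).
  apply/integrableP; split => //.
  rewrite (eq_integral (fun z : borel X =>
    \sum_(0 <= j <oo) (lam ^+ j)%:E * W j u (z : X))); last first.
    by move=> z _; rewrite gee0_abs// nneseries_ge0.
  have := integral_mean_oscillation_sum p oO dO mu0 nu0 Cmu1 dbl Cth1 theta0 cod
    D0 diamD lam1 mu_ 0%N.
  move=> /le_lt_trans; apply.
  apply: lte_mul_pinfty => //; last exact: multiscale_lty.
  by rewrite lee_fin; exact: trace_const_ge0.
have := integrable_ae mOc iS.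
apply: filterS => z Sz Oz; have := Sz Oz.
by rewrite ge0_fin_numE// nneseries_ge0.
Qed.

End function.
End trace_Lp.

(** * Convergence, locality and linearity of the trace *)

Lemma mean_linear d (T : measurableType d) (R : realType)
    (m : {measure set T -> \bar R}) (B : set T) (c : R) (u v : T -> R) :
  measurable B -> m.-integrable B (EFin \o u) -> m.-integrable B (EFin \o v) ->
  mean m B (fun x => c * u x + v x) = c * mean m B u + mean m B v.
Proof.
move=> mB iu iv; rewrite /mean.
have icu : m.-integrable B (EFin \o (fun x => c * u x)).
  by apply: (eq_integrable _ (fun x => (c%:E * (EFin \o u) x)%E)) => //; exact: integrableZl.
rewrite RintegralD// RintegralZl//.
by rewrite mulrDr; congr (_ + _); rewrite mulrCA.
Qed.

Lemma ae_eq_mean d (T : measurableType d) (R : realType)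
    (m : {measure set T -> \bar R}) (B : set T) (u v : T -> R) :
  measurable B -> measurable_fun B u -> measurable_fun B v ->
  {ae m, forall x, B x -> u x = v x} -> mean m B u = mean m B v.
Proof.
move=> mB mu mv uv; rewrite /mean /Rintegral; congr (_ * fine _).
apply: ae_eq_integral => //; try exact/measurable_EFinP.
by apply: filterS uv => x uvx Bx; rewrite uvx.
Qed.

Section trace_properties.
Context {R : realType} {X : completeMetricType R}.
Local Open Scope ereal_scope.
Variables (Omega : set X) (mu : {measure set (borel X) -> \bar R}).
Variables (Cmu p lam D : R).
Hypotheses (oO : open Omega) (dO : dense Omega).
Hypotheses (mu0 : mu (~` Omega) = 0).
Hypotheses (Cmu1 : (1 <= Cmu)%R) (dbl : doubling Omega mu Cmu).
Hypotheses (D0 : (0 < D)%R) (p1 : (1 <= p)%R) (lam1 : (1 < lam)%R).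

Local Notation T := (trace Omega mu D).
Local Notation Bo z r := (ball z r `&` Omega).
Local Notation sc := (scale D).
Local Notation av k u z := (mean mu (Bo z (sc k)) u).
Local Notation W k u z := (mean_oscillation Omega mu p u (sc k) z).

Let p0 : (0 < p)%R. Proof. exact: lt_le_trans p1. Qed.
Let lam0 : (0 < lam)%R. Proof. exact: lt_trans lam1. Qed.
Let sc0 k : (0 < sc k)%R. Proof. exact: scale_gt0. Qed.
Let lamE n : 0 <= (lam ^+ n)%:E.
Proof. by rewrite lee_fin exprn_ge0// ltW. Qed.

Let mO : measurable (Omega : set (borel X)).
Proof. exact: measurable_open_borel. Qed.

Let mBo (z : X) (r : R) : measurable (Bo z r : set (borel X)).
Proof. by apply: measurableI => //; exact: measurable_ball_borel. Qed.

Let V_gt0 (z : X) (r : R) : (0 < r)%R -> 0 < mu (Bo z r).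
Proof. exact: doubling_ball_gt0 oO dO dbl z r. Qed.

Let V_lty (z : X) (r : R) : (0 < r)%R -> mu (Bo z r) < +oo.
Proof. exact: doubling_ball_lty oO dO dbl z r. Qed.

Lemma trace_limE (u : borel X -> R) (z : X) (l : R) :
  (fun k => av k u z) @ \oo --> l -> T u z = l.
Proof.
move=> ul; rewrite /trace (_ : limn_esup _ = l%:E)//.
have cE : (fun k => (av k u z)%:E) @ \oo --> l%:E by apply: cvg_EFin ul; near=> k.
by rewrite is_cvg_limn_esupE; [exact/cvg_lim|apply/cvg_ex; exists l%:E].
Unshelve. all: by end_near. Qed.

Lemma trace_ae_eq (u v : borel X -> R) :
  measurable_fun (Omega : set (borel X)) u ->
  measurable_fun (Omega : set (borel X)) v ->
  {ae mu, forall x, Omega x -> u x = v x} -> T u = T v.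
Proof.
move=> mu_ mv_ uv; apply/funext => z; congr (fine (limn_esup _)).
apply/funext => k; congr _%:E; apply: ae_eq_mean => //.
- by apply: (measurable_funS mO _ mu_); exact: subIsetr.
- by apply: (measurable_funS mO _ mv_); exact: subIsetr.
- have Ff := @ae_filter_ringOfSetsType _ (borel X) R mu.
  by apply: (@filterS _ _ Ff) uv => x uvx [_ /uvx].
Qed.

Section function.
Variable u : borel X -> R.
Hypothesis Lu : Lp Omega mu p u.

Let mu_ : measurable_fun (Omega : set (borel X)) u. Proof. by case: Lu. Qed.
Let iu := Lp_ball_integrable oO dO dbl p1 Lu.

Lemma trace_cvg (z : X) :
  \sum_(0 <= j <oo) (lam ^+ j)%:E * W j u z < +oo ->
  (fun k => av k u z) @ \oo --> T u z.
Proof.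
move=> Woo.
by have [] := trace_approximation oO dO mu0 Cmu1 dbl D0 p1 lam1 mu_ iu (n := 0%N) Woo.
Qed.

Let bm_const : R :=
  (Cmu ^+ 4 * (2 `^ p * (2 `^ p * Cmu ^+ 4 + dist_const Cmu p lam)))%R.

Let tail (z : X) k := \sum_(k <= j <oo) (lam ^+ j)%:E * W j u z.

Let W0 k z : 0 <= W k u z. Proof. exact: mean_oscillation_ge0. Qed.
Let lW0 k z : 0 <= (lam ^+ k)%:E * W k u z. Proof. exact: mule_ge0. Qed.

Let le1X n : (1 <= lam ^+ n)%R.
Proof. by apply: exprn_ege1; exact: ltW. Qed.

Let tailE z k :
  tail z k = \sum_(0 <= j <oo) (lam ^+ (j + k))%:E * W (j + k)%N u z.
Proof. by rewrite (@nneseries_addn _ (fun j => (lam ^+ j)%:E * W j u z)). Qed.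

Let tail_sum z k :
  \sum_(0 <= j <oo) (lam ^+ j)%:E * W (k + j)%N u z <= tail z k.
Proof.
rewrite tailE; apply: lee_nneseries => [j _ _|j _]; first exact: mule_ge0.
have kj : (k + j)%N = (j + k)%N by exact: addnC.
rewrite kj; apply: lee_wpmul2r; first exact: W0.
rewrite lee_fin exprD.
have lj0 : (0 <= lam ^+ j)%R by apply: exprn_ge0; exact: ltW.
by rewrite ler_peMr.
Qed.

Let tail_term z k : W k u z <= tail z k.
Proof.
rewrite tailE; apply: (@le_trans _ _ ((lam ^+ (0 + k))%:E * W (0 + k)%N u z)).
  by rewrite add0n; apply: lee_pemull; [exact: W0|rewrite lee_fin].
apply: (@nneseries_term R (fun j => (lam ^+ (j + k))%:E * W (j + k)%N u z) 0%N).
by move=> j; exact: lW0.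
Qed.

Let mup (c : R) (z : X) k :
  measurable_fun (Bo z (sc k) : set (borel X)) (fun y => (`|u y - c| `^ p)%:E).
Proof.
apply/measurable_EFinP; apply: (measurableT_comp (measurable_powR p)).
apply: (measurableT_comp (@normr_measurable R setT)) => //.
apply: measurable_funB; last exact: measurable_cst.
by apply: (measurable_funS mO _ mu_); exact: subIsetr.
Qed.

(** Both the distance from [u] to its mean at scale k and the distance from this
    mean to [T u z] are controlled by the terms of index at least k. *)
Let ball_mean_tail (z : X) k (r : R) : (0 < r)%R ->
  (sc k.+1 < r <= sc k)%R ->
  ball_mean Omega mu p u (T u z) z r <= bm_const%:E * tail z k.
Proof.
move=> r0 /andP[kr rk].
have dc0 : (0 <= dist_const Cmu p lam)%R.
  by apply: mulr_ge0; [exact/ltW/geometric_const_gt0|exact: sqr_ge0].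
have Cmu_ge0 : (0 <= Cmu)%R by exact: le_trans Cmu1.
have tail0 : 0 <= tail z k by apply: le_trans (tail_term z k).
have pow0 (x : R) : 0 <= (`|x| `^ p)%:E by rewrite lee_fin powR_ge0.
have C4 : (0 <= Cmu ^+ 4)%R by exact: exprn_ge0.
rewrite /bm_const EFinM -muleA.
apply: (@le_trans _ _ ((Cmu ^+ 4)%:E * ball_mean Omega mu p u (T u z) z (sc k))).
  apply: average_enlarge => //.
  - by apply: setSI; exact: le_ball.
  - exact: V_gt0.
  - exact: V_lty.
  apply: (@le_trans _ _ (mu (Bo z (4 * r)))).
    apply: le_measure; [exact: mem_set|exact: mem_set|].
    apply: setSI; apply: le_ball.
    by move: kr; rewrite -(scaleS D k); lra.
  by apply: (doubling_shift oO dO Cmu1 dbl) => //; apply: ballxx; rewrite mulr_gt0.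
rewrite lee_wpmul2l// EFinM -muleA.
apply: (@le_trans _ _ (average mu (Bo z (sc k)) (fun y => (2 `^ p)%:E *
    ((`|u y - av k u z| `^ p)%:E + cst (`|T u z - av k u z| `^ p)%:E y)))).
  apply: le_average => // y _.
  rewrite /= -EFinD -EFinM lee_fin.
  apply: le_trans (powRD_le2 p0 _ _) => //.
  apply: ge0_ler_powR; rewrite ?nnegrE ?(ltW p0) ?addr_ge0//.
  rewrite (_ : u y - T u z = (u y - av k u z) - (T u z - av k u z))%R; last by ring.
  exact: ler_normB.
rewrite averageZl ?powR_ge0//; last 2 first.
- by apply: emeasurable_funD; [exact: mup|exact: measurable_cst].
- by move=> y _; apply: adde_ge0; exact: pow0.
rewrite lee_wpmul2l ?lee_fin ?powR_ge0//.
rewrite averageD//; last by move=> y _; exact: pow0.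
have -> : average mu (Bo z (sc k)) (fun y => cst (`|T u z - av k u z| `^ p)%:E y) =
    (`|T u z - av k u z| `^ p)%:E.
  by apply: average_cst => //; [exact: V_gt0|exact: V_lty].
rewrite EFinD ge0_muleDl ?lee_fin ?mulr_ge0 ?powR_ge0//; apply: leeD.
  apply: (le_trans (ball_mean_mean_le oO dO mu0 Cmu1 dbl p1 mu_ iu z (sc0 k))).
  apply: lee_wpmul2l; last exact: tail_term.
  by rewrite lee_fin; apply: mulr_ge0 => //; exact: powR_ge0.
apply: (le_trans (trace_dist oO dO mu0 Cmu1 dbl D0 p1 lam1 mu_ iu z k)).
by apply: lee_wpmul2l; [rewrite lee_fin|exact: tail_sum].
Qed.

(** At radius r the mean is bounded by a tail of a convergent series, whose
    first index tends to infinity as r tends to 0. *)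
Lemma trace_ball_mean_cvg (z : X) :
  \sum_(0 <= j <oo) (lam ^+ j)%:E * W j u z < +oo ->
  ball_mean Omega mu p u (T u z) z r @[r --> (0:R)^'+] --> 0.
Proof.
move=> Woo.
have tail_cvg : tail z @ \oo --> 0 by apply: nneseries_tail_cvg => // k _; exact: lW0.
have small (e : R) : (0 < e)%R -> \forall r \near (0:R)^'+,
    0 <= ball_mean Omega mu p u (T u z) z r < e%:E.
  move=> e0.
  have bm0 r : 0 <= ball_mean Omega mu p u (T u z) z r.
    by apply: average_ge0 => y _; rewrite lee_fin powR_ge0.
  pose c : R := (`|bm_const| + 1)%R.
  have c0 : (0 < c)%R by rewrite ltr_wpDl.
  have ec0 : (0 < e / c)%R by rewrite divr_gt0.
  have tn0 k : 0 <= tail z k by apply: nneseries_ge0 => j _ _; exact: lW0.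
  have [n _ nt] : \forall k \near \oo, tail z k < (e / c)%:E.
    have /fine_cvgP[tfin tc] := tail_cvg.
    have /cvgrPdist_lt/(_ _ ec0) te := tc.
    near=> k.
    have kf : tail z k \is a fin_num by near: k.
    rewrite -(fineK kf) lte_fin.
    have : (`|0 - fine (tail z k)| < e / c)%R by near: k.
    by rewrite sub0r normrN ger0_norm// fine_ge0.
  near=> r.
  have r0 : (0 < r)%R by near: r; exact: nbhs_right_gt.
  have rn : (r < sc n.+1)%R by near: r; exact: nbhs_right_lt.
  have r2D : (r <= 2 * D)%R by apply: (le_trans (ltW rn)); exact: scaleS_le.
  have [k kr] := ex_scale_small r0 r2D.
  have nk : (n <= k.+1)%N.
    rewrite leqNgt; apply/negP => kn; case/andP: kr => kr _.
    have := lt_trans kr rn; rewrite ltNge => /negP; apply.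
    by apply: scale_anti => //; exact: ltnW.
  rewrite bm0 /=; apply: (le_lt_trans (ball_mean_tail z r0 kr)).
  have tk := nt _ nk; rewrite /= in tk.
  apply: (@le_lt_trans _ _ (c%:E * tail z k.+1)).
    rewrite lee_wpmul2r// lee_fin /c (le_trans (ler_norm _))//.
    by rewrite lerDl.
  by rewrite muleC -lte_pdivlMr.
apply/fine_cvgP; split.
  have := small 1%R ltr01; apply: filterS => r /andP[h1 h2].
  by rewrite ge0_fin_numE//; apply: lt_trans h2 _; exact: ltry.
apply/cvgrPdist_lt => e e0; have := small e e0; apply: filterS => r /andP[h1 h2].
have hf : ball_mean Omega mu p u (T u z) z r \is a fin_num.
  by rewrite ge0_fin_numE//; apply: lt_trans h2 _; exact: ltry.
rewrite /= sub0r normrN ger0_norm ?fine_ge0//.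
by rewrite -lte_fin fineK.
Unshelve. all: by end_near. Qed.

End function.

Lemma trace_linear (c : R) (u v : borel X -> R) (z : X) :
  Lp Omega mu p u -> Lp Omega mu p v ->
  \sum_(0 <= j <oo) (lam ^+ j)%:E * W j u z < +oo ->
  \sum_(0 <= j <oo) (lam ^+ j)%:E * W j v z < +oo ->
  T (fun x => c * u x + v x)%R z = (c * T u z + T v z)%R.
Proof.
move=> Lu Lv Wu Wv; apply: trace_limE.
have iu := Lp_ball_integrable oO dO dbl p1 Lu z.
have iv := Lp_ball_integrable oO dO dbl p1 Lv z.
rewrite (_ : (fun k => _) = (fun k => c * av k u z + av k v z)%R); last first.
  apply/funext => k; apply: mean_linear => //; [exact: iu|exact: iv].
apply: cvgD; last exact: (trace_cvg Lv Wv).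
apply: cvgM; first exact: cvg_cst.
exact: (trace_cvg Lu Wu).
Qed.

End trace_properties.

(** * The trace operator *)

Definition trace_seminorm_const (R : realType) (Cmu Cth p al theta : R)
    (q : \bar R) : R :=
  if q is s%:E then
    (trace_integral_const Cmu Cth p al theta s *
     trace_sum_const Cmu p al theta s) `^ s^-1
  else boundary_weak_const Cmu Cth p al theta q `^ p^-1.

Section main.
Context {R : realType} {X : completeMetricType R}.
Local Open Scope ereal_scope.
Variables (Omega : set X) (mu nu : {measure set (borel X) -> \bar R}).
Variables (Cmu Cth p al theta D : R) (q : \bar R).
Hypotheses (oO : open Omega) (dO : dense Omega).
Hypotheses (mu0 : mu (~` Omega) = 0) (nu0 : nu Omega = 0).
Hypotheses (Cmu1 : (1 <= Cmu)%R) (dbl : doubling Omega mu Cmu).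
Hypotheses (Cth1 : (1 <= Cth)%R) (theta0 : (0 < theta)%R).
Hypothesis (cod : codim_regular Omega mu nu theta Cth).
Hypotheses (D0 : (0 < D)%R) (diamD : diam (~` Omega) = D%:E).
Hypotheses (p1 : (1 <= p)%R) (al0 : (0 < al)%R) (q1 : 1 <= q).
Hypothesis (al'0 : (0 < al - theta / p)%R).

Local Notation al' := (al - theta / p)%R.
Local Notation T := (trace Omega mu D).
Local Notation C1 := (trace_seminorm_const Cmu Cth p al theta q).
Local Notation C2 := (trace_Lp_const Cmu Cth p al theta D q).

Let p0 : (0 < p)%R. Proof. exact: lt_le_trans p1. Qed.

Let beta0 : (0 < al * p - theta)%R.
Proof.
have -> : (al * p - theta = al' * p)%R by rewrite mulrBl divfK// gt_eqF.
exact: mulr_gt0.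
Qed.

Let lam1 : (1 < 2 `^ ((al * p - theta) / 2))%R.
Proof. by apply: pow2_gt1; rewrite divr_gt0. Qed.

Let mO : measurable (Omega : set (borel X)).
Proof. exact: measurable_open_borel. Qed.

Let mOc : measurable (~` Omega : set (borel X)).
Proof. exact: measurableC. Qed.

Let Lp_besov u : besov Omega mu al p q u -> Lp Omega mu p u.
Proof. by case. Qed.

Let seminorm_lty u : besov Omega mu al p q u ->
  besov_seminorm Omega mu al p q u < +oo.
Proof. by case=> -[]. Qed.

Let C1_ge0 : (0 <= C1)%R.
Proof. by rewrite /trace_seminorm_const; case: q => [s| |]; exact: powR_ge0. Qed.

Let C2_ge0 : (0 <= C2)%R.
Proof. exact: powR_ge0. Qed.

Lemma trace_seminorm_le u : besov Omega mu al p q u ->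
  besov_seminorm (~` Omega) nu al' p q (T u) <=
    C1%:E * besov_seminorm Omega mu al p q u.
Proof.
move=> bu; have Lu := Lp_besov bu; have [mu_ _] := Lu.
have iu := Lp_ball_integrable oO dO dbl p1 Lu.
move: q1; rewrite /trace_seminorm_const; case: q => [s| |]// q1'.
  exact: (boundary_besov_finite oO dO mu0 nu0 Cmu1 dbl Cth1 theta0 cod D0 diamD
    p1 al0 al'0 mu_ iu q1').
exact: (boundary_besov_infty oO dO mu0 nu0 Cmu1 dbl Cth1 theta0 cod D0 diamD
  p1 al0 q1' al'0 mu_ iu).
Qed.

Lemma trace_Lp_le u : besov Omega mu al p q u ->
  Lp_norm (~` Omega) nu p (T u) <=
    C2%:E * (Lp_norm Omega mu p u + besov_seminorm Omega mu al p q u).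
Proof.
move=> bu; exact: (trace_Lp_norm_le oO dO mu0 nu0 Cmu1 dbl Cth1 theta0 cod D0
  diamD p1 al0 q1 beta0 (Lp_besov bu)).
Qed.

Lemma trace_besov u : besov Omega mu al p q u ->
  besov (~` Omega) nu al' p q (T u).
Proof.
move=> bu; have Lu := Lp_besov bu; have [mu_ Loo] := Lu.
have Noo := seminorm_lty bu.
have mT : measurable_fun (~` Omega : set (borel X)) (T u).
  apply: (measurable_funS measurableT) => //.
  exact: (measurable_trace oO dO mu0 dbl D0 mu_).
have LT : Lp (~` Omega) nu p (T u).
  split=> //; apply: (le_lt_trans (trace_Lp_le bu)).
  by apply: lte_mul_pinfty => //; exact: lte_add_pinfty.
split=> //; split; last first.
  by apply: (le_lt_trans (trace_seminorm_le bu)); exact: lte_mul_pinfty.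
split=> // z Oz; exists 1%R => //.
apply: (Lp_integrable mOc p1) => //.
  by apply: measurableI => //; exact: measurable_ball_borel.
exact: (boundary_ball_lty oO dO dbl Cth1 cod D0 diamD).
Qed.

Lemma trace_norm_le u : besov Omega mu al p q u ->
  besov_norm (~` Omega) nu al' p q (T u) <=
    (C1 + C2)%:E * besov_norm Omega mu al p q u.
Proof.
move=> bu; rewrite /besov_norm EFinD ge0_muleDl ?lee_fin//; apply: leeD.
  apply: (le_trans (trace_seminorm_le bu)); rewrite lee_wpmul2l ?lee_fin//.
  by rewrite leeDl// Lp_norm_ge0.
by apply: (le_trans (trace_Lp_le bu)); rewrite [X in _ * X]addeC.
Qed.

Let summable u : besov Omega mu al p q u -> {ae nu, forall z : borel X, (~` Omega) z ->
    \sum_(0 <= j <oo) ((2 `^ ((al * p - theta) / 2)) ^+ j)%:E *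
      mean_oscillation Omega mu p u (scale D j) z < +oo}.
Proof.
move=> bu; exact: (trace_ae_summable oO dO mu0 nu0 Cmu1 dbl Cth1 theta0 cod D0
  diamD p1 al0 q1 beta0 (Lp_besov bu) (seminorm_lty bu)).
Qed.

Lemma trace_besov_linear c u v :
  besov Omega mu al p q u -> besov Omega mu al p q v ->
  {ae nu, forall z, (~` Omega) z ->
    T (fun x => c * u x + v x)%R z = (c * T u z + T v z)%R}.
Proof.
move=> bu bv; have Ff := @ae_filter_ringOfSetsType _ (borel X) R nu.
apply: (@filterS2 _ _ Ff _ _ _ _ (summable bu) (summable bv)) => z su sv Oz.
exact: (trace_linear oO dO mu0 Cmu1 dbl D0 p1 lam1 c (Lp_besov bu) (Lp_besov bv)
  (su Oz) (sv Oz)).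
Qed.

Lemma trace_besov_cvg u : besov Omega mu al p q u ->
  {ae nu, forall z, (~` Omega) z ->
    ball_mean Omega mu p u (T u z) z r @[r --> 0^'+] --> 0}.
Proof.
move=> bu; have Ff := @ae_filter_ringOfSetsType _ (borel X) R nu.
apply: (@filterS _ _ Ff _ _ _ (summable bu)) => z su Oz.
exact: (trace_ball_mean_cvg oO dO mu0 Cmu1 dbl D0 p1 lam1 (Lp_besov bu) (su Oz)).
Qed.

Lemma trace_bounded_linear :
  bounded_linear_besov Omega mu al (~` Omega) nu al' p q T.
Proof.
split.
- exact: trace_besov.
- move=> u v bu bv uv.
  have [mu_ _] := Lp_besov bu; have [mv_ _] := Lp_besov bv.
  rewrite (trace_ae_eq D oO mu_ mv_ uv).
  have Ff := @ae_filter_ringOfSetsType _ (borel X) R nu.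
  by apply: (@filterS _ _ Ff setT); [|exact: filterT].
- exact: trace_besov_linear.
- by exists (C1 + C2)%R; [exact: addr_ge0|exact: trace_norm_le].
Qed.

End main.

Theorem theorem1p4 (R : realType) (al p theta : R) (q : \bar R)
    (al_gt0 : 0 < al) (al_lt1 : al < 1) (p_ge1 : 1 <= p) (q_ge1 : (1 <= q)%E)
    (theta_gt0 : 0 < theta)
    (al'_gt0 : 0 < al - theta / p) (al'_lt1 : al - theta / p < 1) :
  exists (C1 : R -> R -> R -> R) (C : R -> R -> R -> R),
    (forall Cmu Cth A, 1 <= C1 Cmu Cth A) /\
    (forall Cmu Cth D, 1 <= C Cmu Cth D) /\
    forall (X : completeMetricType R) (Omega : set X)
      (mu nu : {measure set (borel X) -> \bar R}) (Cmu Cth A : R),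
    dense Omega ->
    locally_compact [set: Omega] ->
    ~ complete_subset Omega ->
    mu (~` Omega) = 0%E ->
    nu Omega = 0%E ->
    1 <= Cmu -> doubling Omega mu Cmu ->
    1 <= A -> uniform_domain Omega A ->
    (0 < diam (~` Omega))%E -> (diam (~` Omega) < +oo)%E ->
    1 <= Cth -> codim_regular Omega mu nu theta Cth ->
    exists T : (borel X -> R) -> (borel X -> R),
      bounded_linear_besov Omega mu al (~` Omega) nu (al - theta / p) p q T /\
      forall u, besov Omega mu al p q u ->
        [/\ {ae nu, forall z, (~` Omega) z ->
              ball_mean Omega mu p u (T u z) z r @[r --> 0^'+] --> 0%E},
            (besov_seminorm (~` Omega) nu (al - theta / p) p q (T u)
             <= (C1 Cmu Cth A)%:E * besov_seminorm Omega mu al p q u)%E &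
            (Lp_norm (~` Omega) nu p (T u)
             <= (C Cmu Cth (fine (diam (~` Omega))))%:E *
                (Lp_norm Omega mu p u + besov_seminorm Omega mu al p q u))%E].
Proof.
exists (fun Cmu Cth _ => Num.max 1 (trace_seminorm_const Cmu Cth p al theta q)),
  (fun Cmu Cth D => Num.max 1 (trace_Lp_const Cmu Cth p al theta D q)).
split; first by move=> *; rewrite le_max lexx.
split; first by move=> *; rewrite le_max lexx.
move=> X Omega mu nu Cmu Cth A dO _ _ mu0 nu0 Cmu1 dbl _ [oO _ _] diam0 diamoo
  Cth1 cod.
pose D := fine (diam (~` Omega)).
have diamD : diam (~` Omega) = D%:E by rewrite fineK// ge0_fin_numE// ltW.
have D0 : 0 < D by rewrite -lte_fin -diamD.
exists (trace Omega mu D); split.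
  exact: (trace_bounded_linear oO dO mu0 nu0 Cmu1 dbl Cth1 theta_gt0 cod D0 diamD
    p_ge1 al_gt0 q_ge1 al'_gt0).
move=> u bu; split.
- exact: (trace_besov_cvg oO dO mu0 nu0 Cmu1 dbl Cth1 theta_gt0 cod D0 diamD
    p_ge1 al_gt0 q_ge1 al'_gt0 bu).
- apply: (le_trans (trace_seminorm_le oO dO mu0 nu0 Cmu1 dbl Cth1 theta_gt0 cod
    D0 diamD p_ge1 al_gt0 q_ge1 al'_gt0 bu)).
  by apply: lee_wpmul2r; [exact: besov_seminorm_ge0|rewrite lee_fin le_max lexx orbT].
- apply: (le_trans (trace_Lp_le oO dO mu0 nu0 Cmu1 dbl Cth1 theta_gt0 cod
    D0 diamD p_ge1 al_gt0 q_ge1 al'_gt0 bu)).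
  apply: lee_wpmul2r; last by rewrite lee_fin le_max lexx orbT.
  by apply: adde_ge0; [exact: Lp_norm_ge0|exact: besov_seminorm_ge0].
Qed.
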